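(* Let $W$ be a Coxeter group with simple generators $S$ and let $\Omega$ be an orientation of its Coxeter diagram $\Gamma$. If $A$ is a nonempty subset of $W$, then $\pi_\downarrow^{\Omega}\left(\bigwedge A\right)=\bigwedge \pi_\downarrow^{\Omega}A$. If $A$ is a subset of $W$ such that $\bigvee A$ exists, then $\pi_\downarrow^{\Omega}\left(\bigvee A\right)=\bigvee \pi_\downarrow^{\Omega}A$. Here $\pi_\downarrow^\Omega A=\{\pi_\downarrow^\Omega(a):a\in A\}$.
   Context: $W$ is a Coxeter group with finite set $S$ of simple generators; $\ell$ is the length function and $e$ the identity. The (right) weak order on $W$ sets $u\le w$ if and only if $\ell(u)+\ell(u^{-1}w)=\ell(w)$. Meets $\bigwedge$ and joins $\bigvee$ are taken in the weak order on $W$; every nonempty subset of $W$ has a meet, and a subset with an upper bound has a join. For $J\subseteq S$, $W_J$ is the standard parabolic subgroup generated by $J$. The Coxeter diagram $\Gamma$ is the graph with vertex set $S$ in which distinct $s,t$ are joined by an edge if and only if they do not commute. $\Omega$ is an arbitrary orientation of $\Gamma$ (each edge is given one direction; directed cycles are allowed). A subset $J\subseteq S$ is $\Omega$-acyclic if the induced subgraph of $\Gamma$ on $J$, oriented by $\Omega$, has no directed cycle. For $\Omega$-acyclic $J$, $c(\Omega,J)=s_1s_2\cdots s_k$, where $s_1,\ldots,s_k$ is any ordering of $J$ such that $i<j$ whenever there is an edge oriented $s_j\to s_i$ (the product does not depend on the ordering; $c(\Omega,\emptyset)=e$). $J(w,\Omega)$ denotes the unique maximal (under inclusion) element among the $\Omega$-acyclic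 subsets $J'\subseteq S$ with $w\ge c(\Omega,J')$ (it is a fact that there is a unique maximal one, which therefore contains all the others). For $w\in W$, $\mathrm{inv}(w)$ is the set of reflections $t$ (conjugates of elements of $S$) with $\ell(tw)<\ell(w)$. For $J\subseteq S$, $w_J$ is the unique element of $W_J$ with $\mathrm{inv}(w_J)=\mathrm{inv}(w)\cap W_J$. The map $\pi_\downarrow^\Omega:W\to W$ is defined recursively by $\pi_\downarrow^\Omega(e)=e$ and, for $w\neq e$, with $J=J(w,\Omega)$, $\pi_\downarrow^{\Omega}(w)=c(\Omega,J)\,\pi_\downarrow^{\Omega}\bigl(c(\Omega,J)^{-1}w_J\bigr)$. *)

(* Defs.v *)
From HB Require Import structures.
From mathcomp Require Import all_boot.
From mathcomp Require Import boolp classical_sets.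

Set Implicit Arguments.
Unset Strict Implicit.
Unset Printing Implicit Defensive.

Local Open Scope classical_set_scope.
Local Open Scope group_scope.

(* A word over the index type S of the simple generators is a [seq S]. *)
Definition wprod (W : groupType) (S : finType) (gen : S -> W) (u : seq S) : W :=
  \prod_(s <- u) gen s.

Definition is_order (W : groupType) (x : W) (m : nat) : Prop :=
  [/\ (0 < m)%N, x ^+ m = 1 & forall k, (0 < k < m)%N -> x ^+ k <> 1].

(* The congruence on words generated by the relations (st)^m(s,t) = 1, where
   m(s,t) is the order of st in W; there is no relation when this order is
   infinite.  For s = t the order is 1 when gen s is an involution, so the
   relation ss = 1 is included, and formal inverses of letters are not needed. *)
Inductive cox_equiv (W : groupType) (S : finType) (gen : S -> W) :
    seq S -> seq S -> Prop :=
| cox_equiv_rel u v s t m :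
    is_order (gen s * gen t) m ->
    cox_equiv gen (u ++ flatten (nseq m [:: s; t]) ++ v) (u ++ v)
| cox_equiv_refl u : cox_equiv gen u u
| cox_equiv_sym u v : cox_equiv gen u v -> cox_equiv gen v u
| cox_equiv_trans u v w :
    cox_equiv gen u v -> cox_equiv gen v w -> cox_equiv gen u w.

(* Coxeter system in the sense of Bourbaki, Lie IV.1.3: the image of gen is a
   generating set of W consisting of elements of order 2, and W is presented by
   these generators and the relations (st)^m(s,t) = 1. *)
Definition coxeter_system (W : groupType) (S : finType) (gen : S -> W) : Prop :=
  [/\ injective gen,
      forall s, is_order (gen s) 2,
      forall w, exists u, wprod gen u = w &
      forall u v, wprod gen u = wprod gen v -> cox_equiv gen u v].

Definition is_length (W : groupType) (S : finType) (gen : S -> W)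
    (w : W) (n : nat) : Prop :=
  (exists2 u, wprod gen u = w & size u = n) /\
  (forall u, wprod gen u = w -> (n <= size u)%N).

Definition cox_length (W : groupType) (S : finType) (gen : S -> W) (w : W) : nat :=
  xget 0%N [set n | is_length gen w n].

Definition weak_le (W : groupType) (S : finType) (gen : S -> W) (u w : W) : Prop :=
  (cox_length gen u + cox_length gen (u^-1 * w))%N = cox_length gen w.

Definition is_meet (W : groupType) (S : finType) (gen : S -> W)
    (A : set W) (m : W) : Prop :=
  (forall a, A a -> weak_le gen m a) /\
  (forall x, (forall a, A a -> weak_le gen x a) -> weak_le gen x m).

Definition is_join (W : groupType) (S : finType) (gen : S -> W)
    (A : set W) (j : W) : Prop :=
  (forall a, A a -> weak_le gen a j) /\
  (forall x, (forall a, A a -> weak_le gen a x) -> weak_le gen j x).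

(* W_J; the generators being involutions, words in J exhaust the subgroup
   generated by J. *)
Definition parabolic (W : groupType) (S : finType) (gen : S -> W)
    (J : {set S}) : set W :=
  [set w | exists2 u : seq S, {subset u <= J} & wprod gen u = w].

Definition reflection (W : groupType) (S : finType) (gen : S -> W) : set W :=
  [set t | exists x s, t = x * gen s * x^-1].

Definition inversions (W : groupType) (S : finType) (gen : S -> W) (w : W) : set W :=
  [set t | reflection gen t /\ (cox_length gen (t * w) < cox_length gen w)%N].

Definition parabolic_part (W : groupType) (S : finType) (gen : S -> W)
    (J : {set S}) (w : W) : W :=
  xget 1 [set x | parabolic gen J x /\
                  inversions gen x = inversions gen w `&` parabolic gen J].

Definition diagram_edge (W : groupType) (S : finType) (gen : S -> W) (s t : S) : Prop :=
  s <> t /\ ~ commute (gen s) (gen t).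

(* [Omega s t] means that there is an edge oriented from s to t. *)
Definition orientation (W : groupType) (S : finType) (gen : S -> W)
    (Omega : rel S) : Prop :=
  (forall s t, diagram_edge gen s t <-> Omega s t \/ Omega t s) /\
  (forall s t, ~ (Omega s t /\ Omega t s)).

Definition omega_acyclic (S : finType) (Omega : rel S) (J : {set S}) : Prop :=
  forall p : seq S, {subset p <= J} -> ucycle Omega p -> p = [::].

Definition omega_ordering (S : finType) (Omega : rel S) (J : {set S}) (u : seq S) : Prop :=
  [/\ uniq u, u =i J &
      forall s t, s \in J -> t \in J -> Omega s t -> (index t u < index s u)%N].

(* Meaningful only for acyclic J. *)
Definition cox_elt (W : groupType) (S : finType) (gen : S -> W)
    (Omega : rel S) (J : {set S}) : W :=
  xget 1 [set c | exists2 u, omega_ordering Omega J u & c = wprod gen u].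

Definition acyclic_below (W : groupType) (S : finType) (gen : S -> W)
    (Omega : rel S) (w : W) (J : {set S}) : Prop :=
  omega_acyclic Omega J /\ weak_le gen (cox_elt gen Omega J) w.

Definition omega_support (W : groupType) (S : finType) (gen : S -> W)
    (Omega : rel S) (w : W) : {set S} :=
  xget finset.set0
    [set J | acyclic_below gen Omega w J /\
             forall K : {set S}, acyclic_below gen Omega w K -> J \subset K -> K = J].

Fixpoint pi_down_rec (W : groupType) (S : finType) (gen : S -> W)
    (Omega : rel S) (n : nat) (w : W) : W :=
  if n is n'.+1 then
    if w == 1 then 1 else
    let J := omega_support gen Omega w in
    let c := cox_elt gen Omega J in
    c * pi_down_rec gen Omega n' (c^-1 * parabolic_part gen J w)
  else 1.

(* For w != 1 the set J is nonempty and c <= w_J <= w, so each recursive call is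
   on a strictly shorter element, and cox_length w steps always reach the identity. *)
Definition pi_down (W : groupType) (S : finType) (gen : S -> W)
    (Omega : rel S) (w : W) : W :=
  pi_down_rec gen Omega (cox_length gen w) w.

(* Main.v *)
From Stdlib Require Import Rtrigo1.
From mathcomp Require Import all_boot all_order all_algebra.
From mathcomp Require Import boolp classical_sets Rstruct.
From mathcomp Require Import zify ring lra.
Require Import Defs.
Set Implicit Arguments.
Unset Strict Implicit.
Unset Printing Implicit Defensive.
Import Order.TTheory GRing.Theory Num.Theory.

(** An element of [W] is encoded by its inversions, seen as positive roots of the
    geometric representation, and the weak order is inclusion of inversions. For an
    acyclic [J], listed as a word [l] compatible with [Omega], the map [pi l] reads [l]
    cyclically: a letter [s] is split off the front of [w] and moved to the end of [l] if
    it is a descent of [w], and is dropped from [l] for good otherwise.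

    The Euler form of [l], half of the invariant bilinear form, is preserved when the
    first letter moves to the end, and its antisymmetrization [omega] says in which order
    [l] meets two roots. The opposite of each inversion of [pi l w] is a nonnegative
    combination of the roots at which a letter is dropped, which makes [pi l] order
    preserving; its fixed points are the elements aligned with [omega]. Meets of
    fixed points are fixed, by the same recursion, so that [pi l], which is also
    decreasing and idempotent, respects meets.
    For joins, if [pi l] identifies the ends of a bottom edge of a polygon of the weak
    order then it identifies the ends of the opposite side, and induction along chains
    does the rest.

    For a general [Omega], two acyclic sets [J'] with [c(Omega, J') <= w] have an acyclic
    union, for a directed cycle in it would give two inversions of [w] spanning an infinite
    dihedral subsystem. Hence [J(w, Omega)] exists, and [pi_down] coincides with [pi l] below
    [w] for [l] a word of [J(w, Omega)]. *)

(* [pi_down] changes its set of letters at every call, whereas [pi] keeps one word, so each argument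
   becomes an induction on length plus word size whose only moves are a rotation and the loss of the
   first letter. The recurring obstacle is a cover [u] < [gen s * u] where the first letter [s] is a
   descent of the larger element only: one computation goes on with [l], the other with [rcons l s].
   What relates the two is extremality. A positive combination of positive roots that equals a
   simple root involves no other root; so once [simple s] lies in the cone of the dropped roots, and
   the inverse of [u] sends it to a simple root, it is itself a dropped root. Since [W] may be
   infinite, no longest element exchanges meets with joins, or lower edges of polygons with upper
   ones, and the two halves are proved separately. Below a join a single word serves. For a meet the
   words of the elements differ, and the argument runs on their common letters. The field [R] stays
   abstract: only numbers with the Chebyshev properties of 2 cos(pi/m) are needed, and real analysis
   enters with them at the end. *)
Existing Class coxeter_system.

(** * Length *)

Section Length.
Local Open Scope group_scope.
Context {W : groupType} {S : finType} {gen : S -> W} {coxW : coxeter_system gen}.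
Local Notation len := (cox_length gen).
Local Notation wp := (wprod gen).

Lemma wprod_cons s u : wp (s :: u) = gen s * wp u.
Proof. by rewrite /wprod big_cons. Qed.
Lemma wprod_cat u v : wp (u ++ v) = wp u * wp v.
Proof. by rewrite /wprod big_cat. Qed.
Lemma wprod_nil : wp [::] = 1.
Proof. by rewrite /wprod big_nil. Qed.

Lemma gen_sq s : gen s * gen s = 1.
Proof. by case: coxW => _ /(_ s) [_ + _] _ _; rewrite expg2. Qed.
Lemma gen_inv s : (gen s)^-1 = gen s.
Proof. by apply: (mulgI (gen s)); rewrite mulgV gen_sq. Qed.
Lemma genK s w : gen s * (gen s * w) = w.
Proof. by rewrite mulgA gen_sq mul1g. Qed.
Lemma mulgenK s w : w * gen s * gen s = w.
Proof. by rewrite -mulgA gen_sq mulg1. Qed.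
Lemma gen_neq1 s : gen s <> 1.
Proof. by case: coxW => _ /(_ s) [_ _ /(_ 1%N isT)] + _ _; rewrite expg1. Qed.

Lemma len_is_length w : is_length gen w (len w).
Proof.
apply: (@xgetPex _ 0%N [set n | is_length gen w n]%classic).
case: coxW => _ _ /(_ w) [u0 u0w] _.
have ex : exists n, `[< exists2 u, wp u = w & size u = n >].
  by exists (size u0); apply/asboolP; exists u0.
exists (ex_minn ex); case: ex_minnP => n /asboolP nP nmin; split=> // u uw.
by apply: nmin; apply/asboolP; exists u.
Qed.

Lemma len_word w : exists2 u, wp u = w & size u = len w.
Proof. by case: (len_is_length w). Qed.

Lemma len_wprod u : (len (wp u) <= size u)%N.
Proof. by case: (len_is_length (wp u)) => _; apply. Qed.

Lemma len1 : len 1 = 0%N.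
Proof. by apply/eqP; rewrite -leqn0 -wprod_nil len_wprod. Qed.

Lemma len_eq0 w : len w = 0%N -> w = 1.
Proof. by have [[|s u] <- <-] := len_word w; rewrite ?wprod_nil. Qed.

Lemma len_mul u v : (len (u * v) <= len u + len v)%N.
Proof.
have [a <- <-] := len_word u; have [b <- <-] := len_word v.
by rewrite -wprod_cat -size_cat len_wprod.
Qed.

Lemma len_gen s : len (gen s) = 1%N.
Proof.
have := len_wprod [:: s]; rewrite wprod_cons wprod_nil mulg1 /=.
case E : (len _) => [|[|//]] // _.
by case: (@gen_neq1 s); apply: len_eq0.
Qed.

Lemma wprod_rev u : wp (rev u) = (wp u)^-1.
Proof.
elim: u => [|s u IH]; first by rewrite wprod_nil invg1.
by rewrite rev_cons -cats1 wprod_cat IH !wprod_cons wprod_nil mulg1 invgM gen_inv.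
Qed.

Lemma len_inv w : len w^-1 = len w.
Proof.
have le x : (len x^-1 <= len x)%N.
  by have [u <- <-] := len_word x; rewrite -wprod_rev -size_rev len_wprod.
by apply/eqP; rewrite eqn_leq le -{1}(invgK w) le.
Qed.

Lemma len_genl s w : (len w <= (len (gen s * w)).+1)%N.
Proof. by rewrite -{1}(genK s w) (leq_trans (len_mul _ _)) // len_gen. Qed.

Lemma len_genr s w : (len w <= (len (w * gen s)).+1)%N.
Proof. by rewrite -{1}(mulgenK s w) (leq_trans (len_mul _ _)) // len_gen addn1. Qed.

Lemma len_pred w : w <> 1 -> exists s, (len (gen s * w) < len w)%N.
Proof.
have [[|s u] <- su] := len_word w; first by rewrite wprod_nil.
by move=> _; exists s; rewrite -su wprod_cons genK ltnS len_wprod.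
Qed.

Lemma len_predr w : w <> 1 -> exists s, (len (w * gen s) < len w)%N.
Proof.
move=> w1; have [|s] := @len_pred w^-1.
  by move=> e; apply: w1; rewrite -(invgK w) e invg1.
by rewrite len_inv -{1}(gen_inv s) -invgM len_inv; exists s.
Qed.

End Length.

Local Open Scope ring_scope.

(** * The geometric representation *)

Section Vectors.
Variables (S : finType) (R : realFieldType).
Local Notation V := {ffun S -> R}.

Definition scal (c : R) (x : V) : V := [ffun i => c * x i].
Definition simple (s : S) : V := [ffun i => (i == s)%:R].
Definition bil (G : S -> S -> R) (x y : V) : R :=
  \sum_i \sum_j G i j * x i * y j.
Definition spanned (P : pred S) (x : V) := forall i, ~~ P i -> x i = 0.

Lemma simpleE s i : simple s i = (i == s)%:R.
Proof. by rewrite ffunE. Qed.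
Lemma simple_id s : simple s s = 1.
Proof. by rewrite simpleE eqxx. Qed.
Lemma scalE c x i : scal c x i = c * x i.
Proof. by rewrite ffunE. Qed.
Lemma addvE (x y : V) i : (x + y) i = x i + y i.
Proof. by rewrite ffunE. Qed.
Lemma oppvE (x : V) i : (- x) i = - x i.
Proof. by rewrite ffunE. Qed.
Lemma zerovE i : (0 : V) i = 0.
Proof. by rewrite ffunE. Qed.
Definition vE := (addvE, oppvE, zerovE, scalE, simpleE).

Lemma scal0 x : scal 0 x = 0.
Proof. by apply/ffunP=> i; rewrite !vE mul0r. Qed.
Lemma scal1 x : scal 1 x = x.
Proof. by apply/ffunP=> i; rewrite !vE mul1r. Qed.

Section Form.
Variable G : S -> S -> R.
Lemma bilDl x y z : bil G (x + y) z = bil G x z + bil G y z.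
Proof.
rewrite /bil -big_split; apply: eq_bigr => i _; rewrite -big_split.
by apply: eq_bigr => j _ /=; rewrite !vE; ring.
Qed.
Lemma bilDr x y z : bil G x (y + z) = bil G x y + bil G x z.
Proof.
rewrite /bil -big_split; apply: eq_bigr => i _; rewrite -big_split.
by apply: eq_bigr => j _ /=; rewrite !vE; ring.
Qed.
Lemma bilZl c x z : bil G (scal c x) z = c * bil G x z.
Proof.
rewrite /bil mulr_sumr; apply: eq_bigr => i _; rewrite mulr_sumr.
by apply: eq_bigr => j _ /=; rewrite !vE; ring.
Qed.
Lemma bilZr c x z : bil G x (scal c z) = c * bil G x z.
Proof.
rewrite /bil mulr_sumr; apply: eq_bigr => i _; rewrite mulr_sumr.
by apply: eq_bigr => j _ /=; rewrite !vE; ring.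
Qed.
Lemma scalN1 (x : V) : - x = scal (-1) x.
Proof. by apply/ffunP=> i; rewrite !vE mulN1r. Qed.
Lemma bilNl x z : bil G (- x) z = - bil G x z.
Proof. by rewrite scalN1 bilZl mulN1r. Qed.
Lemma bilNr x z : bil G x (- z) = - bil G x z.
Proof. by rewrite scalN1 bilZr mulN1r. Qed.
Definition bilE := (bilDl, bilDr, bilNl, bilNr, bilZl, bilZr).
Lemma bil_simplel s y : bil G (simple s) y = \sum_j G s j * y j.
Proof.
rewrite /bil (bigD1 s) //= [X in _ + X]big1 ?addr0 => [|i /negPf is'].
  by apply: eq_bigr => j _; rewrite simple_id mulr1.
by rewrite big1 // => j _; rewrite simpleE is' mulr0 mul0r.
Qed.
Lemma bil_simpler x s : bil G x (simple s) = \sum_i G i s * x i.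
Proof.
rewrite /bil; apply: eq_bigr => i _.
rewrite (bigD1 s) //= [X in _ + X]big1 ?addr0 => [|j /negPf js]; first by rewrite simple_id mulr1.
by rewrite simpleE js mulr0.
Qed.
Lemma bil_simple s t : bil G (simple s) (simple t) = G s t.
Proof.
rewrite bil_simplel (bigD1 t) //= [X in _ + X]big1 ?addr0 => [|j /negPf js].
  by rewrite simple_id mulr1.
by rewrite simpleE js mulr0.
Qed.
End Form.

Lemma bil_sym (G : S -> S -> R) : (forall s t, G s t = G t s) ->
  forall x y, bil G x y = bil G y x.
Proof.
move=> Gs x y; rewrite /bil exchange_big; apply: eq_bigr => i _.
by apply: eq_bigr => j _; rewrite Gs; ring.
Qed.

Lemma eq_bil (G H : S -> S -> R) (P : pred S) x y :
  (forall i j, P i -> P j -> G i j = H i j) -> spanned P x -> spanned P y ->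
  bil G x y = bil H x y.
Proof.
move=> GH Px Py; rewrite /bil; apply: eq_bigr => i _; apply: eq_bigr => j _.
have [Pi|/Px->] := boolP (P i); last by rewrite !mulr0 !mul0r.
have [Pj|/Py->] := boolP (P j); last by rewrite !mulr0.
by rewrite GH.
Qed.

Lemma spanned_simple (P : pred S) s : P s -> spanned P (simple s).
Proof. by move=> Ps i; rewrite simpleE; case: eqP => // ->; rewrite Ps. Qed.
Lemma spannedD (P : pred S) x y : spanned P x -> spanned P y -> spanned P (x + y).
Proof. by move=> Px Py i Pi; rewrite vE Px ?Py // addr0. Qed.
Lemma spannedZ (P : pred S) c x : spanned P x -> spanned P (scal c x).
Proof. by move=> Px i Pi; rewrite vE Px ?mulr0. Qed.
Lemma spannedN (P : pred S) x : spanned P x -> spanned P (- x).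
Proof. by move=> Px i Pi; rewrite vE Px ?oppr0. Qed.
Lemma spannedS (P Q : pred S) x : (forall i, P i -> Q i) -> spanned P x -> spanned Q x.
Proof. by move=> PQ Px i Qi; apply: Px; apply: contra Qi => /PQ. Qed.

End Vectors.
Arguments simple {S R} s.
Arguments spanned {S R} P x.

Section Rep.
Variables (W : groupType) (S : finType) (gen : S -> W).

(** Everything about the representation that the sequel uses. The gap between 0 and -1 in [gram_off]
    comes from 2 cos(pi/m) >= 1 for m >= 3; it is what lets coefficients of roots propagate
    undiminished along directed paths. *)
Record georep (R : realFieldType) := Georep {
  georep_cox : coxeter_system gen;
  gram : S -> S -> R;
  act : W -> {ffun S -> R} -> {ffun S -> R};
  gram_sym : forall s t, gram s t = gram t s;
  gram_diag : forall s, gram s s = 2;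
  gram_off : forall s t, s != t -> (gram s t == 0) || (gram s t <= -1);
  gram_commute : forall s t, s != t -> gram s t = 0 <-> commute (gen s) (gen t);
  act1 : forall x, act 1%g x = x;
  actM : forall u v x, act (u * v)%g x = act u (act v x);
  act_gen : forall s x, act (gen s) x = x - scal (bil gram (simple s) x) (simple s);
  act_pos : forall w s i, (cox_length gen w <= cox_length gen (w * gen s)%g)%N ->
    0 <= act w (simple s) i }.
End Rep.
Existing Class georep.
Existing Instance georep_cox.

(** * Chebyshev values and the first zero of their sequence *)

Section Chebyshev.
Variable R : realFieldType.
Implicit Types (k : R).

(* [cheb (2 cos a) n = sin (n a) / sin a]. *)
Fixpoint cheb k n : R :=
  match n with
  | 0 => 0
  | n'.+1 => match n' with 0 => 1 | n''.+1 => k * cheb k n' - cheb k n'' end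
  end.

Lemma chebSS k n : cheb k n.+2 = k * cheb k n.+1 - cheb k n.
Proof. by []. Qed.

Lemma cheb_shift k m n : cheb k m = 0 -> cheb k (m + n) = cheb k m.+1 * cheb k n.
Proof.
move=> h; suff : cheb k (m + n) = cheb k m.+1 * cheb k n /\
  cheb k (m + n.+1) = cheb k m.+1 * cheb k n.+1 by case.
elim: n => [|n [IH1 IH2]]; first by rewrite addn0 addn1 h /= mulr0 mulr1.
by split=> //; rewrite addnS in IH2; rewrite !addnS chebSS IH2 IH1 chebSS; ring.
Qed.

Lemma cheb_norm k n : cheb k n.+1 ^+ 2 - k * cheb k n.+1 * cheb k n + cheb k n ^+ 2 = 1.
Proof. by elim: n => [|n IH]; [rewrite /=; ring|rewrite chebSS -IH; ring]. Qed.

(** At a zero, [cheb_norm] forces the next value to have square 1, so after 2m steps the initial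
    values 0, 1 return: the product of two reflections has order dividing m on their plane. *)
Lemma cheb_period k m : cheb k m = 0 ->
  cheb k (m + m) = 0 /\ cheb k (m + m).+1 = 1.
Proof.
move=> h; split; first by rewrite cheb_shift // h mulr0.
rewrite -addnS cheb_shift //; have := cheb_norm k m; rewrite h => <-; ring.
Qed.

Lemma cheb2n n : cheb 2 n = n%:R.
Proof.
suff : cheb 2 n = n%:R /\ cheb 2 n.+1 = n.+1%:R by case.
by elim: n => [//|n [IH1 IH2]]; split=> //; rewrite chebSS IH1 IH2 -!natr1; ring.
Qed.

(** For m > 1 this is an algebraic description of k = 2 cos(pi/m): positivity before the first zero
    excludes the other roots 2 cos(j pi/m). *)
Definition chebyshev_zero m k := cheb k m = 0 /\ forall n, (0 < n < m)%N -> 0 < cheb k n.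

Lemma chebyshev_zero2 k : chebyshev_zero 2 k -> k = 0.
Proof. by move=> [+ _]; rewrite chebSS /= mulr1 subr0. Qed.

Lemma chebyshev_zero_ge1 m k : (2 < m)%N -> chebyshev_zero m k -> 1 <= k.
Proof.
move=> m2 [h0 hp].
have k0 : 0 < k by have := hp 2%N m2; rewrite chebSS /= mulr1 subr0.
have : 0 <= k * k - 1.
  have e : cheb k 3 = k * k - 1 by rewrite /=; ring.
  have [lt|ge] := ltnP 3 m; first by rewrite -e ltW // hp.
  by rewrite -e (_ : 3%N = m) ?h0 //; apply/eqP; rewrite eqn_leq m2.
by nra.
Qed.

Lemma chebyshev_zero_ge0 m k : (1 < m)%N -> chebyshev_zero m k -> 0 <= k.
Proof.
move=> m1 h; have [lt|ge] := ltnP 2 m; first by have := chebyshev_zero_ge1 lt h; lra.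
have e : m = 2%N by apply/eqP; rewrite eqn_leq ge.
by subst m; rewrite (chebyshev_zero2 h).
Qed.

Lemma chebyshev_zero_neq2 m k : (1 < m)%N -> chebyshev_zero m k -> 4 - k * k != 0.
Proof.
move=> m1 h; have k0 := chebyshev_zero_ge0 m1 h; apply/eqP => e.
have k2 : k = 2 by nra.
by case: h => + _; rewrite k2 cheb2n => /eqP; rewrite pnatr_eq0 => /eqP e0; rewrite e0 in m1.
Qed.
End Chebyshev.

(** * Construction of the geometric representation *)

Section Existence.
Context {W : groupType} {S : finType} {gen : S -> W} {coxW : coxeter_system gen}.
Variables (R : realFieldType) (kap : nat -> R).
Hypothesis kapP : forall m, (1 < m)%N -> chebyshev_zero m (kap m).
Local Notation V := {ffun S -> R}.
Local Notation len := (cox_length gen).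
Local Notation wp := (wprod gen).
Implicit Types (s t : S) (x : V).

(* [0] when the order is infinite. *)
Definition cox_order s t : nat := xget 0%N [set m | is_order (gen s * gen t)%g m]%classic.

(** Order 0 stands for infinite order; 2 is the limit of 2 cos(pi/m), and there [cheb 2 n] = n stays
    positive. *)
Definition cox_angle m : R := if m == 0%N then 2 else kap m.
Definition cox_gram s t : R := if s == t then 2 else - cox_angle (cox_order s t).

Lemma is_order_inj (x : W) m n : is_order x m -> is_order x n -> m = n.
Proof.
move=> [m0 xm hm] [n0 xn hn]; case: (ltngtP m n) => // lt.
  by case: (hn m) => //; rewrite m0.
by case: (hm n) => //; rewrite n0.
Qed.

Lemma is_orderV (x : W) m : is_order x m -> is_order x^-1%g m.
Proof.
move=> [m0 xm hm]; split=> //; first by rewrite expVgn xm invg1.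
by move=> k km; rewrite expVgn => e; apply: (hm k km); rewrite -(invgK (x ^+ k)%g) e invg1.
Qed.

Lemma is_order_swap s t m : is_order (gen s * gen t)%g m -> is_order (gen t * gen s)%g m.
Proof. by move=> /is_orderV; rewrite invgM !gen_inv. Qed.

Lemma cox_orderE s t m : is_order (gen s * gen t)%g m -> cox_order s t = m.
Proof.
move=> h; have : is_order (gen s * gen t)%g (cox_order s t).
  by apply: (@xgetPex _ 0%N [set m | is_order (gen s * gen t)%g m]%classic); exists m.
by move=> h'; apply: is_order_inj h' h.
Qed.

Lemma cox_order_spec s t : cox_order s t != 0%N -> is_order (gen s * gen t)%g (cox_order s t).
Proof.
have [[m h] _|h] := pselect (exists m, is_order (gen s * gen t)%g m).
  by rewrite (cox_orderE h).
by rewrite /cox_order xgetPN ?eqxx // => m hm; apply: h; exists m.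
Qed.

Lemma cox_order_sym s t : cox_order s t = cox_order t s.
Proof.
have [e|ne] := eqVneq (cox_order s t) 0%N; last first.
  by apply/esym/cox_orderE/is_order_swap/cox_order_spec.
have [e'|ne] := eqVneq (cox_order t s) 0%N; first by rewrite e e'.
by apply/cox_orderE/is_order_swap/cox_order_spec.
Qed.

Lemma cox_order_gt1 s t : s != t -> cox_order s t != 0%N -> (1 < cox_order s t)%N.
Proof.
move=> ne /cox_order_spec; move: (cox_order s t) => m [m0 xm _].
case: m m0 xm => [//|[|//]] _; rewrite expg1 => e; case/eqP: ne.
have [inj _ _ _] := coxW; apply: inj.
by apply: (mulIg (gen t)); rewrite e gen_sq.
Qed.

Lemma cox_gram_sym s t : cox_gram s t = cox_gram t s.
Proof. by rewrite /cox_gram eq_sym cox_order_sym. Qed.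

Lemma cox_gram_diag s : cox_gram s s = 2.
Proof. by rewrite /cox_gram eqxx. Qed.

Lemma cox_order2 s t : s != t -> cox_order s t = 2%N <-> commute (gen s) (gen t).
Proof.
move=> ne; split=> [e|c].
  have [|_ h _] := @cox_order_spec s t; first by rewrite e.
  move: h; rewrite e expgS expg1 /commute => h.
  apply: (mulIg (gen s * gen t)%g); rewrite h.
  by rewrite -mulgA genK gen_sq.
apply: cox_orderE; split=> //.
  by rewrite expgS expg1 {1}c -mulgA genK gen_sq.
move=> [|[|//]] // _; rewrite expg1 => e; case/eqP: ne.
have [inj _ _ _] := coxW; apply: inj.
by apply: (mulIg (gen t)); rewrite e gen_sq.
Qed.

Lemma cox_gram_cases s t : s != t ->
  (cox_order s t = 2%N /\ cox_gram s t = 0) \/ (cox_order s t <> 2%N /\ cox_gram s t <= -1).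
Proof.
move=> ne; rewrite /cox_gram (negPf ne) /cox_angle.
have [e|m0] := eqVneq (cox_order s t) 0%N; first by right; rewrite e; split=> //; lra.
have m1 := cox_order_gt1 ne m0; have kp := kapP m1.
have [e|m2] := eqVneq (cox_order s t) 2%N.
  by left; rewrite e in kp *; rewrite (chebyshev_zero2 kp) oppr0.
right; split; first exact/eqP.
have lt : (2 < cox_order s t)%N by rewrite ltn_neqAle eq_sym m2.
by have := chebyshev_zero_ge1 lt kp; lra.
Qed.

Lemma cox_gram_off s t : s != t -> (cox_gram s t == 0) || (cox_gram s t <= -1).
Proof. by case/cox_gram_cases => -[_ ->]; rewrite ?eqxx ?orbT. Qed.

Lemma cox_gram_commute s t : s != t -> cox_gram s t = 0 <-> commute (gen s) (gen t).
Proof.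
move=> ne; rewrite -cox_order2 //; case: (cox_gram_cases ne) => -[h1 h2]; split=> // h.
by move: h2; rewrite h oppr_ge0 ler10.
Qed.

Local Notation A := (bil cox_gram).
Definition refl s x : V := x - scal (A (simple s) x) (simple s).
Definition act_word (u : seq S) x : V := foldr refl x u.

Lemma reflD s x y : refl s (x + y) = refl s x + refl s y.
Proof. by rewrite /refl bilDr; apply/ffunP=> i; rewrite !vE; ring. Qed.
Lemma reflZ s c x : refl s (scal c x) = scal c (refl s x).
Proof. by rewrite /refl bilZr; apply/ffunP=> i; rewrite !vE; ring. Qed.
Lemma reflK s : involutive (refl s).
Proof.
move=> x; rewrite /refl !bilE bil_simple cox_gram_diag.
by apply/ffunP=> i; rewrite !vE; ring.
Qed.
Lemma act_wordD u x y : act_word u (x + y) = act_word u x + act_word u y.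
Proof. by elim: u => //= s u ->; rewrite reflD. Qed.
Lemma act_wordZ u c x : act_word u (scal c x) = scal c (act_word u x).
Proof. by elim: u => //= s u ->; rewrite reflZ. Qed.
Lemma act_word_cat u v x : act_word (u ++ v) x = act_word u (act_word v x).
Proof. by rewrite /act_word foldr_cat. Qed.

(** The parity is counted from the right, so lengthening the word adds a letter in front and the
    last letter of a nonempty word is always [t]. *)
Fixpoint alt s t n : seq S :=
  if n is n'.+1 then (if odd n' then s else t) :: alt s t n' else [::].

Lemma alt_double s t n : alt s t n.*2 = flatten (nseq n [:: s; t]).
Proof. by elim: n => // n IH; rewrite doubleS /= odd_double /= IH. Qed.

Lemma size_alt s t n : size (alt s t n) = n.
Proof. by elim: n => //= n ->. Qed.

Lemma alt_rcons s t n : alt s t n.+1 = rcons (alt t s n) t.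
Proof. by elim: n => // n IH; rewrite [LHS]/= -/(alt s t n.+1) IH /=; case: (odd n). Qed.

Lemma alt_cat s t m n : exists2 p, size p = m & alt s t (m + n) = p ++ alt s t n.
Proof.
elim: m => [|m [p sp e]]; first by exists [::].
by exists ((if odd (m + n) then s else t) :: p); rewrite /= ?sp // e.
Qed.

Lemma act_alt s t n : s != t -> let k := - cox_gram s t in
  act_word (alt s t n) (simple s) =
  scal (cheb k n.+1) (simple (if odd n then t else s)) +
  scal (cheb k n) (simple (if odd n then s else t)).
Proof.
move=> ne k; elim: n => [|n IH].
  by apply/ffunP=> i; rewrite !vE /=; ring.
rewrite [alt _ _ _]/= [act_word _ _]/= IH chebSS.
have r i j : i != j -> cox_gram i j = - k -> refl i (scal (cheb k n.+1) (simple j) +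
    scal (cheb k n) (simple i)) =
    scal (k * cheb k n.+1 - cheb k n) (simple i) + scal (cheb k n.+1) (simple j).
  move=> nij gij; rewrite /refl !bilE !bil_simple gij cox_gram_diag.
  by apply/ffunP=> l; rewrite !vE; ring.
have gst : cox_gram s t = - k by rewrite /k opprK.
have gts : cox_gram t s = - k by rewrite cox_gram_sym.
have ne' : t != s by rewrite eq_sym.
by rewrite /=; case: (odd n) => /=; apply: r.
Qed.

Lemma act_word_rel s t m x : is_order (gen s * gen t)%g m ->
  act_word (flatten (nseq m [:: s; t])) x = x.
Proof.
have iterE u v n y : act_word (flatten (nseq n [:: u; v])) y = iter n (refl u \o refl v) y.
  by elim: n => //= n ->.
move=> om; have [e|ne] := eqVneq s t.
  by rewrite iterE e; elim: m {om} => //= m ->; rewrite reflK.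
have eo := cox_orderE om; have m0 : cox_order s t != 0%N by rewrite eo; case: om; case: (m).
have m1 := cox_order_gt1 ne m0; have kp := kapP m1; rewrite eo in kp m1 m0.
pose k := - cox_gram s t.
have ek : k = kap m by rewrite /k /cox_gram (negPf ne) opprK eo /cox_angle (negPf m0).
have [hz _] := kp; have [e0 e1] := cheb_period hz.
have fix1 u v : u != v -> cox_gram u v = cox_gram s t ->
    act_word (flatten (nseq m [:: u; v])) (simple u) = simple u.
  move=> nuv guv; rewrite -alt_double act_alt // guv -/k odd_double ek -addnn e0 e1.
  by apply/ffunP=> i; rewrite !vE; ring.
have fs := fix1 s t ne erefl.
have ft : act_word (flatten (nseq m [:: s; t])) (simple t) = simple t.
  have ft' := fix1 t s; rewrite eq_sym ne cox_gram_sym in ft'.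
  rewrite -{1}(ft' isT erefl) !iterE.
  elim: (m) => // n IH; rewrite iterSr [in X in iter n _ X]/= !reflK //.
(* The form is nondegenerate on the plane of [simple s] and [simple t]: its determinant is [d]. The
   coefficients [a] and [b] solve the linear system that makes [y] orthogonal to both, so both
   reflections fix [y]. *)
pose d := 4 - k * k; have d0 : d != 0 by rewrite /d ek (chebyshev_zero_neq2 m1 kp).
pose p := A (simple s) x; pose q := A (simple t) x.
pose a := (2 * p + k * q) / d; pose b := (k * p + 2 * q) / d.
pose y := x - scal a (simple s) - scal b (simple t).
have ey : x = y + (scal a (simple s) + scal b (simple t)).
  by apply/ffunP=> i; rewrite /y !vE; ring.
have gst : cox_gram s t = - k by rewrite /k opprK.
have ys : A (simple s) y = 0.
  rewrite /y !bilE !bil_simple -/p cox_gram_diag gst /a /b /d; field.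
  by rewrite -/d.
have yt : A (simple t) y = 0.
  rewrite /y !bilE !bil_simple -/q cox_gram_diag (cox_gram_sym t) gst /a /b /d; field.
  by rewrite -/d.
have fy : act_word (flatten (nseq m [:: s; t])) y = y.
  rewrite iterE; elim: (m) => //= n ->; rewrite /refl.
  by rewrite yt scal0 subr0 ys scal0 subr0.
by clearbody y; rewrite [in LHS]ey !act_wordD !act_wordZ fy fs ft -ey.
Qed.

Lemma act_word_equiv u v x : cox_equiv gen u v -> act_word u x = act_word v x.
Proof.
elim=> {u v} [u v s t m om|//|u v _ ->//|u v w _ -> _ ->//].
by rewrite !act_word_cat act_word_rel.
Qed.

Definition word (w : W) : seq S := sval (cid2 (len_word (gen := gen) w)).
Lemma wordK w : wp (word w) = w.
Proof. by rewrite /word; case: cid2. Qed.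
Definition cox_act (w : W) x : V := act_word (word w) x.

Lemma cox_act_wprod u x : cox_act (wp u) x = act_word u x.
Proof.
by apply: act_word_equiv; have [_ _ _] := coxW; apply; rewrite wordK.
Qed.

Lemma cox_act1 x : cox_act 1%g x = x.
Proof. by have <- := wprod_nil (gen := gen); rewrite cox_act_wprod. Qed.

Lemma cox_actM v w x : cox_act (v * w)%g x = cox_act v (cox_act w x).
Proof. by rewrite -(wordK v) -(wordK w) -wprod_cat !cox_act_wprod act_word_cat. Qed.

Lemma cox_act_gen s x : cox_act (gen s) x = x - scal (A (simple s) x) (simple s).
Proof.
have e : gen s = wp [:: s] by rewrite wprod_cons wprod_nil mulg1.
by rewrite {1}e cox_act_wprod.
Qed.

Lemma alt_relation s t m : ((gen s * gen t) ^+ m = 1)%g -> wp (alt s t m) = wp (alt t s m).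
Proof.
have X2 u v n : wp (alt u v n.*2) = ((gen u * gen v) ^+ n)%g.
  elim: n => [|n IH]; first by rewrite wprod_nil expg0.
  by rewrite doubleS /= odd_double /= !wprod_cons IH expgS mulgA.
have inv n : (((gen s * gen t) ^+ n)^-1 = (gen t * gen s) ^+ n)%g.
  by rewrite -expVgn invgM !gen_inv.
have swap n : (gen s * (gen t * gen s) ^+ n = (gen s * gen t) ^+ n * gen s)%g.
  elim: n => [|n IH]; first by rewrite !expg0 mulg1 mul1g.
  by rewrite !expgS -!mulgA IH.
rewrite -(odd_double_half m); move: m./2 => j; case: (odd m) => /=; last first.
  rewrite add0n !X2 -inv -addnn expgnDr => e.
  by apply: (mulgI ((gen s * gen t) ^+ j)%g); rewrite e mulgV.
rewrite add1n /= odd_double /= !wprod_cons !X2 swap => e.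
apply: (mulgI ((gen s * gen t) ^+ j * gen s)%g); rewrite -{3}swap.
have -> : ((gen s * gen t) ^+ j * gen s * (gen t * (gen s * gen t) ^+ j) =
    (gen s * gen t) ^+ (j + j.+1))%g by rewrite expgnDr expgS !mulgA.
by rewrite addnS addnn e !mulgA mulgenK -inv mulgV.
Qed.

(** Choose a descent [t] on the right and factor [w] as [v] times the longest possible alternating
    suffix in [s] and [t], lengths adding. The suffix sends [simple s] to a nonnegative combination
    of the two simple roots, and induction applies to the shorter [v]. *)
Lemma cox_act_pos w s i : (len w <= len (w * gen s)%g)%N -> 0 <= cox_act w (simple s) i.
Proof.
have [n] := ubnP (len w); elim: n w s i => // n IH w s i; rewrite ltnS => lw ws.
have [->|/len_predr[t wt]] := pselect (w = 1%g).
  by rewrite cox_act1 simpleE ler0n.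
have ne : s != t by apply: contraTneq wt => <-; rewrite -leqNgt.
pose P k := `[< exists2 v, w = (v * wp (alt s t k))%g & (len v + k)%N = len w >].
have P1 : P 1%N.
  apply/asboolP; exists (w * gen t)%g.
    by rewrite /= wprod_cons wprod_nil mulg1 mulgenK.
  rewrite addn1; apply/eqP; rewrite eqn_leq wt /=; exact: len_genr.
have Pb k : P k -> (k <= len w)%N by move=> /asboolP[v _ <-]; apply: leq_addl.
have [k /asboolP[v ew lv] maxk] := ex_maxnP (ex_intro P 1%N P1) Pb.
have k1 : (0 < k)%N by apply: maxk.
have lt_vw : (len v < len w)%N by rewrite -lv -[X in (X < _)%N]addn0 ltn_add2l.
case: k => [//|k] in ew lv maxk k1.
pose h := if odd k.+1 then t else s; pose h' := if odd k.+1 then s else t.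
have vh : (len v <= len (v * gen h)%g)%N.
  rewrite leqNgt; apply/negP => lt.
  have e : w = (v * gen h * wp (alt s t k))%g.
    rewrite ew /= wprod_cons mulgA; congr (_ * gen _ * _)%g.
    by rewrite /h /=; case: (odd k).
  have : (len w <= len (v * gen h)%g + k)%N.
    by rewrite e (leq_trans (len_mul _ _)) // leq_add2l (leq_trans (len_wprod _)) ?size_alt.
  by move: lt lv; lia.
have vh' : (len v <= len (v * gen h')%g)%N.
  rewrite leqNgt; apply/negP => lt.
  suff /maxk : P k.+2 by rewrite ltnn.
  apply/asboolP; exists (v * gen h')%g.
    by rewrite [alt _ _ _]/= wprod_cons -/(alt s t k.+1) -/h' -mulgA genK.
  have le : (len v <= (len (v * gen h')%g).+1)%N by exact: len_genr.
  by rewrite -lv; move: lt le; lia.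
have ph j : 0 <= cox_act v (simple h) j by apply: IH vh; apply: leq_trans lt_vw lw.
have ph' j : 0 <= cox_act v (simple h') j by apply: IH vh'; apply: leq_trans lt_vw lw.
(* A suffix as long as the order could be rewritten by the braid relation to end in [s], and then
   [w * gen s] would be shorter than [w]. *)
have lt_km : cox_order s t = 0%N \/ (k.+1 < cox_order s t)%N.
  have [|m0] := eqVneq (cox_order s t) 0%N; [by left|right].
  rewrite ltnNge; apply/negP => mk.
  have [_ om _] := cox_order_spec m0; have := alt_relation om.
  move: (cox_order s t) m0 mk => [//|m] _ mk {om} em.
  have [p sp ep] := alt_cat s t (k - m) m.+1.
  have e : (w * gen s = v * wp (p ++ alt s t m))%g.
    rewrite ew; have -> : k.+1 = (k - m + m.+1)%N by lia.
    rewrite ep !wprod_cat em alt_rcons -cats1 wprod_cat wprod_cons wprod_nil mulg1 !mulgA.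
    by rewrite mulgenK.
  have : (len (w * gen s)%g <= len v + (k - m + m))%N.
    rewrite e (leq_trans (len_mul _ _)) // leq_add2l (leq_trans (len_wprod _)) //.
    by rewrite size_cat sp size_alt.
  by move: ws lv; lia.
have u_ge0 j : (j <= k.+2)%N -> 0 <= cheb (- cox_gram s t) j.
  move=> jk; rewrite /cox_gram (negPf ne) opprK /cox_angle.
  case: lt_km => [->|lt]; first by rewrite eqxx cheb2n ler0n.
  have m0 : cox_order s t != 0%N by rewrite -lt0n; apply: leq_ltn_trans lt.
  rewrite (negPf m0); have [h0 hp] := kapP (cox_order_gt1 ne m0).
  case: j jk => [//|j] jk; have [e|nj] := eqVneq j.+1 (cox_order s t); first by rewrite e h0.
  by apply/ltW/hp; rewrite /= ltn_neqAle nj; apply: leq_trans lt.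
rewrite ew cox_actM cox_act_wprod act_alt //.
rewrite /cox_act act_wordD !act_wordZ !vE -!/(cox_act _ _).
by apply: addr_ge0; apply: mulr_ge0; rewrite ?u_ge0 //.
Qed.

Definition cox_georep : georep gen R :=
  @Georep W S gen R coxW cox_gram cox_act cox_gram_sym cox_gram_diag cox_gram_off
    cox_gram_commute cox_act1 cox_actM cox_act_gen cox_act_pos.

End Existence.

Definition nonneg (S : finType) (R : realFieldType) (x : {ffun S -> R}) :=
  forall i, 0 <= x i.

(** * Roots, inversions and the weak order *)

Section Roots.
Context {W : groupType} {S : finType} {gen : S -> W}.
Context {R : realFieldType} {rho : georep gen R}.
Local Notation V := {ffun S -> R}.
Local Notation len := (cox_length gen).
Local Notation ac := (act rho).
Local Notation A := (bil (gram rho)).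

Lemma form_sym x y : A x y = A y x.
Proof. exact/bil_sym/gram_sym. Qed.

Lemma gen_ind (P : W -> Prop) :
  P 1%g -> (forall s w, P w -> P (gen s * w)%g) -> forall w, P w.
Proof.
move=> P1 Ps w; have [u <- _] := len_word w.
by elim: u => [|s u IH]; rewrite ?wprod_nil ?wprod_cons //; apply: Ps.
Qed.

Lemma actD w x y : ac w (x + y) = ac w x + ac w y.
Proof.
elim/gen_ind: w x y => [|s w IH] x y; first by rewrite !act1.
by rewrite !actM IH !act_gen bilDr; apply/ffunP=> i; rewrite !vE; ring.
Qed.

Lemma actZ w c x : ac w (scal c x) = scal c (ac w x).
Proof.
elim/gen_ind: w x => [|s w IH] x; first by rewrite !act1.
by rewrite !actM IH !act_gen bilZr; apply/ffunP=> i; rewrite !vE; ring.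
Qed.

Lemma actN w x : ac w (- x) = - ac w x.
Proof. by rewrite scalN1 actZ -scalN1. Qed.

Lemma act0 w : ac w 0 = 0.
Proof. by rewrite -{1}(scal0 0) actZ scal0. Qed.

Lemma actK w x : ac w^-1 (ac w x) = x.
Proof. by rewrite -actM mulVg act1. Qed.

Lemma actVK w x : ac w (ac w^-1 x) = x.
Proof. by rewrite -actM mulgV act1. Qed.

Lemma act_genK s x : ac (gen s) (ac (gen s) x) = x.
Proof. by rewrite -{1}(gen_inv s) actK. Qed.

Lemma form_simple s : A (simple s) (simple s) = 2.
Proof. by rewrite bil_simple gram_diag. Qed.

Lemma act_simple s : ac (gen s) (simple s) = - simple s.
Proof. by rewrite act_gen form_simple; apply/ffunP=> i; rewrite !vE; ring. Qed.

Lemma form_act w x y : A (ac w x) (ac w y) = A x y.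
Proof.
elim/gen_ind: w x y => [|s w IH] x y; first by rewrite !act1.
rewrite !actM -(IH x y) !act_gen !bilE form_simple.
by rewrite (form_sym (ac w x) (simple s)); ring.
Qed.

Lemma form_actl w x y : A (ac w x) y = A x (ac w^-1 y).
Proof. by rewrite -(form_act w x) actVK. Qed.

Lemma act_expand w x : ac w x = \sum_i scal (x i) (ac w (simple i)).
Proof.
have {1}-> : x = \sum_i scal (x i) (simple i).
  apply/ffunP=> j; rewrite sum_ffunE (bigD1 j) //= big1 => [|i /negPf ij].
    by rewrite addr0 !vE eqxx mulr1.
  by rewrite !vE eq_sym ij mulr0.
elim/big_ind2 : _ => [|x1 x2 y1 y2 <- <-|i _]; rewrite ?act0 ?actD ?actZ //.
Qed.

Lemma act_expandE w x j : ac w x j = \sum_i x i * ac w (simple i) j.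
Proof. by rewrite {1}act_expand sum_ffunE; apply: eq_bigr => i _; rewrite vE. Qed.

Definition root (b : V) := exists w s, b = ac w (simple s).
Definition proot (b : V) := root b /\ nonneg b.
Definition inv (w : W) (b : V) := proot b /\ nonneg (- ac w^-1 b).
Definition wle (u w : W) := forall b, inv u b -> inv w b.

Lemma root_act w b : root b -> root (ac w b).
Proof. by move=> [v [s ->]]; exists (w * v)%g, s; rewrite actM. Qed.

Lemma rootN b : root b -> root (- b).
Proof. by move=> [v [s ->]]; exists (v * gen s)%g, s; rewrite actM act_simple actN. Qed.

Lemma root_simple s : root (simple s).
Proof. by exists 1%g, s; rewrite act1. Qed.

Lemma form_root b : root b -> A b b = 2.
Proof. by move=> [w [s ->]]; rewrite form_act form_simple. Qed.

Lemma form0 x : A 0 x = 0.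
Proof. by rewrite -(scal0 0) bilZl mul0r. Qed.

Lemma root_neq0 b : root b -> b <> 0.
Proof. by move=> /form_root + b0; rewrite b0 form0 => /eqP; rewrite eq_sym pnatr_eq0. Qed.

Lemma nonneg0 (b : V) : nonneg b -> nonneg (- b) -> b = 0.
Proof.
move=> b1 b2; apply/ffunP=> i; rewrite vE; apply/eqP.
by rewrite eq_le b1 andbT; have := b2 i; rewrite vE; lra.
Qed.

Lemma nonnegD (x y : V) : nonneg x -> nonneg y -> nonneg (x + y).
Proof. by move=> x0 y0 i; rewrite vE addr_ge0. Qed.

Lemma nonnegZ c (x : V) : 0 <= c -> nonneg x -> nonneg (scal c x).
Proof. by move=> c0 x0 i; rewrite vE mulr_ge0. Qed.

Lemma root_sign b : root b -> nonneg b \/ nonneg (- b).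
Proof.
move=> [w [s ->]]; have [le|lt] := leqP (len w) (len (w * gen s)%g).
  by left => i; apply: act_pos.
right=> i; have := @act_pos _ _ _ _ rho (w * gen s)%g s i.
rewrite mulgenK => /(_ (ltnW lt)).
by rewrite actM act_simple actN.
Qed.

Lemma proot_notneg b : proot b -> ~ nonneg (- b).
Proof. by move=> [rb b0] b1; apply: (root_neq0 rb); apply: nonneg0. Qed.

Lemma root_signN b : root b -> ~ nonneg b -> nonneg (- b).
Proof. by move=> /root_sign[]. Qed.

Lemma root_signP b : root b -> ~ nonneg (- b) -> proot b.
Proof. by move=> rb; case: (root_sign rb). Qed.

Lemma nonneg_simple s : nonneg (simple s : V).
Proof. by move=> i; rewrite simpleE ler0n. Qed.

Lemma proot_simple s : proot (simple s).
Proof. by split; [exact: root_simple|exact: nonneg_simple]. Qed.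

Lemma spanned1 s (b : V) : spanned (pred1 s) b -> b = scal (b s) (simple s).
Proof.
move=> h; apply/ffunP=> i; rewrite !vE; have [->|ne] := eqVneq i s.
  by rewrite mulr1.
by rewrite mulr0 h.
Qed.

Lemma proot_spanned1 s b : proot b -> spanned (pred1 s) b -> b = simple s.
Proof.
move=> [rb b0] /spanned1 e; have := form_root rb; rewrite e bilZl bilZr form_simple => h.
suff -> : b s = 1 by rewrite scal1.
by have := b0 s; nra.
Qed.

Lemma act_genE s x i : i != s -> ac (gen s) x i = x i.
Proof. by move=> /negPf h; rewrite act_gen !vE h mulr0 subr0. Qed.

Lemma act_gens s x : ac (gen s) x s = x s - A (simple s) x.
Proof. by rewrite act_gen !vE eqxx mulr1. Qed.

Lemma proot_gen s b : proot b -> b <> simple s -> proot (ac (gen s) b).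
Proof.
move=> pb ne; apply: root_signP => [|neg]; first by apply: root_act; case: pb.
apply/ne/proot_spanned1 => // i /= ne'; have := neg i.
rewrite vE act_genE //; case: pb => _ /(_ i); lra.
Qed.

Definition desc s w := (len (gen s * w)%g < len w)%N.
Lemma descE s w : desc s w = (len (gen s * w)%g < len w)%N.
Proof. by []. Qed.

Lemma desc_len s w : desc s w -> len w = (len (gen s * w)%g).+1.
Proof. by move=> d; apply/eqP; rewrite eqn_leq len_genl. Qed.

Lemma desc_neg s w : desc s w -> nonneg (- ac w^-1 (simple s)).
Proof.
move=> d i; have := @act_pos _ _ _ _ rho (w^-1 * gen s)%g s i.
rewrite mulgenK actM act_simple actN => -> //.
by rewrite -{1}(gen_inv s) -invgM !len_inv // ltnW.
Qed.

Lemma desc_pos s w : ~~ desc s w -> nonneg (ac w^-1 (simple s)).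
Proof.
move=> d i; apply: act_pos.
by rewrite -{1}(gen_inv s) -invgM !len_inv // leqNgt.
Qed.

Lemma descP s w : reflect (inv w (simple s)) (desc s w).
Proof.
apply: (iffP idP) => [d|[_ neg]]; first by split; [exact: proot_simple|exact: desc_neg].
apply/negPn/negP => /desc_pos pos.
by apply: (root_neq0 (root_act w^-1 (root_simple s))); apply: nonneg0.
Qed.

Lemma desc_flip s w : desc s (gen s * w)%g = ~~ desc s w.
Proof.
rewrite /desc genK; apply/idP/idP => [h|h]; first by rewrite -leqNgt ltnW.
rewrite ltnNge; apply/negP => le.
have e : len (gen s * w)%g = len w by apply/eqP; rewrite eqn_leq le leqNgt.
have /desc_pos p1 := h.
have /desc_pos p2 : ~~ desc s (gen s * w)%g by rewrite /desc genK e ltnn.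
apply: (root_neq0 (root_act w^-1 (root_simple s))); apply: nonneg0 => //.
by move: p2; rewrite invgM gen_inv actM act_simple actN.
Qed.

Lemma inv_proot w b : inv w b -> proot b.
Proof. by case. Qed.

Lemma invN w b : proot b -> ~ inv w b -> proot (ac w^-1 b).
Proof.
by move=> pb ni; apply: root_signP => [|h]; [apply: root_act; case: pb|apply: ni].
Qed.

Lemma inv_notpos w b : inv w b -> ~ nonneg (ac w^-1 b).
Proof.
move=> [[rb _] neg] pos; apply: (root_neq0 (root_act w^-1 rb)); exact: nonneg0.
Qed.

Lemma inv_gen s w b : proot b -> b <> simple s ->
  inv (gen s * w)%g (ac (gen s) b) <-> inv w b.
Proof.
move=> pb ne; rewrite /inv invgM gen_inv actM act_genK.
by split=> [[_ ?]|[_ ?]]; split=> //; apply: proot_gen.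
Qed.

Lemma inv_genl s w b : proot b -> b <> simple s ->
  inv (gen s * w)%g b <-> inv w (ac (gen s) b).
Proof. by move=> pb ne; rewrite -{2}(genK s w) inv_gen // genK. Qed.

Lemma neq_gen_simple s b : proot b -> ac (gen s) b <> simple s.
Proof.
move=> pb e; apply: (proot_notneg pb); rewrite -(act_genK s b) e act_simple opprK.
exact: nonneg_simple.
Qed.

Lemma inv1 b : ~ inv 1%g b.
Proof. by move=> [pb]; rewrite invg1 act1 => /(proot_notneg pb). Qed.

Lemma wle_refl w : wle w w. Proof. by []. Qed.
Lemma wle_trans u v w : wle u v -> wle v w -> wle u w.
Proof. by move=> uv vw b /uv/vw. Qed.
Lemma wle1 w : wle 1%g w.
Proof. by move=> b /inv1. Qed.

Lemma wle_desc s u w : wle u w -> desc s u -> desc s w.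
Proof. by move=> uw /descP/uw/descP. Qed.

(** [gen s] permutes the positive roots other than [simple s], and the hypothesis on descents
    settles that one. *)
Lemma wle_gen s u w : desc s u = desc s w -> wle u w -> wle (gen s * u)%g (gen s * w)%g.
Proof.
move=> d uw b ib; have pb := inv_proot ib.
have [e|ne] := pselect (b = simple s).
  move: ib; rewrite e => /descP; rewrite desc_flip d -desc_flip => /descP //.
by apply/inv_genl => //; apply: uw; apply/inv_genl.
Qed.

Lemma wle_genE s u w : desc s u = desc s w ->
  wle (gen s * u)%g (gen s * w)%g <-> wle u w.
Proof.
move=> d; split; last exact: wle_gen.
by rewrite -{2}(genK s u) -{2}(genK s w); apply: wle_gen; rewrite !desc_flip d.
Qed.

Lemma wle_gen_desc s u w : ~~ desc s u -> wle u (gen s * w)%g -> desc s w ->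
  wle (gen s * u)%g w.
Proof. by move=> du le dw; rewrite -(genK s w); apply: wle_gen; rewrite // desc_flip dw (negPf du). Qed.

Lemma weak_leP u w : weak_le gen u w <-> wle u w.
Proof.
rewrite /weak_le; have [n] := ubnP (len u).
elim: n u w => // n IH u w; rewrite ltnS => un.
have [->|/(len_pred)[s ds]] := pselect (u = 1%g).
  by rewrite invg1 mul1g len1 // add0n; split=> // _; apply: wle1.
have dsu : desc s u := ds.
have eu := desc_len dsu.
have IHs : (len (gen s * u)%g + len (u^-1 * w)%g)%N = len (gen s * w)%g <->
    wle (gen s * u)%g (gen s * w)%g.
  rewrite -(IH _ (gen s * w)%g (leq_trans ds un)).
  by rewrite invgM gen_inv -mulgA genK.
split=> [e|le].
  have h : (len (gen s * w)%g <= len (gen s * u)%g + len (u^-1 * w)%g)%N.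
    apply: leq_trans (len_mul _ _); rewrite -mulgA mulVKg leqnn //.
  have dw : desc s w by rewrite /desc -e eu; lia.
  have ew := desc_len dw.
  apply/(@wle_genE s); first by rewrite dsu dw.
  by apply/IHs; lia.
have dw := wle_desc le dsu; have ew := desc_len dw.
have /IHs : wle (gen s * u)%g (gen s * w)%g by apply: wle_gen; rewrite ?dsu ?dw.
by lia.
Qed.

Lemma wle_len u w : wle u w -> (len u + len (u^-1 * w)%g = len w)%N.
Proof. by move=> /weak_leP. Qed.

Lemma wle_leq u w : wle u w -> (len u <= len w)%N.
Proof. by move=> /wle_len <-; apply: leq_addr. Qed.

Lemma wle_eqlen u w : wle u w -> len u = len w -> u = w.
Proof.
move=> /wle_len h e; have : len (u^-1 * w)%g = 0%N by lia.
by move=> /(len_eq0) e1; apply: (mulgI (u^-1)%g); rewrite e1 mulVg.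
Qed.

Lemma wle_anti u w : wle u w -> wle w u -> u = w.
Proof. by move=> a b; apply: wle_eqlen => //; apply/eqP; rewrite eqn_leq !wle_leq. Qed.

Lemma wle_ltn u w : wle u w -> u <> w -> (len u < len w)%N.
Proof.
by move=> uw ne; rewrite ltn_neqAle wle_leq // andbT; apply/eqP => /(wle_eqlen uw).
Qed.

Lemma inv_mulr w s b : proot (ac w (simple s)) ->
  inv (w * gen s)%g b <-> inv w b \/ b = ac w (simple s).
Proof.
move=> pw; rewrite /inv invgM gen_inv actM.
have key : proot b -> b <> ac w (simple s) ->
  nonneg (- ac (gen s) (ac w^-1 b)) <-> nonneg (- ac w^-1 b).
  move=> pb ne; have rb : root (ac w^-1 b) by apply: root_act; case: pb.
  split=> h.
    apply: root_signN => // h'; apply: (proot_notneg _ h); apply: proot_gen => //.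
    by move=> e; apply: ne; rewrite -e actVK.
  apply: root_signN => [|h']; first exact: root_act.
  have : proot (ac (gen s) (- ac w^-1 b)).
    apply: proot_gen => [|e]; first by split=> //; apply: rootN.
    apply: (proot_notneg pw); rewrite -e actN actVK opprK; by case: pb.
  by rewrite actN => /proot_notneg; rewrite opprK.
split=> [[pb h]|[[pb h]|->]].
- have [->|ne] := pselect (b = ac w (simple s)); [by right|left].
  by split=> //; apply/key.
- split=> //; apply/key => // e; apply: (proot_notneg (proot_simple s)).
  by rewrite e actK in h.
- by split=> //; rewrite actK act_simple opprK; apply: nonneg_simple.
Qed.

Lemma wle_mulr w s : proot (ac w (simple s)) -> wle w (w * gen s)%g.
Proof. by move=> pw b ib; apply/inv_mulr => //; left. Qed.

Lemma inv_mulr_self w s : proot (ac w (simple s)) -> inv (w * gen s)%g (ac w (simple s)).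
Proof. by move=> pw; apply/inv_mulr => //; right. Qed.

Lemma ninv_mulr w s : ~ inv w (ac w (simple s)).
Proof. by move=> [_]; rewrite actK => /(proot_notneg (proot_simple s)). Qed.

Lemma wle_mulr_sub w s u : proot (ac w (simple s)) -> wle w u ->
  inv u (ac w (simple s)) -> wle (w * gen s)%g u.
Proof. by move=> pw wu iu b /inv_mulr[//|/wu|->]. Qed.

Lemma wle_mulr_cases w s u : proot (ac w (simple s)) -> wle u (w * gen s)%g ->
  ~ inv u (ac w (simple s)) -> wle u w.
Proof. by move=> pw uw nu b ib; have /inv_mulr[//||e] := uw _ ib => //; case: nu; rewrite -e. Qed.

Lemma len_mulr w s : proot (ac w (simple s)) -> len (w * gen s)%g = (len w).+1.
Proof.
move=> pw; have /wle_len := wle_mulr pw.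
by rewrite mulKg len_gen // addn1.
Qed.

Lemma upper_cover x y : wle x y -> x <> y ->
  exists s, proot (ac x (simple s)) /\ wle (x * gen s)%g y.
Proof.
move=> xy ne; have ne1 : (x^-1 * y)%g <> 1%g.
  by move=> e; apply: ne; apply: (mulgI (x^-1)%g); rewrite e mulVg.
have [s ds] := len_pred ne1; exists s.
have ltx : (len x < len (x * gen s)%g)%N.
  have h : (len y <= len (x * gen s)%g + len (gen s * (x^-1 * y))%g)%N.
    have := @len_mul W S gen (georep_cox rho) (x * gen s)%g (gen s * (x^-1 * y))%g.
    by rewrite -mulgA genK mulVKg.
  by have := wle_len xy; lia.
have px : proot (ac x (simple s)).
  split; first by exists x, s.
  by move=> i; apply: act_pos; apply: ltnW.
split=> //; apply: wle_mulr_sub => //; split=> //.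
have : desc s (x^-1 * y)%g by [].
by move=> /descP[_]; rewrite invgM invgK actM.
Qed.

Lemma lower_cover x y : wle x y -> x <> y ->
  exists z s, [/\ y = (z * gen s)%g, proot (ac z (simple s)) & wle x z].
Proof.
have [n] := ubnP (len y - len x)%N.
elim: n x => // n IH x; rewrite ltnS => le xy ne.
have [s [ps xsy]] := upper_cover xy ne.
have [e|ne'] := pselect ((x * gen s)%g = y).
  by exists x, s; split; [rewrite e|exact: ps|exact: wle_refl].
have lt := wle_ltn xsy ne'; have := len_mulr ps.
move=> lx; case: (IH _ _ xsy ne') => [|z [t [ey pz xz]]]; first by lia.
by exists z, t; split=> //; apply: wle_trans xz; apply: wle_mulr.
Qed.

End Roots.

(** * Parabolic parts, rank-two polygons, meets and joins *)

Section Lattice.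
Context {W : groupType} {S : finType} {gen : S -> W}.
Context {R : realFieldType} {rho : georep gen R}.
Local Notation V := {ffun S -> R}.
Local Notation len := (cox_length gen).
Local Notation wp := (wprod gen).
Local Notation ac := (act rho).

Local Notation root := (@root W S gen R rho).
Local Notation proot := (@proot W S gen R rho).
Local Notation inv := (@inv W S gen R rho).
Local Notation wle := (@wle W S gen R rho).
Local Notation desc := (@desc W S gen).

Definition supported (P : pred S) (w : W) := forall b, inv w b -> spanned P b.

Lemma act_wprod_out (P : pred S) u x i : all P u -> ~~ P i -> ac (wp u) x i = x i.
Proof.
elim: u => [|s u IH] /=; first by rewrite wprod_nil act1.
move=> /andP[Ps Pu] nPi; rewrite wprod_cons actM act_genE ?IH //.
by apply: contraNneq nPi => ->.
Qed.

Lemma supported_wprod (P : pred S) u : all P u -> supported P (wp u).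
Proof.
move=> Pu b [[rb b0] neg] i nPi; have := neg i; rewrite -(wprod_rev) vE.
rewrite (act_wprod_out _ _ nPi) ?all_rev //; have := b0 i => h1 h2.
by apply/eqP; rewrite eq_le h1 andbT; lra.
Qed.

Lemma spanned_simpleP (P : pred S) s : spanned P (simple s : V) -> P s.
Proof. by move=> h; apply/negPn/negP => /h /eqP; rewrite simple_id oner_eq0. Qed.

Lemma spanned_gen (P : pred S) s x : P s -> spanned P x -> spanned P (ac (gen s) x).
Proof. by move=> Ps Px i nPi; rewrite act_genE ?Px //; apply: contraNneq nPi => ->. Qed.

Lemma supported_gen (P : pred S) s w : supported P w -> desc s w ->
  P s /\ supported P (gen s * w)%g.
Proof.
move=> Pw dw; have Ps : P s by apply: spanned_simpleP; apply: Pw; apply/(descP).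
split=> // b ib; have pb := inv_proot ib.
have ne : b <> simple s.
  by move=> e; move: ib; rewrite e => /(descP); rewrite desc_flip dw.
rewrite -(act_genK s b); apply: spanned_gen => //; apply: Pw.
by apply/(inv_genl).
Qed.

Lemma supportedP (P : pred S) w : supported P w -> exists u, all P u /\ wp u = w.
Proof.
have [n] := ubnP (len w); elim: n w => // n IH w; rewrite ltnS => lw Pw.
have [->|/(len_pred)[s dw]] := pselect (w = 1%g).
  by exists [::]; rewrite wprod_nil.
have [Ps Psw] := supported_gen Pw dw.
have [//|u [Pu e]] := IH (gen s * w)%g _ Psw; first exact: leq_trans dw lw.
by exists (s :: u); rewrite /= Ps Pu wprod_cons e genK.
Qed.

Lemma supported_act (P : pred S) w x i : supported P w -> ~~ P i -> ac w x i = x i.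
Proof. by move=> /supportedP[u [Pu <-]] nPi; apply: act_wprod_out nPi. Qed.

Lemma supported_actV (P : pred S) w x i : supported P w -> ~~ P i -> ac w^-1 x i = x i.
Proof.
move=> /supportedP[u [Pu <-]] nPi; rewrite -(wprod_rev).
by apply: act_wprod_out nPi; rewrite all_rev.
Qed.

Lemma supported_span (P : pred S) w x : supported P w -> spanned P x -> spanned P (ac w x).
Proof. by move=> Pw Px i nPi; rewrite (supported_act _ Pw nPi) Px. Qed.

Lemma supported1 P : supported P 1%g.
Proof. by move=> b /inv1. Qed.

Lemma supported_le (P : pred S) u w : wle u w -> supported P w -> supported P u.
Proof. by move=> uw Pw b /uw/Pw. Qed.

Lemma nonneg_spanned_inv (P : pred S) w b : nonneg b -> spanned P b ->
  (forall s, P s -> ~~ desc s w) -> nonneg (ac w^-1 b).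
Proof.
move=> b0 Pb nd j; rewrite act_expandE; apply: sumr_ge0 => i _.
have [Pi|/Pb ->] := boolP (P i); last by rewrite mul0r.
by apply: mulr_ge0 => //; apply: (desc_pos); apply: nd.
Qed.

(** Descents in [P] are stripped one at a time. When none is left, the inverse of [w] keeps every
    nonnegative vector spanned by [P] nonnegative, so no inversion in that span remains. *)
Lemma par_ex (P : pred S) w :
  exists x, forall b, inv x b <-> inv w b /\ spanned P b.
Proof.
have [n] := ubnP (len w); elim: n w => // n IH w; rewrite ltnS => lw.
have [[s [Ps dw]]|nd] := pselect (exists s, P s /\ desc s w); last first.
  exists 1%g => b; split=> [/inv1//|[iw Pb]].
  have [[rb b0] neg] := iw; case: (inv_notpos iw).
  apply: (nonneg_spanned_inv b0 Pb) => s Ps; apply/negP => ds; apply: nd.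
  by exists s.
have [x hx] := IH (gen s * w)%g (leq_trans dw lw).
have nx : ~~ desc s x.
  apply/negP => /(descP) /hx[/(descP)].
  by rewrite desc_flip dw.
exists (gen s * x)%g => b.
have [pb|npb] := pselect (proot b); last by split=> [/inv_proot|[/inv_proot]].
have [e|ne] := pselect (b = simple s).
  split=> _; first by rewrite e; split; [apply/descP|apply: spanned_simple].
  by rewrite e; apply/(descP); rewrite desc_flip.
rewrite (inv_genl) // hx.
rewrite (inv_gen) //; split=> -[ib sb]; split=> //; last exact: spanned_gen.
by rewrite -(act_genK s b); apply: spanned_gen.
Qed.

Definition par P w := projT1 (cid (par_ex P w)).
Lemma parP P w b : inv (par P w) b <-> inv w b /\ spanned P b.
Proof. exact: projT2 (cid (par_ex P w)) b. Qed.
Lemma par_le P w : wle (par P w) w.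
Proof. by move=> b /parP[]. Qed.
Lemma par_supported P w : supported P (par P w).
Proof. by move=> b /parP[]. Qed.
Lemma le_par P u w : wle u w -> supported P u -> wle u (par P w).
Proof. by move=> uw Pu b ib; apply/parP; split; [apply: uw|apply: Pu]. Qed.

Lemma inv_comb w b p q x y : proot b -> b = scal p x + scal q y -> 0 <= p -> 0 <= q ->
  nonneg (- ac w^-1 x) -> nonneg (- ac w^-1 y) -> inv w b.
Proof.
move=> pb e p0 q0 x0 y0; split=> // i; rewrite e actD // !actZ // !vE.
by have := mulr_ge0 p0 (x0 i); have := mulr_ge0 q0 (y0 i); rewrite !vE; lra.
Qed.

Lemma spanned2 t t' (b : V) : t != t' -> spanned (pred2 t t') b ->
  b = scal (b t) (simple t) + scal (b t') (simple t').
Proof.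
move=> ne h; apply/ffunP=> i; rewrite !vE.
have [->|n1] := eqVneq i t; first by rewrite (negPf ne) mulr0 mulr1 addr0.
have [->|n2] := eqVneq i t'; first by rewrite mulr0 mulr1 add0r.
by rewrite !mulr0 addr0 h //= negb_or n1 n2.
Qed.

(** A simple root spans an extreme ray of the nonnegative cone. All extremality arguments below rest
    on this. *)
Lemma simple_comb s p q x y : simple s = scal p x + scal q y -> 0 < p -> 0 <= q ->
  proot x -> nonneg y -> x = simple s.
Proof.
move=> e p0 q0 px y0; apply: (proot_spanned1 px) => i /= ne.
have := congr1 (fun f : V => f i) e; rewrite !vE (negPf ne).
move=> /esym h; have x0 : 0 <= x i by case: px.
have h' : p * x i + q * y i = 0 by rewrite h.
apply/eqP; rewrite eq_le x0 andbT leNgt; apply/negP => xi.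
by have := mulr_gt0 p0 xi; have := mulr_ge0 q0 (y0 i); lra.
Qed.

(** The longest element of the group generated by [t] and [t'], described by its inversions so that
    the order of the group never appears. It exists as soon as [t] and [t'] are descents of one
    element. *)
Definition dihedral_top t t' g :=
  forall b, inv g b <-> proot b /\ spanned (pred2 t t') b.

Lemma dihedral_top_ex t t' a : t != t' -> desc t a -> desc t' a ->
  exists g, dihedral_top t t' g /\ forall b, desc t b -> desc t' b -> wle g b.
Proof.
move=> ne da da'.
have key w b : desc t w -> desc t' w -> proot b -> spanned (pred2 t t') b -> inv w b.
  move=> d d' pb sb; have [_ b0] := pb; apply: (inv_comb pb (spanned2 ne sb)) => //.
    exact: desc_neg.
  exact: desc_neg.
exists (par (pred2 t t') a); split=> [b|w dw dw' b].
  by rewrite parP; split=> [[/inv_proot]|[pb sb]] //; split=> //; apply: key.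
by move=> /parP[/inv_proot pb sb]; apply: key.
Qed.

Lemma dihedral_desc t t' g : dihedral_top t t' g -> desc t g /\ desc t' g.
Proof.
by move=> h; split; apply/(descP)/h; split; try exact: proot_simple;
  apply: spanned_simple; rewrite /= eqxx ?orbT.
Qed.

Section Polygon.
Variables (u : W) (t t' : S).
Hypotheses (ne : t != t').
Hypotheses (pt : proot (ac u (simple t))) (pt' : proot (ac u (simple t'))).

(** [u] is shortest in its coset, so it sends the positive roots of the plane to positive roots and
    none of its own inversions is cancelled. *)
Lemma inv_polygon h b : supported (pred2 t t') h ->
  inv (u * h)%g b <-> proot b /\ (inv u b \/ inv h (ac u^-1 b)).
Proof.
move=> sh; have up z : nonneg z -> spanned (pred2 t t') z -> nonneg (ac u z).
  move=> z0 /(spanned2 ne) -> i; rewrite actD // !actZ // !vE.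
  by apply: addr_ge0; apply: mulr_ge0 => //; [case: pt|case: pt'].
split=> [[pb neg]|[pb [[_ neg]|[pz neg]]]].
- split=> //; have [iu|nu] := pselect (inv u b); [by left|right].
  by split; [apply: invN|rewrite -actM -invgM].
- have rz : root (ac u^-1 b) by apply: root_act; case: pb.
  split=> //; rewrite invgM actM.
  apply: root_signN => //; first exact: root_act.
  move=> pos; have : inv h (- ac u^-1 b).
    split; first by split=> //; apply: rootN.
    by rewrite actN // opprK.
  move=> ih; have := up _ neg (sh _ ih); rewrite actN // actVK => nb.
  exact: (proot_notneg pb).
- by split=> //; rewrite invgM actM.
Qed.

Lemma dihedral_top_join g x : dihedral_top t t' g ->
  wle (u * gen t)%g x -> wle (u * gen t')%g x -> wle (u * g)%g x.
Proof.
move=> hg le le' b ib.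
have sg : supported (pred2 t t') g by move=> c /hg[].
move/(inv_polygon _ sg) : ib => [pb [iu|/hg[pz sz]]].
  by apply: le; apply: wle_mulr iu.
have [_ z0] := pz; apply: (inv_comb (x := ac u (simple t)) (y := ac u (simple t'))
   (p := ac u^-1 b t) (q := ac u^-1 b t')) => //.
- by rewrite -!actZ // -actD // -spanned2 // actVK.
- by case: (le (ac u (simple t))) => //; apply: inv_mulr_self.
- by case: (le' (ac u (simple t'))) => //; apply: inv_mulr_self.
Qed.

Lemma polygon_le g h : dihedral_top t t' g -> supported (pred2 t t') h ->
  wle u (u * h)%g /\ wle (u * h)%g (u * g)%g.
Proof.
move=> hg sh; have sg : supported (pred2 t t') g by move=> c /hg[].
split=> b ib; first by apply/(inv_polygon _ sh); split; [case: ib|left].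
move/(inv_polygon _ sh) : ib => [pb h2]; apply/(inv_polygon _ sg); split=> //.
case: h2 => [iu|ih]; [by left|right]; apply/hg; split; first by case: ih.
exact: sh.
Qed.

Lemma dihedral_top_gen g : dihedral_top t t' g -> supported (pred2 t t') (gen t' * g)%g.
Proof.
move=> hg b ib; have sg : supported (pred2 t t') g by move=> c /hg[].
have [|_] := @supported_gen _ t' g sg; last exact.
by case: (dihedral_desc hg).
Qed.

Lemma polygon_ex x : wle (u * gen t)%g x -> wle (u * gen t')%g x ->
  exists g, dihedral_top t t' g.
Proof.
move=> le le'; have h s : proot (ac u (simple s)) -> wle (u * gen s)%g x ->
    desc s (u^-1 * x)%g.
  move=> ps lex; apply/(descP); split; first exact: proot_simple.
  by rewrite invgM invgK actM; case: (lex (ac u (simple s))) => //; apply: inv_mulr_self.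
by have [g [hg _]] := dihedral_top_ex ne (h _ pt le) (h _ pt' le'); exists g.
Qed.
End Polygon.

Definition ismeet (X : W -> Prop) m :=
  (forall a, X a -> wle m a) /\ (forall x, (forall a, X a -> wle x a) -> wle x m).
Definition isjoin (X : W -> Prop) m :=
  (forall a, X a -> wle a m) /\ (forall x, (forall a, X a -> wle a x) -> wle m x).

(** For a common descent [s], the meet of the stripped elements exists by induction, and multiplying
    it by [gen s] dominates every lower bound that has the descent [s]. Lower bounds with another
    descent are compared through a rank-two element. *)
Lemma meet_ex (X : W -> Prop) a0 : X a0 -> exists m, ismeet X m.
Proof.
have [n] := ubnP (len a0); elim: n X a0 => // n IH X a0; rewrite ltnS => la Xa0.
pose D s := forall a, X a -> desc s a.
have [[s Ds]|nD] := pselect (exists s, D s); last first.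
  exists 1%g; split=> [a _|x hx]; first exact: wle1.
  have [->|/(len_pred)[s ds]] := pselect (x = 1%g); first exact: wle1.
  by case: nD; exists s => a Xa; apply: (wle_desc (hx a Xa)).
pose Xs s y := X (gen s * y)%g /\ desc s (gen s * y)%g.
have mex s' : D s' -> exists m, ismeet (Xs s') m.
  move=> Ds'; apply: (IH (Xs s') (gen s' * a0)%g); first exact: leq_trans (Ds' _ Xa0) la.
  by rewrite /Xs genK; split=> //; apply: Ds'.
have lem s' m : D s' -> ismeet (Xs s') m ->
   [/\ forall a, X a -> wle (gen s' * m)%g a, ~~ desc s' m &
    forall x, desc s' x -> (forall a, X a -> wle x a) -> wle x (gen s' * m)%g].
  move=> Ds' [lo gr].
  have nm : ~~ desc s' m.
    apply/negP => /(wle_desc (lo (gen s' * a0)%g _)) h.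
    have : desc s' (gen s' * a0)%g.
      by apply: h; rewrite /Xs genK; split=> //; apply: Ds'.
    by rewrite desc_flip Ds'.
  split=> // [a Xa|x dx hx].
    apply: wle_gen_desc => //; last exact: Ds'.
    by apply: lo; rewrite /Xs genK; split=> //; apply: Ds'.
  apply/(@wle_genE _ _ _ _ _ s').
    by rewrite desc_flip dx (negPf nm).
  rewrite genK; apply: gr => y [Xy dy].
  apply/(@wle_genE _ _ _ _ _ s').
    by rewrite desc_flip dx; move: dy; rewrite desc_flip => /negPf ->.
  by rewrite genK; apply: hx.
have [m hm] := mex s Ds; have [lo nm gr] := lem s m Ds hm.
exists (gen s * m)%g; split=> // x hx.
have [->|/(len_pred)[t dx]] := pselect (x = 1%g); first exact: wle1.
have Dt : D t by move=> a Xa; apply: (wle_desc (hx a Xa)).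
have [e|net] := eqVneq t s; first by apply: gr => //; rewrite -e.
have [m' hm'] := mex t Dt; have [lo' nm' gr'] := lem t m' Dt hm'.
apply: (wle_trans (gr' x dx hx)); apply: gr => //.
(* [s] and [t] are descents of all of [X], so the longest element [g] of their group is a lower
   bound. It lies below the candidate built from [t], which therefore has the descent [s] too and
   lies below the candidate built from [s]. *)
have [g [hg gle]] := dihedral_top_ex net (Dt _ Xa0) (Ds _ Xa0).
have [dg dg'] := dihedral_desc hg.
apply: (wle_desc _ dg'); apply: gr' => // a Xa.
by apply: gle; [apply: Dt|apply: Ds].
Qed.

Lemma join_ex (X : W -> Prop) j : (forall a, X a -> wle a j) ->
  exists m, isjoin X m.
Proof.
move=> hj; have [m [lo gr]] := @meet_ex (fun x => forall a, X a -> wle a x) j hj.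
by exists m; split=> // a Xa; apply: gr => x; apply.
Qed.

Lemma join2_ex a b j : wle a j -> wle b j ->
  exists m, [/\ wle a m, wle b m & forall x, wle a x -> wle b x -> wle m x].
Proof.
move=> aj bj; have [|m [up lo]] := @join_ex (fun x => x = a \/ x = b) j.
  by move=> x [->|->].
exists m; split; [by apply: up; left|by apply: up; right|].
by move=> x ax bx; apply: lo => y [->|->].
Qed.

End Lattice.

(** * The Euler form of a word *)

Section Sorting.
Context {W : groupType} {S : finType} {gen : S -> W}.
Context {R : realFieldType} {rho : georep gen R}.
Local Notation V := {ffun S -> R}.
Local Notation ac := (act rho).
Local Notation A := (bil (gram rho)).
Implicit Types (s t : S) (l : seq S) (w : W) (x y b : V).

(** The unitriangular half of the Gram matrix for the order of [l]. The row of the first letter and,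
    among the letters of [l], the column of the last one reduce to the diagonal, so pairing with
    that simple root reads off a coefficient. *)
Definition euler_gram l i j : R :=
  if i == j then 1 else if (index j l < index i l)%N then gram rho i j else 0.
Definition euler l := bil (euler_gram l).
Definition omega l x y := euler l x y - euler l y x.
Lemma omegaE l x y : omega l x y = euler l x y - euler l y x.
Proof. by []. Qed.
Local Notation span l := (spanned (fun i => i \in l)).

Lemma eulerDl l x y z : euler l (x + y) z = euler l x z + euler l y z.
Proof. exact: bilDl. Qed.
Lemma eulerDr l x y z : euler l x (y + z) = euler l x y + euler l x z.
Proof. exact: bilDr. Qed.
Lemma eulerNl l x z : euler l (- x) z = - euler l x z.
Proof. exact: bilNl. Qed.
Lemma eulerNr l x z : euler l x (- z) = - euler l x z.
Proof. exact: bilNr. Qed.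
Lemma eulerZl l c x z : euler l (scal c x) z = c * euler l x z.
Proof. exact: bilZl. Qed.
Lemma eulerZr l c x z : euler l x (scal c z) = c * euler l x z.
Proof. exact: bilZr. Qed.
Definition eulerE := (eulerDl, eulerDr, eulerNl, eulerNr, eulerZl, eulerZr).

Lemma euler_headl s l x : euler (s :: l) (simple s) x = x s.
Proof.
rewrite /euler bil_simplel (bigD1 s) //= big1 ?addr0 => [|j /negPf js].
  by rewrite /euler_gram eqxx mul1r.
by rewrite /euler_gram eq_sym js /= eqxx ltn0 mul0r.
Qed.

Lemma euler_lastr s l x : s \notin l -> span (rcons l s) x ->
  euler (rcons l s) x (simple s) = x s.
Proof.
move=> sl sx; rewrite /euler bil_simpler (bigD1 s) //= big1 ?addr0 => [|i js].
  by rewrite /euler_gram eqxx mul1r.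
rewrite /euler_gram (negPf js) -!cats1 !index_cat (negPf sl) /= eqxx addn0.
have [il|il] := boolP (i \in l); first by rewrite ltnNge ltnW ?index_mem ?mul0r.
by rewrite sx ?mulr0 // mem_rcons inE negb_or js.
Qed.

Lemma euler_sym l x y : span l x -> span l y -> euler l x y + euler l y x = A x y.
Proof.
move=> sx sy; have -> : euler l y x = bil (fun i j => euler_gram l j i) x y.
  rewrite /euler /bil exchange_big; apply: eq_bigr => i _; apply: eq_bigr => j _; ring.
rewrite (_ : _ + _ = bil (fun i j => euler_gram l i j + euler_gram l j i) x y).
  apply: (eq_bil _ sx sy) => i j il jl; rewrite /euler_gram (eq_sym j).
  have [->|ne] := eqVneq i j; first by rewrite gram_diag; lra.
  have /negPf := ne; case: ltngtP => // [_ _|_ _|e].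
  - by rewrite addr0.
  - by rewrite add0r gram_sym.
  by move: ne; rewrite -(nth_index i il) -e nth_index // eqxx.
rewrite /euler /bil -big_split; apply: eq_bigr => i _; rewrite -big_split.
by apply: eq_bigr => j _ /=; ring.
Qed.

Lemma euler_cons s l x y : s \notin l -> span l x -> span l y ->
  euler (s :: l) x y = euler l x y.
Proof.
move=> sl sx sy; apply: (eq_bil _ sx sy) => i j il jl; rewrite /euler_gram /=.
have ne k : k \in l -> (s == k) = false by move=> kl; apply: contraNF sl => /eqP ->.
by rewrite !ne.
Qed.

Lemma euler_rcons s l x y : span l x -> span l y ->
  euler (rcons l s) x y = euler l x y.
Proof.
move=> sx sy; apply: (eq_bil _ sx sy) => i j il jl; rewrite /euler_gram.
by rewrite -cats1 !index_cat il jl.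
Qed.

Lemma span_split s l x : span (s :: l) x ->
  exists2 x', span l x' & x = scal (x s) (simple s) + x'.
Proof.
move=> sx; exists (x - scal (x s) (simple s)); last by rewrite addrC subrK.
move=> i il; rewrite !vE; have [->|ne] := eqVneq i s; first by rewrite mulr1 subrr.
by rewrite mulr0 subr0 sx // inE negb_or ne.
Qed.

Lemma span_rcons s l x : span (rcons l s) x <-> span (s :: l) x.
Proof. by split=> h i hi; apply: h; move: hi; rewrite mem_rcons. Qed.

Lemma span_tail s l x : span l x -> span (s :: l) x.
Proof. by apply: spannedS => i il; rewrite inE il orbT. Qed.

Lemma span_head s l : span (s :: l) (simple s : V).
Proof. by apply: spanned_simple; rewrite mem_head. Qed.

Lemma span_cons_head0 s l x : span (s :: l) x -> x s = 0 -> span l x.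
Proof.
move=> sx xs i il; have [->//|ne] := eqVneq i s.
by rewrite sx // inE negb_or ne.
Qed.

Lemma span_gen s l x : span (s :: l) x -> span (s :: l) (ac (gen s) x).
Proof. by apply: spanned_gen; rewrite mem_head. Qed.

(** When [s] goes from first to last place, exactly the off-diagonal entries at [s] cross the
    diagonal, and the change of the [s]-coefficients under the reflection compensates for it. *)
Lemma euler_rot s l x y : s \notin l -> span (s :: l) x -> span (s :: l) y ->
  euler (rcons l s) (ac (gen s) x) (ac (gen s) y) = euler (s :: l) x y.
Proof.
move=> sl sx sy; have [x' sx' ex] := span_split sx; have [y' sy' ey] := span_split sy.
have E1 : euler (rcons l s) x' (simple s) = 0.
  by rewrite euler_lastr ?sx' //; apply/span_rcons/span_tail.
have E2 : euler (rcons l s) (simple s) y' = A (simple s) y'.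
  rewrite -(@euler_sym (rcons l s)) ?euler_lastr ?sy' ?addr0 //; try exact/span_rcons/span_tail.
  exact/span_rcons/span_head.
have E2' : euler (rcons l s) (simple s) (simple s) = 1.
  by rewrite euler_lastr ?simple_id //; apply/span_rcons/span_head.
have E3 : euler (s :: l) x' (simple s) = A x' (simple s).
  rewrite -(@euler_sym (s :: l)) ?euler_headl ?sx' ?addr0 //; first exact: span_tail.
  exact: span_head.
have ac_split (z z' : V) : z = scal (z s) (simple s) + z' ->
    ac (gen s) z = scal (- (z s + A (simple s) z')) (simple s) + z'.
  move=> ez; rewrite act_gen {2}ez !bilE form_simple {1}ez.
  by apply/ffunP=> i; rewrite !vE; ring.
rewrite (ac_split _ _ ex) (ac_split _ _ ey) [in RHS]ex [in RHS]ey !eulerE.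
rewrite !euler_headl simple_id sy' // E1 E2 E2' E3 euler_rcons // euler_cons //.
by rewrite (form_sym x'); ring.
Qed.
End Sorting.
Arguments span_head {S R} s l [i] _.

(** * Monotonicity for a word *)

Section PiDown.
Context {W : groupType} {S : finType} {gen : S -> W}.
Context {R : realFieldType} {rho : georep gen R}.
Local Notation V := {ffun S -> R}.
Local Notation len := (cox_length gen).
Local Notation ac := (act rho).
Local Notation A := (bil (gram rho)).
Local Notation root := (@root W S gen R rho).
Local Notation proot := (@proot W S gen R rho).
Local Notation inv := (@inv W S gen R rho).
Local Notation wle := (@wle W S gen R rho).
Local Notation desc := (@desc W S gen).
Local Notation supported := (@supported W S gen R rho).
Implicit Types (s t : S) (l : seq S) (w : W) (x y b : V).
Local Notation span l := (spanned (fun i => i \in l)).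
Local Notation euler := (@euler W S gen R rho).
Local Notation omega := (@omega W S gen R rho).

Lemma omegaDl l x y z : omega l (x + y) z = omega l x z + omega l y z.
Proof. by rewrite /omega !eulerE; ring. Qed.
Lemma omegaZl l c x z : omega l (scal c x) z = c * omega l x z.
Proof. by rewrite /omega !eulerE; ring. Qed.
Lemma omegaxx l x : omega l x x = 0.
Proof. by rewrite /omega subrr. Qed.
Lemma omegaC l x y : omega l x y = - omega l y x.
Proof. by rewrite /omega opprB. Qed.

(** For a positive root other than [simple s] both summands are coefficients of positive roots; this
    is the sense in which the first letter precedes every root. *)
Lemma omega_head s l x : span (s :: l) x ->
  omega (s :: l) (simple s) x = x s + ac (gen s) x s.
Proof.
move=> sx; have := euler_sym (rho := rho) sx (span_head s l).
by rewrite /omega !euler_headl (act_gens s x) (form_sym (simple s)) => <-; ring.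
Qed.

Lemma omega_last s l x : s \notin l -> span (s :: l) x ->
  omega (rcons l s) x (simple s) = x s + ac (gen s) x s.
Proof.
move=> sl /span_rcons sx.
have sh : span (rcons l s) (simple s : V) by apply/span_rcons/span_head.
have := euler_sym (rho := rho) sh sx.
by rewrite /omega !euler_lastr // (act_gens s x) => <-; ring.
Qed.

Lemma omega_head_ge0 s l b : proot b -> span (s :: l) b ->
  0 <= omega (s :: l) (simple s) b.
Proof.
move=> pb sb; have [->|ne] := pselect (b = simple s); first by rewrite omegaxx.
rewrite omega_head //; have [_ h] := proot_gen pb ne; case: pb => _ b0.
by rewrite addr_ge0.
Qed.

Lemma omega_last_ge0 s l b : s \notin l -> proot b -> span (s :: l) b ->
  0 <= omega (rcons l s) b (simple s).
Proof.
move=> sl pb sb; rewrite omega_last // -(omega_head sb); exact: omega_head_ge0.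
Qed.

Lemma omega_rot s l x y : s \notin l -> span (s :: l) x -> span (s :: l) y ->
  omega (rcons l s) (ac (gen s) x) (ac (gen s) y) = omega (s :: l) x y.
Proof. by move=> sl sx sy; rewrite /omega !euler_rot. Qed.

Lemma omega_cons s l x y : s \notin l -> span l x -> span l y ->
  omega (s :: l) x y = omega l x y.
Proof. by move=> sl sx sy; rewrite /omega !euler_cons. Qed.

Lemma omega_head_eq0 s l b : proot b -> b <> simple s -> span (s :: l) b ->
  omega (s :: l) (simple s) b <= 0 -> b s = 0 /\ A (simple s) b = 0.
Proof.
move=> pb ne sb; rewrite omega_head //; have [_ /(_ s) h] := proot_gen pb ne.
case: pb => _ /(_ s) b0; move: h; rewrite act_gens => h1 h2.
by split; lra.
Qed.

Fixpoint pi_fuel n l w : W :=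
  match n, l with
  | n'.+1, s :: l' =>
      if desc s w then (gen s * pi_fuel n' (rcons l' s) (gen s * w))%g
      else pi_fuel n' l' w
  | _, _ => 1%g
  end.
(** A taken letter shortens [w] and keeps the size of the word, a dropped one shortens the word, so
    this fuel never runs out. *)
Definition pi l w := pi_fuel (len w + size l) l w.

Lemma pi_nil w : pi [::] w = 1%g.
Proof. by rewrite /pi; case: (_ + _)%N. Qed.

Lemma pi_take s l w : desc s w -> pi (s :: l) w = (gen s * pi (rcons l s) (gen s * w))%g.
Proof.
move=> d; rewrite /pi /= addnS /= d size_rcons addnS.
by rewrite -addSn -(desc_len d).
Qed.

Lemma pi_skip s l w : ~~ desc s w -> pi (s :: l) w = pi l w.
Proof. by move=> /negPf d; rewrite /pi /= addnS /= d. Qed.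

Lemma pi_ind (Q : seq S -> W -> Prop) :
  (forall w, Q [::] w) ->
  (forall s l w, s \notin l -> uniq l -> desc s w -> Q (rcons l s) (gen s * w)%g ->
     Q (s :: l) w) ->
  (forall s l w, s \notin l -> uniq l -> ~~ desc s w -> Q l w -> Q (s :: l) w) ->
  forall l w, uniq l -> Q l w.
Proof.
move=> Q0 Qt Qs l w; have [n] := ubnP (len w + size l)%N.
elim: n l w => // n IH [|s l] w; rewrite ltnS => le //= /andP[sl ul].
have [d|d] := boolP (desc s w).
  apply: Qt => //; apply: IH; last by rewrite rcons_uniq sl.
  by move: le; rewrite size_rcons (desc_len d) /= addSn.
by apply: Qs => //; apply: IH => //; move: le; rewrite /= addnS.
Qed.

Lemma pi_supported l w : uniq l -> supported (fun i => i \in l) (pi l w).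
Proof.
move: l w; apply: pi_ind => [w|s l w sl ul d IH|s l w sl ul d IH].
- by rewrite pi_nil; apply: supported1.
- rewrite pi_take // => b ib; have pb := inv_proot ib.
  have [->|ne] := pselect (b = simple s); first exact: span_head.
  rewrite -(act_genK s b); apply: span_gen; apply/span_rcons; apply: IH.
  by apply/inv_genl.
- by rewrite pi_skip // => b /IH; apply: span_tail.
Qed.

Lemma pi_le l w : uniq l -> wle (pi l w) w.
Proof.
move: l w; apply: pi_ind => [w|s l w sl ul d IH|s l w sl ul d IH].
- by rewrite pi_nil; apply: wle1.
- rewrite pi_take //; apply: wle_gen_desc => //.
  by apply/negP => /(wle_desc IH); rewrite desc_flip d.
- by rewrite pi_skip.
Qed.

Lemma pi_ndesc l s w : uniq l -> ~~ desc s w -> ~~ desc s (pi l w).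
Proof. by move=> ul; apply: contra; apply: wle_desc; apply: pi_le. Qed.

Lemma pi_ndesc_take l s w : uniq l -> desc s w -> ~~ desc s (pi l (gen s * w)%g).
Proof. by move=> ul d; apply: pi_ndesc => //; rewrite desc_flip d. Qed.

Lemma pi_desc l s w : uniq (s :: l) -> desc s w -> desc s (pi (s :: l) w).
Proof.
move=> /= /andP[sl ul] d; rewrite pi_take // desc_flip.
by apply: pi_ndesc_take => //; rewrite rcons_uniq sl.
Qed.

Lemma supported_ndesc l s w : s \notin l -> supported (fun i => i \in l) w -> ~~ desc s w.
Proof.
move=> sl sw; apply: contra sl => /(descP (rho := rho))/sw; exact: spanned_simpleP.
Qed.

Lemma pi_idem l w : uniq l -> pi l (pi l w) = pi l w.
Proof.
move: l w; apply: pi_ind => [w|s l w sl ul d IH|s l w sl ul d IH].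
- by rewrite !pi_nil.
- have us : uniq (s :: l) by rewrite /= sl.
  rewrite [LHS]pi_take; last exact: pi_desc.
  by rewrite pi_take // genK IH.
- rewrite pi_skip // pi_skip //; apply: (supported_ndesc sl); exact: pi_supported.
Qed.

(** The recursion only tests letters of [l], and the roots behind these tests stay in the span of
    [l]. *)
Lemma pi_ext l w w' : uniq l ->
  (forall b, span l b -> inv w b <-> inv w' b) -> pi l w = pi l w'.
Proof.
move=> ul; move: l w ul w'.
apply: pi_ind => [w w' _|s l w sl ul d IH w' h|s l w sl ul d IH w' h].
- by rewrite !pi_nil.
- have d' : desc s w' by apply/(descP (rho := rho))/h; [exact: span_head|apply/descP].
  rewrite !pi_take // (IH (gen s * w')%g) // => b sb.
  have [pb|npb] := pselect (proot b); last by split=> /inv_proot.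
  have [->|ne] := pselect (b = simple s).
    by split=> /descP; rewrite desc_flip ?d ?d'.
  rewrite !inv_genl //; apply: h; apply: span_gen; exact/span_rcons.
- have d' : ~~ desc s w'.
    by apply: contra d => /(descP (rho := rho))/h => i; apply/(descP (rho := rho)); apply: i; apply: span_head.
  by rewrite !pi_skip //; apply: IH => b sb; apply: h; apply: span_tail.
Qed.

Lemma pi_par l w : uniq l -> pi l (par (rho := rho) (fun i => i \in l) w) = pi l w.
Proof. by move=> ul; apply: pi_ext => // b sb; rewrite parP; split=> [[]|]. Qed.

Lemma pi_filter (P : pred S) l w : uniq l -> supported P w -> pi (filter P l) w = pi l w.
Proof.
move: l w; apply: pi_ind => [w _|s l w sl ul d IH sw|s l w sl ul d IH sw] //=.
- have [Ps sw'] := supported_gen sw d.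
  by rewrite Ps !pi_take // -IH // filter_rcons Ps.
- by case: ifP => _; rewrite !pi_skip // IH.
Qed.

(* The roots at which the recursion defining [pi] skips a letter. *)
Inductive skips : seq S -> W -> V -> Prop :=
| skips_head s l w : ~~ desc s w -> skips (s :: l) w (simple s)
| skips_tail s l w b : ~~ desc s w -> skips l w b -> skips (s :: l) w b
| skips_take s l w b : desc s w -> skips (rcons l s) (gen s * w)%g b ->
    skips (s :: l) w (ac (gen s) b).

Inductive cone (P : V -> Prop) : V -> Prop :=
| cone0 : cone P 0
| coneD c x y : 0 <= c -> P x -> cone P y -> cone P (scal c x + y).

Lemma skips_nil w b : ~ skips [::] w b.
Proof. by move=> h; inversion h. Qed.

Lemma skips_takeP s l w b : desc s w -> skips (s :: l) w b ->
  exists2 b', skips (rcons l s) (gen s * w)%g b' & b = ac (gen s) b'.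
Proof.
move=> d h; inversion h as [? ? ? nd|? ? ? ? nd|? ? ? b' d' h'].
- by rewrite d in nd.
- by rewrite d in nd.
- by exists b'.
Qed.

Lemma skips_skipP s l w b : ~~ desc s w -> skips (s :: l) w b ->
  b = simple s \/ skips l w b.
Proof.
move=> d h; inversion h as [? ? ? nd|? ? ? ? nd|? ? ? b' d' h'].
- by left.
- by right.
- by rewrite d' in d.
Qed.

Lemma skips_proot l w b : uniq l -> skips l w b -> proot (ac w^-1 b).
Proof.
move=> ul; move: l w ul b; apply: pi_ind => [w b /skips_nil//||].
- move=> s l w sl ul d IH b /(skips_takeP d)[b' /IH + ->].
  by rewrite invgM gen_inv actM.
- move=> s l w sl ul d IH b /(skips_skipP d)[->|/IH//].
  split; first by apply: root_act; apply: root_simple.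
  exact: desc_pos.
Qed.

Lemma skips_span l w b : uniq l -> skips l w b -> span l b.
Proof.
move=> ul; move: l w ul b; apply: pi_ind => [w b /skips_nil//||].
- move=> s l w sl ul d IH b /(skips_takeP d)[b' /IH sb ->].
  by apply: span_gen; apply/span_rcons.
- move=> s l w sl ul d IH b /(skips_skipP d)[->|/IH]; first exact: span_head.
  exact: span_tail.
Qed.

(** Rotation invariance carries the pair to the moment when the first of the two letters is dropped.
    That root is then [simple s] at the head of the word, and the other one has no
    [s]-coefficient. *)
Lemma skips_euler l w b b' : uniq l -> skips l w b -> skips l w b' -> b <> b' ->
  euler l b b' = 0 \/ euler l b' b = 0.
Proof.
move=> ul; move: l w ul b b'; apply: pi_ind => [w b b' /skips_nil//||].
- move=> s l w sl ul d IH b b' /(skips_takeP d)[c hc ->] /(skips_takeP d)[c' hc' ->] ne.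
  have us : uniq (rcons l s) by rewrite rcons_uniq sl.
  have sc := iffLR (span_rcons _ _ _) (skips_span us hc).
  have sc' := iffLR (span_rcons _ _ _) (skips_span us hc').
  rewrite -!euler_rot ?act_genK //; try exact: span_gen.
  by apply: IH => // e; apply: ne; rewrite e.
- have aux s l w b : s \notin l -> uniq l -> skips l w b -> euler (s :: l) (simple s) b = 0.
    by move=> sl ul h; rewrite euler_headl (skips_span ul h).
  move=> s l w sl ul d IH b b' /(skips_skipP d)[->|h] /(skips_skipP d)[->|h'] // ne.
  + by left; apply: aux h'.
  + by right; apply: aux h.
  + rewrite !euler_cons //; [exact: IH| | | | ];
      by [apply: skips_span h'|apply: skips_span h].
Qed.

Lemma cone_map (P Q : V -> Prop) w : (forall x, P x -> Q (ac w x)) ->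
  forall x, cone P x -> cone Q (ac w x).
Proof.
move=> PQ x; elim=> [|c y z c0 Py _ IH]; first by rewrite act0; apply: cone0.
by rewrite actD actZ; apply: coneD => //; apply: PQ.
Qed.

Lemma cone_mono (P Q : V -> Prop) x : (forall x, P x -> Q x) -> cone P x -> cone Q x.
Proof. by move=> PQ; elim=> [|c y z c0 Py _ IH]; [apply: cone0|apply: coneD => //; apply: PQ]. Qed.

(** If [s] is taken, the new [s]-coefficient of [x] is minus its Euler pairing with [simple s],
    nonnegative by the hypothesis at that inversion. If [s] is dropped, the [s]-part of [x] is split
    off as a multiple of a dropped root. *)
Lemma cone_skips l w x : uniq l -> span l x -> nonneg x ->
  (forall b, inv w b -> span l b -> euler l x b <= 0) -> cone (skips l w) x.
Proof.
move=> ul; move: l w ul x; apply: pi_ind => [w x sx _ _||].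
- by rewrite (_ : x = 0); [apply: cone0|apply/ffunP=> i; rewrite sx ?vE].
- move=> s l w sl ul d IH x sx x0 h.
  rewrite -(act_genK s x); apply: (cone_map (P := skips (rcons l s) (gen s * w)%g)).
    by move=> y; apply: skips_take.
  apply: IH => [|i|b ib sb]; first exact/span_rcons/span_gen.
    have [->|ne] := eqVneq i s; last by rewrite act_genE.
    have /(descP (rho := rho)) ids := d; have := h _ ids (span_head s l).
    have := euler_sym (rho := rho) sx (span_head s l).
    by rewrite euler_headl act_gens form_sym => e h0; lra.
  have pb := inv_proot ib; move/span_rcons: sb => sb.
  have ne : b <> simple s by move=> e; move: ib; rewrite e => /descP; rewrite desc_flip d.
  rewrite -(act_genK s b) euler_rot //; last exact: span_gen.
  by apply: h; [apply/inv_genl|apply: span_gen].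
- move=> s l w sl ul d IH x sx x0 h; have [x' sx' ex] := span_split sx.
  rewrite ex; apply: coneD; [exact: x0|exact: skips_head|].
  apply: (cone_mono (P := skips l w)) => [y|]; first exact: skips_tail.
  apply: IH => // [i|b ib sb].
    have [->|ne] := eqVneq i s; first by rewrite sx'.
    by have := x0 i; rewrite {1}ex !vE (negPf ne) mulr0 add0r.
  have := h b ib (span_tail sb); rewrite ex !eulerE euler_headl (sb s) //.
  by rewrite mulr0 add0r euler_cons.
Qed.

Lemma cone_skips_last s l w : s \notin l -> uniq l -> ~~ desc s w ->
  cone (skips (rcons l s) w) (simple s).
Proof.
move=> sl ul d; apply: cone_skips => [|||b ib /span_rcons sb].
- by rewrite rcons_uniq sl.
- exact/span_rcons/span_head.
- exact: nonneg_simple.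
have ne : b <> simple s by move=> e; move: ib d; rewrite e => /descP ->.
have pb := inv_proot ib.
have := omega_last sl sb; rewrite /omega euler_lastr //; last exact/span_rcons.
by have [_ /(_ s)] := proot_gen pb ne; lra.
Qed.

(** For a letter [s] just taken, [- simple s] is the reflection of [simple s], and [s] is now the
    last letter and no longer a descent, the case of [cone_skips_last]. *)
Lemma cone_skips_inv l w b : uniq l -> inv (pi l w) b -> cone (skips l w) (- b).
Proof.
move=> ul; move: l w ul b; apply: pi_ind => [w b|s l w sl ul d IH b|s l w sl ul d IH b].
- by rewrite pi_nil => /inv1.
- rewrite pi_take // => ib; have pb := inv_proot ib.
  rewrite -(act_genK s (- b)); apply: (cone_map (P := skips (rcons l s) (gen s * w)%g)).
    by move=> y; apply: skips_take.
  have [->|ne] := pselect (b = simple s).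
    by rewrite actN act_simple opprK; apply: cone_skips_last; rewrite // desc_flip d.
  by rewrite actN; apply: IH; apply/inv_genl.
- rewrite pi_skip // => /IH; apply: cone_mono => y; exact: skips_tail.
Qed.

Lemma cone_simple (P : V -> Prop) w x s : cone P x -> ac w x = simple s ->
  (forall y, P y -> proot (ac w y)) -> exists2 y, P y & ac w y = simple s.
Proof.
move=> cx e hP; have nn z : cone P z -> nonneg (ac w z).
  elim=> [i|c y z' c0 Py _ IH i]; first by rewrite act0 vE.
  by rewrite actD actZ; apply: nonnegD => //; apply: nonnegZ => //; case: (hP y Py).
elim: cx e => [e|c y z c0 Py cz IH].
  by case: (root_neq0 (rho := rho) (root_simple s)); rewrite -e act0.
have [->|cn] := eqVneq c 0; first by rewrite scal0 add0r.
move=> e; exists y => //; apply: (simple_comb (p := c) (q := 1) (y := ac w z)) => //.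
- by rewrite -e actD actZ scal1.
- by rewrite lt_def cn.
- exact: hP.
- exact: nn.
Qed.

Lemma act_orth_inv w x : (forall b, inv w b -> A b x = 0) -> ac w^-1 x = x.
Proof.
have [n] := ubnP (len w); elim: n w => // n IH w; rewrite ltnS => lw h.
have [->|/len_pred[s d]] := pselect (w = 1%g); first by rewrite invg1 act1.
have ds : desc s w by [].
have sx : ac (gen s) x = x.
  rewrite act_gen h; last exact/(descP (rho := rho)).
  by rewrite scal0 subr0.
rewrite -(genK s w) invgM gen_inv actM sx; apply: IH => [|b ib].
  exact: leq_trans d lw.
have pb := inv_proot ib.
have ne : b <> simple s by move=> e; move: ib; rewrite e => /descP; rewrite desc_flip ds.
by rewrite -sx -(act_genK s b) form_act; apply: h; apply/inv_genl.
Qed.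

(** At the moment of dropping, [m] is [simple s] with [s] first, so [omega] is nonnegative in both
    directions between [m] and each remaining inversion. All of these are then orthogonal to [m],
    and what is left of [pi l w] fixes it. *)
Lemma skips_late_simple l w m : uniq l -> skips l w m ->
  (forall b, inv (pi l w) b -> 0 <= omega l b m) ->
  exists r, ac (pi l w)^-1 m = simple r.
Proof.
move=> ul; move: l w ul m; apply: pi_ind => [w m /skips_nil//||].
- move=> s l w sl ul d IH m /(skips_takeP d)[m' hm' ->]; rewrite pi_take // => h.
  have us : uniq (rcons l s) by rewrite rcons_uniq sl.
  rewrite invgM gen_inv actM act_genK; apply: IH => // b ib.
  have sb := pi_supported us ib; move/span_rcons: sb => sb.
  have sm := iffLR (span_rcons _ _ _) (skips_span us hm').
  have pb := inv_proot ib.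
  have nd := pi_ndesc_take us d.
  have ne : b <> simple s by move=> e; move: ib; rewrite e => /descP; apply/negP.
  rewrite -(act_genK s b) -(act_genK s m') omega_rot //; try exact: span_gen.
  by apply: h; apply/inv_gen.
- move=> s l w sl ul d IH m /(skips_skipP d)[->|hm]; rewrite pi_skip // => h; last first.
    apply: IH => // b ib; have sb := pi_supported ul ib.
    by rewrite -(omega_cons sl) //; [apply: h|apply: skips_span hm].
  exists s; apply: act_orth_inv => b ib.
  have pb := inv_proot ib; have sb := pi_supported ul ib.
  have := h b ib; rewrite omegaC oppr_ge0 form_sym => /(omega_head_eq0 pb _ (span_tail sb)).
  case=> // e; move: (sb s sl); rewrite e simple_id => /eqP; rewrite oner_eq0 //.
Qed.

Lemma conj_simple w s r : ac w (simple r) = simple s -> (gen s * w = w * gen r)%g.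
Proof.
move=> e; have key b : ac w^-1 (ac (gen s) b) = ac (gen r) (ac w^-1 b).
  by rewrite !act_gen actD actN actZ -e actK form_actl.
have le1 : wle (gen s * w)%g (w * gen r)%g.
  move=> b [pb]; rewrite invgM gen_inv actM key => h.
  by split=> //; rewrite invgM gen_inv actM.
have le2 : wle (w * gen r)%g (gen s * w)%g.
  move=> b [pb]; rewrite invgM gen_inv actM => h.
  by split=> //; rewrite invgM gen_inv actM key.
exact: wle_anti le1 le2.
Qed.

(** [simple s] is in the cone of the dropped roots and becomes simple under the inverse of [w],
    hence is a dropped root. As [s] is the last letter, every inversion precedes it, and
    [skips_late_simple] applies. *)
Lemma pi_cover_last s l w r : s \notin l -> uniq l -> ac w (simple r) = simple s ->
  exists2 r', ac (pi (rcons l s) w) (simple r') = simple s &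
    wle (pi (rcons l s) w) (gen s * pi (rcons l s) w)%g.
Proof.
move=> sl ul e; set z := pi _ _.
have us : uniq (rcons l s) by rewrite rcons_uniq sl.
have nd : ~~ desc s w.
  apply/negP => /(descP (rho := rho))[_]; rewrite -e actK => /proot_notneg; apply.
  exact: proot_simple.
have [||m hm em] := @cone_simple _ w^-1%g _ r (cone_skips_last sl ul nd).
- by rewrite -e actK.
- by move=> y hy; apply: skips_proot hy.
have {}em : m = simple s by rewrite -e -em actVK.
move: hm; rewrite em => hm.
have [|r' er'] := skips_late_simple us hm.
  move=> b ib; apply: omega_last_ge0 => //; first exact: inv_proot ib.
  by apply/span_rcons; apply: pi_supported ib.
have {}er' : ac z (simple r') = simple s by rewrite -er' actVK.
exists r' => //; rewrite (conj_simple er'); apply: wle_mulr.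
by rewrite er'; apply: proot_simple.
Qed.

Theorem pi_mono l (x y : W) : uniq l -> wle x y -> wle (pi l x) (pi l y).
Proof.
have [n] := ubnP (len y + size l)%N; elim: n l x y => // n IH l x y.
rewrite ltnS => le ul xy.
have [->|ne] := pselect (x = y); first exact: wle_refl.
have [y' [r [ey py' xy']]] := lower_cover xy ne.
apply: (wle_trans (v := pi l y')).
  by apply: IH => //; rewrite ey len_mulr // in le; apply: leq_trans le; rewrite addSn.
case: l le ul => [|s l] le ul; first by rewrite pi_nil; apply: wle1.
have [sl ull] : s \notin l /\ uniq l by move/andP: ul.
have us : uniq (rcons l s) by rewrite rcons_uniq sl.
have y'y : wle y' y by rewrite ey; apply: wle_mulr.
have [d'|d'] := boolP (desc s y').
  have d := wle_desc y'y d'.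
  rewrite !pi_take //; apply: wle_gen.
    by rewrite (negPf (pi_ndesc_take us d)) (negPf (pi_ndesc_take us d')).
  apply: IH => //; last by apply: wle_gen; rewrite ?d ?d'.
  by move: le; rewrite size_rcons (desc_len d) addSn.
rewrite (pi_skip l d'); have [d|d] := boolP (desc s y); last first.
  by rewrite pi_skip //; apply: IH => //; move: le; rewrite /= addnS.
(* The only case where the two computations diverge: [s] is a descent of [y] but not of [y'], so the
   new inversion is [simple s] and [y] equals [gen s * y']. *)
have er : ac y' (simple r) = simple s.
  have /(descP (rho := rho)) := d; rewrite ey => /inv_mulr[//|/descP dd|//].
  by rewrite dd in d'.
have [r' _ hz] := pi_cover_last sl ull er.
rewrite pi_take // ey -(conj_simple er) genK.
apply: wle_trans hz.
(* On the part of [y'] supported on [l], a trailing [s] changes nothing, so [pi l y'] becomes a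
   value of [pi (rcons l s)] at a smaller element and the induction hypothesis compares the two. *)
rewrite -(pi_par y' ull) -(pi_filter (P := fun i => i \in l)) //; last first.
  exact: par_supported.
rewrite (_ : filter _ l = filter (fun i => i \in l) (rcons l s)); last first.
  by rewrite filter_rcons (negPf sl).
rewrite pi_filter //; last exact: par_supported.
apply: IH => //; last exact: par_le.
by move: le; rewrite size_rcons ey len_mulr // addSn.
Qed.

End PiDown.

(** * Alignment *)

Section Aligned.
Context {W : groupType} {S : finType} {gen : S -> W}.
Context {R : realFieldType} {rho : georep gen R}.
Local Notation V := {ffun S -> R}.
Local Notation ac := (act rho).
Local Notation root := (@root W S gen R rho).
Local Notation proot := (@proot W S gen R rho).
Local Notation inv := (@inv W S gen R rho).
Local Notation desc := (@desc W S gen).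
Local Notation supported := (@supported W S gen R rho).
Implicit Types (s t : S) (l : seq S) (w : W) (x y b : V).
Local Notation span l := (spanned (fun i => i \in l)).
Local Notation omega := (@omega W S gen R rho).
Local Notation pi := (@pi W S gen).

Lemma span_comb (P : pred S) b p q x y : nonneg x -> nonneg y -> 0 < p -> 0 < q ->
  b = scal p x + scal q y -> spanned P b -> spanned P x /\ spanned P y.
Proof.
move=> x0 y0 p0 q0 e sb.
have h i : ~~ P i -> x i = 0 /\ y i = 0.
  move=> nP; have := sb i nP; rewrite e !vE => e0.
  have h1 := mulr_ge0 (ltW p0) (x0 i); have h2 := mulr_ge0 (ltW q0) (y0 i).
  have /eqP : p * x i = 0 by lra.
  have /eqP : q * y i = 0 by lra.
  by rewrite !mulf_eq0 (gt_eqF p0) (gt_eqF q0) /= => /eqP -> /eqP ->.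
by split=> i /h[].
Qed.

(** Sortability without reference to the recursion: whenever an inversion lies strictly between two
    positive roots, the one that [omega] puts first is an inversion as well. *)
Definition align l w := forall b c d p q, inv w b -> span l b ->
  proot c -> proot d -> 0 < p -> 0 < q -> b = scal p c + scal q d ->
  0 <= omega l c d -> inv w c.

Lemma gram_le0 s t : s != t -> gram rho s t <= 0.
Proof. by move=> /(gram_off rho)/orP[/eqP->//|]; lra. Qed.

(* [simple s] is on the [c] side of every [omega]-nonnegative pair, so a
   decomposition using it as [d] would have to be orthogonal. *)
Lemma head_not_right s l b c p q : proot b -> b <> simple s -> proot c ->
  c <> simple s -> 0 < p -> 0 < q -> b = scal p c + scal q (simple s) ->
  span (s :: l) c -> 0 <= omega (s :: l) c (simple s) -> False.
Proof.
move=> pb nb pc nc p0 q0 e sc; rewrite omegaC oppr_ge0.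
move=> /(omega_head_eq0 pc nc sc)[cs Ac]; have [_ /(_ s)] := proot_gen pb nb.
rewrite act_gens e !bilE !vE eqxx mulr1 cs Ac form_simple; lra.
Qed.

Lemma simple_decomp s b c d p q : proot c -> nonneg d -> 0 < p -> 0 <= q ->
  b = scal p c + scal q d -> b = simple s -> c = simple s.
Proof. by move=> pc d0 p0 q0 -> e; apply: (simple_comb (esym e)). Qed.

Lemma act_comb w (x y : V) p q :
  ac w (scal p x + scal q y) = scal p (ac w x) + scal q (ac w y).
Proof. by rewrite actD !actZ. Qed.

Lemma align_pi l w : uniq l -> align l (pi l w).
Proof.
move: l w; apply: pi_ind => [w|s l w sl ul d IH|s l w sl ul d IH].
- by rewrite pi_nil => b c d p q /inv1.
- rewrite pi_take // => b c e p q ib sb pc pe p0 q0 eb om.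
  have us : uniq (rcons l s) by rewrite rcons_uniq sl.
  have [_ e0] := pe; have [_ c0] := pc.
  have ds : desc s (gen s * pi (rcons l s) (gen s * w))%g.
    by rewrite desc_flip pi_ndesc_take.
  have pb := inv_proot ib.
  have [->|nc] := pselect (c = simple s); first exact/descP.
  have nb : b <> simple s.
    by move=> bs; apply: nc; apply: (simple_decomp pc e0 p0 (ltW q0) eb bs).
  have [sc se] := span_comb c0 e0 p0 q0 eb sb.
  have [ee|ne] := pselect (e = simple s).
    by subst e; case: (head_not_right pb nb pc nc p0 q0 eb sc om).
  apply/inv_genl => //; apply: (IH (ac (gen s) b) _ (ac (gen s) e) p q) => //.
  + by apply/inv_genl.
  + by apply/span_rcons/span_gen.
  + exact: proot_gen.
  + exact: proot_gen.
  + by rewrite eb act_comb.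
  + by rewrite omega_rot.
- rewrite pi_skip // => b c e p q ib sb pc pe p0 q0 eb om.
  have [_ e0] := pe; have [_ c0] := pc.
  have sb' := pi_supported ul ib.
  have [sc se] := span_comb c0 e0 p0 q0 eb sb'.
  by apply: (IH b c e p q) => //; rewrite -(omega_cons sl).
Qed.

(** Along the letters [r] that [pi] takes, the image of [simple s] grows by nonnegative multiples of
    inversions that come after it. If the larger root were an inversion of [w], alignment would make
    the previous one an inversion, back to [simple s] itself. *)
Lemma align_chain s l0 w : s \notin l0 -> align (s :: l0) w -> ~~ desc s w ->
  forall l w', uniq l -> forall x : W, s \notin l ->
  (forall v, span l v -> span l0 (ac x v)) ->
  (forall v v', span l v -> span l v' ->
     omega (s :: l0) (ac x v) (ac x v') = omega l v v') ->
  (forall v, inv (pi l w') v -> inv w (ac x v) /\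
     0 <= omega (s :: l0) (ac x (simple s)) (ac x v)) ->
  proot (ac x (simple s)) -> span (s :: l0) (ac x (simple s)) ->
  ~ inv w (ac x (simple s)) -> ~ inv w (ac (x * pi l w')%g (simple s)).
Proof.
move=> sl0 al nd; apply: pi_ind => [w'|r l w' rl ul d IH|r l w' rl ul d IH] x srl H1 H2 H3 H4 H5.
- by rewrite pi_nil mulg1.
- move=> ni; rewrite pi_take // mulgA.
  have ur : uniq (rcons l r) by rewrite rcons_uniq rl.
  have /H3[ig og] : inv (pi (r :: l) w') (simple r).
    by apply/descP; apply: pi_desc; rewrite //= rl.
  have pg := inv_proot ig.
  have rs : r != s by apply: contraNneq srl => ->; rewrite mem_head.
  pose k := - gram rho r s.
  have k0 : 0 <= k by rewrite /k oppr_ge0 gram_le0.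
  have ex : ac (x * gen r)%g (simple s) = ac x (simple s) + scal k (ac x (simple r)).
    rewrite actM act_gen bil_simple actD actN actZ /k.
    by apply/ffunP=> i; rewrite !vE; ring.
  have [_ x0] := H4; have [_ g0] := pg.
  have sg : span l0 (ac x (simple r)) by apply: H1; apply: span_head.
  have H4' : proot (ac (x * gen r)%g (simple s)).
    split; first by apply: root_act; apply: root_simple.
    by rewrite ex; apply: nonnegD => //; apply: nonnegZ.
  have H5' : span (s :: l0) (ac (x * gen r)%g (simple s)).
    by rewrite ex; apply: spannedD => //; apply: spannedZ; apply: span_tail.
  apply: IH => //.
  + by move: srl; rewrite mem_rcons.
  + by move=> v /span_rcons sv; rewrite actM; apply/H1/span_gen.
  + move=> v v' /span_rcons sv /span_rcons sv'; rewrite !actM H2; try exact: span_gen.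
    by rewrite -(omega_rot rl) ?act_genK //; apply: span_gen.
  + move=> v iv; have pv := inv_proot iv.
    have sv := pi_supported ur iv; move/span_rcons: sv => sv.
    have nr : v <> simple r.
      move=> e; move: iv; rewrite e => /descP; apply/negP.
      exact: pi_ndesc_take.
    have iv' : inv (pi (r :: l) w') (ac (gen r) v).
      by rewrite pi_take //; apply/inv_gen.
    have [i1 o1] := H3 _ iv'.
    split; first by rewrite actM.
    rewrite ex actM omegaDl omegaZl addr_ge0 // mulr_ge0 // H2; last exact: span_gen.
      apply: omega_head_ge0; last exact: span_gen.
      exact: proot_gen.
    exact: span_head.
  + have [k_eq|kne] := eqVneq k 0; first by rewrite ex k_eq scal0 addr0.
    move=> ix; apply: ni.
    apply: (al _ _ (ac x (simple r)) 1 k ix) => //.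
    * by rewrite lt_def kne.
    * by rewrite scal1 ex.
- move=> ni; rewrite pi_skip //; apply: IH => //.
  + by apply: contra srl => h; rewrite inE h orbT.
  + by move=> v sv; apply/H1/span_tail.
  + move=> v v' sv sv'; rewrite H2; try exact: span_tail.
    exact: omega_cons.
  + by move=> v; rewrite -(pi_skip l d); apply: H3.
Qed.

(** Alignment passes to the remaining element and word in both cases. The substance is that dropping
    [s] loses no inversion: an aligned [w] without the descent [s] has no inversion in the span with
    a positive [s]-coefficient. *)
Lemma inv_pi_align l w b : uniq l -> align l w -> inv w b -> span l b -> inv (pi l w) b.
Proof.
move=> ul; move: l w ul b; apply: pi_ind => [w b _ [pb _] sb||].
- case: (proot_notneg pb) => i; rewrite vE sb // oppr0 //.
- move=> s l w sl ul d IH b al ib sb; rewrite pi_take //.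
  have us : uniq (rcons l s) by rewrite rcons_uniq sl.
  have [->|ne] := pselect (b = simple s).
    by apply/descP; rewrite desc_flip pi_ndesc_take.
  have pb := inv_proot ib.
  apply/inv_genl => //; apply: IH; last exact/span_rcons/span_gen.
    move=> {b ib sb pb ne} b c e p q ib sb pc pe p0 q0 eb om.
    have [_ e0] := pe; have [_ c0] := pc; move/span_rcons: sb => sb.
    have [sc se] := span_comb c0 e0 p0 q0 eb sb; have pb := inv_proot ib.
    have nb : b <> simple s by move=> bs; move: ib; rewrite bs => /descP; rewrite desc_flip d.
    have ib' : inv w (ac (gen s) b) by apply/inv_genl.
    have [ce|nc] := pselect (c = simple s).
      subst c; have [ee|ne] := pselect (e = simple s).
        subst e; case: nb; apply: (proot_spanned1 pb) => i /= ne.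
        by rewrite eb !vE (negPf ne) !mulr0 addr0.
      have : omega (rcons l s) (simple s) e = - (e s + ac (gen s) e s).
        by rewrite omegaC omega_last.
      move: om => /[swap] ->; rewrite oppr_ge0 -(omega_head se).
      move=> /(omega_head_eq0 pe ne se)[es Ae].
      have [_ /(_ s)] := proot_gen pb nb.
      by rewrite act_gens eb !bilE !vE eqxx mulr1 es Ae form_simple; lra.
    apply/inv_genl => //.
    (* Here the root to be shown an inversion of [w] is a positive combination of the inversions
       [ac (gen s) b] and [simple s]; alignment would be of no help, since the order of the pair is
       reversed by the rotation. *)
    have [ee|ne] := pselect (e = simple s).
      subst e.
      have ec : ac (gen s) c = scal p^-1 (ac (gen s) b) + scal (q / p) (simple s).
        rewrite eb act_comb act_simple; apply/ffunP=> i; rewrite !vE; field.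
        by rewrite gt_eqF.
      have [_ n1] := ib'; have /(descP (rho := rho))[_ n2] := d.
      apply: (inv_comb _ ec) => //; first exact: proot_gen.
        by rewrite invr_ge0 ltW.
      by rewrite divr_ge0 // ltW.
    apply: (al (ac (gen s) b) _ (ac (gen s) e) p q) => //.
    + exact: span_gen.
    + exact: proot_gen.
    + exact: proot_gen.
    + by rewrite eb act_comb.
    + by rewrite -omega_rot ?act_genK //; apply: span_gen.
  by apply/inv_genl; rewrite ?act_genK //; [apply: proot_gen|exact: neq_gen_simple].
- move=> s l w sl ul d IH b al ib sb; rewrite pi_skip //.
  have al' : align l w.
    move=> {b ib sb} b c e p q ib sb pc pe p0 q0 eb om.
    have [_ e0] := pe; have [_ c0] := pc.
    have [sc se] := span_comb c0 e0 p0 q0 eb sb.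
    apply: (al b c e p q) => //; first exact: span_tail.
    by rewrite omega_cons.
  have inz c : inv w c -> span l c -> inv (pi l w) c by exact: IH.
  apply: (inz) => //; apply: (span_cons_head0 sb); apply/eqP; rewrite eq_le.
  have [[_ b0] nb] := ib; rewrite b0 andbT leNgt; apply/negP => bs.
  set z := pi l w in inz; have sz : supported (fun i => i \in l) z by exact: pi_supported.
  have zs : ac z (simple s) s = 1 by rewrite (supported_act _ sz sl) simple_id.
  have ni : ~ inv w (ac z (simple s)).
    rewrite -[z]mul1g; apply: (align_chain sl al d) => //.
    - by move=> v sv; rewrite act1.
    - by move=> v v' sv sv'; rewrite !act1 omega_cons.
    - move=> v iv; rewrite !act1; split; first exact: pi_le iv.
      apply: omega_head_ge0; first exact: inv_proot iv.
      by apply/span_tail/(pi_supported ul iv).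
    - by rewrite act1; apply: proot_simple.
    - by rewrite act1; apply: span_head.
    - by rewrite act1 => /descP; apply/negP.
  (* So [z] already carries all inversions of [w] in the span of [s :: l]. Were the [s]-coefficient
     of [b] positive, the inverse of [z] would keep [b] positive, and then so would the inverse of
     [w]. *)
  have neg i : i \in s :: l -> nonneg (ac (w^-1 * z)%g (simple i)).
    rewrite inE => /orP[/eqP->|il].
      rewrite actM; have rz : root (ac z (simple s)) by apply: root_act; exact: root_simple.
      have pz : proot (ac z (simple s)).
        by apply: root_signP => // /(_ s); rewrite vE zs //; lra.
      by case: (invN pz ni).
    have sil : span l (ac z (simple i)).
      by apply: supported_span => //; apply: spanned_simple.
    have rz : root (ac z (simple i)) by apply: root_act; exact: root_simple.
    have rw : root (ac (w^-1 * z)%g (simple i)) by apply: root_act; exact: root_simple.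
    case: (root_sign rw) => // hneg; rewrite actM in hneg rw *.
    case: (root_sign rz) => pz.
      have /inz : inv w (ac z (simple i)) by [].
      by move=> /(_ sil)[_]; rewrite actK => /proot_notneg; case; apply: proot_simple.
    have : inv z (- ac z (simple i)).
      split; first by split=> //; apply: rootN.
      by rewrite actN actK opprK; apply: nonneg_simple.
    by move/(pi_le ul) => -[_]; rewrite actN opprK.
  apply: (inv_notpos ib) => j.
  have -> : ac w^-1 b = ac (w^-1 * z)%g (ac z^-1 b) by rewrite actM actVK.
  have rzb : root (ac z^-1 b) by apply: root_act; case: ib => [[]].
  have pzb : nonneg (ac z^-1 b).
    case: (root_sign rzb) => // /(_ s); rewrite vE (supported_actV _ sz sl); lra.
  rewrite act_expandE; apply: sumr_ge0 => i _.
  have [il|il] := boolP (i \in s :: l); first by rewrite mulr_ge0 // neg.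
  rewrite (_ : ac z^-1 b i = 0) ?mul0r //.
  by rewrite (supported_actV _ sz) ?sb //; apply: contra il => h; rewrite inE h orbT.
Qed.

(** A fixed point for [l] is aligned, and alignment survives restriction to fewer letters as long as
    [omega] is the same on their span. This is how values for different words get compared. *)
Lemma pi_restrict l k v b : uniq l -> uniq k -> {subset k <= l} ->
  (forall x y, span k x -> span k y -> omega k x y = omega l x y) ->
  pi l v = v -> inv v b -> span k b -> inv (pi k v) b.
Proof.
move=> ul uk kl eo ev; apply: inv_pi_align => // {}b c e p q ib sb pc pe p0 q0 eb om.
have [_ e0] := pe; have [_ c0] := pc.
have [sc se] := span_comb c0 e0 p0 q0 eb sb.
rewrite -ev; apply: (align_pi (w := v) ul (b := b) (c := c) (d := e) (p := p) (q := q)) => //.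
- by rewrite ev.
- by apply: spannedS sb => i /kl.
- by rewrite -eo.
Qed.

End Aligned.

(** * Contraction of polygons *)

Section Congruence.
Context {W : groupType} {S : finType} {gen : S -> W}.
Context {R : realFieldType} {rho : georep gen R}.
Local Notation V := {ffun S -> R}.
Local Notation len := (cox_length gen).
Local Notation ac := (act rho).
Local Notation A := (bil (gram rho)).
Local Notation root := (@root W S gen R rho).
Local Notation proot := (@proot W S gen R rho).
Local Notation inv := (@inv W S gen R rho).
Local Notation wle := (@wle W S gen R rho).
Local Notation desc := (@desc W S gen).
Local Notation supported := (@supported W S gen R rho).
Implicit Types (s t : S) (l : seq S) (w : W) (x y b : V).
Local Notation span l := (spanned (fun i => i \in l)).
Local Notation euler := (@euler W S gen R rho).
Local Notation pi := (@pi W S gen).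
Local Notation skips := (@skips W S gen R).
Local Notation dihedral_top := (@dihedral_top W S gen R rho).

(** The version of [cone_simple] for a two-dimensional face of the nonnegative cone. *)
Lemma cone_plane (P : V -> Prop) w x t t' : cone P x ->
  (forall y, P y -> proot (ac w y)) -> spanned (pred2 t t') (ac w x) ->
  0 < ac w x t' ->
  exists y, [/\ P y, spanned (pred2 t t') (ac w y) & 0 < ac w y t'].
Proof.
move=> cx hP; have nn z : cone P z -> nonneg (ac w z).
  elim=> [i|c y z' c0 Py _ IH i]; first by rewrite act0 vE.
  by rewrite actD actZ; apply: nonnegD => //; apply: nonnegZ => //; case: (hP y Py).
elim: cx => [|c y z c0 Py cz IH]; first by rewrite act0 vE ltxx.
rewrite actD actZ => sp; rewrite !vE => pos.
have [_ y0] := hP y Py; have z0 := nn z cz.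
have h i : ~~ pred2 t t' i -> c * ac w y i = 0 /\ ac w z i = 0.
  move=> ni; have := sp i ni; rewrite !vE.
  by have := mulr_ge0 c0 (y0 i); have := z0 i; split; lra.
have [e|ne] := eqVneq (c * ac w y t') 0.
  by apply: IH => [i /h[]//|]; move: pos; rewrite e add0r.
have [c_eq|cn] := eqVneq c 0; first by rewrite c_eq mul0r eqxx in ne.
exists y; split => // [i /h[/eqP]|]; last first.
  by rewrite lt_def y0 andbT; apply: contraNneq ne => ->; rewrite mulr0.
by rewrite mulf_eq0 (negPf cn) /= => /eqP.
Qed.

Lemma euler_self l b : span l b -> root b -> euler l b b = 1.
Proof. by move=> sb rb; have := euler_sym (rho := rho) sb sb; rewrite form_root //; lra. Qed.

(* Since [s u = u t'], the edges [u -> u t] and [u -> s u] are the two lower edges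
   of a polygon of the weak order. *)
Lemma contract_rotate s l u t t' : s \notin l -> uniq l -> t != t' ->
  proot (ac u (simple t)) -> ac u (simple t') = simple s ->
  ~~ desc s (u * gen t)%g ->
  pi l (u * gen t)%g = pi l u -> pi (rcons l s) (u * gen t)%g = pi (rcons l s) u.
Proof.
move=> sl ul ne pt et' nd e.
have us : uniq (rcons l s) by rewrite rcons_uniq sl.
set z' := pi _ (_ * _)%g.
have le0 : wle u (u * gen t)%g by apply: wle_mulr.
suff le : wle z' u.
  apply: (wle_anti (rho := rho)); last exact: pi_mono.
  by rewrite -[z']pi_idem //; apply: pi_mono => //; rewrite pi_idem.
apply: (wle_mulr_cases pt); first exact: pi_le.
set b1 := ac u (simple t) => ib; have sb := pi_supported us ib.
have [bs|bs] := eqVneq (b1 s) 0.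
  (* Without an [s]-coefficient, [b1] survives the restriction to [l], contrary to the contraction
     assumed there. *)
  have sb' : span l b1 by apply: (span_cons_head0 (s := s)) => //; apply/span_rcons.
  have : inv (pi l z') b1.
    apply: (@pi_restrict _ _ _ _ _ (rcons l s)) => //.
    - by move=> i il; rewrite mem_rcons inE il orbT.
    - by move=> x y sx sy; rewrite !omegaE !euler_rcons.
    - exact: pi_idem.
  have le1 : wle (pi l z') (pi l (u * gen t)%g) by apply: pi_mono => //; apply: pi_le.
  move=> /le1; rewrite e => /(pi_le ul); exact: ninv_mulr.
have {}bs : 0 < b1 s by rewrite lt_def bs /=; case: pt => _; apply.
have hpr y : skips (rcons l s) (u * gen t)%g y -> proot (ac (u * gen t)^-1 y).
  exact: skips_proot.
(* Otherwise two dropped roots are produced in the plane of the polygon: [- b1], by extremality, and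
   then [C], from the face containing the image of [simple s]. *)
have kb : skips (rcons l s) (u * gen t)%g (- b1).
  have [|m hm em] := cone_simple (w := (u * gen t)^-1%g) (s := t) (cone_skips_inv us ib) _ hpr.
    by rewrite invgM gen_inv actM actN actK actN act_simple opprK.
  suff -> : - b1 = m by [].
  by rewrite -[m](actVK (u * gen t)%g) em actM act_simple actN.
pose a := gram rho t t'.
have a0 : a <= 0 by apply: gram_le0.
have eas : ac (u * gen t)^-1 (simple s) = simple t' - scal a (simple t).
  by rewrite invgM gen_inv actM -et' actK act_gen bil_simple.
have [||C [hC sC pC]] := cone_plane (t := t) (t' := t') (cone_skips_last sl ul nd) hpr.
- rewrite eas; apply: spannedD; first by apply: spanned_simple; rewrite /= eqxx orbT.
  by apply: spannedN; apply: spannedZ; apply: spanned_simple; rewrite /= eqxx.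
- by rewrite eas !vE eqxx eq_sym (negPf ne) /=; lra.
set p := ac _ C t' in pC; set q := ac (u * gen t)^-1 C t.
have eC : C = scal p (simple s) + scal (- q - p * a) b1.
  rewrite -[LHS](actVK (u * gen t)%g) (spanned2 ne sC) -/p -/q actM act_gen !bilE.
  rewrite !bil_simple gram_diag -/a -et' !actD actN !actZ.
  by rewrite /b1; apply/ffunP=> i; rewrite !vE; ring.
set q' := - q - p * a in eC.
have rC : root C.
  have [rr _] := hpr C hC.
  by rewrite -[C](actVK (u * gen t)%g); apply: root_act.
have euC : ac u^-1 C = scal p (simple t') + scal q' (simple t).
  by rewrite eC actD !actZ actK -et' actK.
have q'0 : 0 <= q'.
  have rr : root (ac u^-1 C) by apply: root_act.
  case: (root_sign rr) => [/(_ t)|/(_ t')]; rewrite euC !vE eqxx.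
    by rewrite (negPf ne) /=; lra.
  by rewrite eq_sym (negPf ne) /=; lra.
have sC' := skips_span us hC.
have ss : span (rcons l s) (simple s : V) by apply/span_rcons/span_head.
have eb : euler (rcons l s) b1 C = p * b1 s + q'.
  rewrite eC !eulerE euler_lastr // euler_self //; first by ring.
  by case: pt.
have ne' : C <> - b1.
  move=> ee; move: pC; rewrite /p ee invgM gen_inv actM actN actK actN act_simple opprK.
  by rewrite vE eq_sym (negPf ne) ltxx.
have pb0 := mulr_gt0 pC bs.
(* One of the two Euler pairings of the dropped roots vanishes; since the one computed in [eb] is
   positive, it is this one. That fixes the coefficients of [C] so that its image under [gen t] has
   coefficients of opposite signs, impossible for a root. *)
have e1 : euler (rcons l s) C b1 = 0.
  have [] := skips_euler us hC kb ne'; first by rewrite eulerNr => h; lra.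
  by rewrite eulerNl eb => h; lra.
have eA := euler_sym (rho := rho) sC' sb.
have eA' : A C b1 = p * a + 2 * q'.
  by rewrite /b1 form_sym form_actl euC !bilE !bil_simple gram_diag -/a; ring.
have rr : root (ac (gen t) (ac u^-1 C)) by do 2!apply: root_act.
have et : ac (gen t) (ac u^-1 C) = scal p (simple t') + scal (- (p * b1 s)) (simple t).
  rewrite act_gen euC !bilE !bil_simple gram_diag -/a.
  have -> : p * b1 s = p * a + q' by move: eA; rewrite e1 eb eA'; lra.
  by apply/ffunP=> i; rewrite !vE; ring.
case: (root_sign rr) => [/(_ t)|/(_ t')]; rewrite et !vE eqxx.
  by rewrite (negPf ne) /=; lra.
by rewrite eq_sym (negPf ne) /=; lra.
Qed.

Lemma ndesc_polygon s u t t' g : t != t' -> proot (ac u (simple t)) ->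
  proot (ac u (simple t')) -> dihedral_top t t' g ->
  ~~ desc s (u * gen t)%g -> ~~ desc s (u * gen t')%g -> ~~ desc s (u * g)%g.
Proof.
move=> ne pt pt' hg n1 n2; apply/negP => /(descP (rho := rho)).
have sg : supported (pred2 t t') g by move=> c /hg[].
move/(inv_polygon ne pt pt' _ sg) => [ps [iu|/hg[pz sz]]].
  by move/negP: n1; apply; apply/(descP (rho := rho)); apply: wle_mulr iu.
have [_ z0] := pz; move: (z0 t) (z0 t'); set p := ac _ _ t; set q := ac _ _ t' => p0 q0.
have es : simple s = scal p (ac u (simple t)) + scal q (ac u (simple t')).
  by rewrite -act_comb -spanned2 // actVK.
have [pe|pn] := eqVneq p 0.
  have [qe|qn] := eqVneq q 0.
    case: (root_neq0 (rho := rho) (root_simple s)).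
    by rewrite es pe qe !scal0 addr0.
  have e : ac u (simple t') = simple s.
    apply: (simple_comb (p := q) (q := p) (y := ac u (simple t))) => //.
    - by rewrite es addrC.
    - by rewrite lt_def qn.
    - by case: pt.
  by move/negP: n2; apply; apply/(descP (rho := rho)); rewrite -e; apply: inv_mulr_self.
have e : ac u (simple t) = simple s.
  apply: (simple_comb (p := p) (q := q) (y := ac u (simple t'))) => //.
  - by rewrite lt_def pn.
  - by case: pt'.
by move/negP: n1; apply; apply/(descP (rho := rho)); rewrite -e; apply: inv_mulr_self.
Qed.

(** Unless [u] sends [t'] to the first letter, that letter treats the four elements [u], [u t],
    [u t'], [u g] alike: it is a descent of all or of none, and the recursion advances on all four
    at once. *)
Lemma contract_step s l u t t' g : s \notin l -> uniq l -> t != t' ->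
  proot (ac u (simple t)) -> proot (ac u (simple t')) -> dihedral_top t t' g ->
  ac u (simple t') <> simple s ->
  (desc s u -> proot (ac (gen s * u)%g (simple t)) ->
     proot (ac (gen s * u)%g (simple t')) ->
     pi (rcons l s) (gen s * u * gen t)%g = pi (rcons l s) (gen s * u)%g ->
     pi (rcons l s) (gen s * u * gen t')%g = pi (rcons l s) (gen s * u * g)%g) ->
  (pi l (u * gen t)%g = pi l u -> pi l (u * gen t')%g = pi l (u * g)%g) ->
  pi (s :: l) (u * gen t)%g = pi (s :: l) u ->
  pi (s :: l) (u * gen t')%g = pi (s :: l) (u * g)%g.
Proof.
move=> sl ul ne pt pt' hg ex IH1 IH2.
have us : uniq (s :: l) by rewrite /= sl.
have [le le'] := polygon_le ne pt pt' hg (supported1 (rho := rho) (P := pred2 t t')).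
rewrite mulg1 in le'.
have [d|d] := boolP (desc s u).
  have dt := wle_desc (wle_mulr pt) d; have dt' := wle_desc (wle_mulr pt') d.
  have dg := wle_desc le' d.
  rewrite !pi_take // !mulgA => /mulgI h; congr (_ * _)%g; apply: IH1 => //.
    rewrite actM; apply: proot_gen => // e.
    by move/(descP (rho := rho)): d; rewrite -e; apply: ninv_mulr.
  by rewrite actM; apply: proot_gen.
rewrite [pi (s :: l) u]pi_skip // => h.
have dt : ~~ desc s (u * gen t)%g.
  apply/negP => /(pi_desc us); rewrite h; apply/negP; exact: pi_ndesc.
have dt' : ~~ desc s (u * gen t')%g.
  apply/negP => /(descP (rho := rho))/(inv_mulr _ pt')[/descP|/esym//].
  by rewrite (negPf d).
have dg := ndesc_polygon ne pt pt' hg dt dt'.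
by rewrite !pi_skip // in h *; apply: IH2.
Qed.

Theorem polygon_contract l u t t' g : uniq l -> t != t' ->
  proot (ac u (simple t)) -> proot (ac u (simple t')) -> dihedral_top t t' g ->
  pi l (u * gen t)%g = pi l u -> pi l (u * gen t')%g = pi l (u * g)%g.
Proof.
have [n] := ubnP (len u + size l)%N; elim: n l u => // n IH [|s l] u; rewrite ltnS.
  by rewrite !pi_nil.
move=> le us ne pt pt' hg.
have [sl ul] : s \notin l /\ uniq l by move/andP: us.
have ul' : uniq (rcons l s) by rewrite rcons_uniq sl.
have IH1 r k : r \notin k -> uniq k -> (size k <= size l)%N -> desc r u ->
     proot (ac (gen r * u)%g (simple t)) ->
     proot (ac (gen r * u)%g (simple t')) ->
     pi (rcons k r) (gen r * u * gen t)%g = pi (rcons k r) (gen r * u)%g ->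
     pi (rcons k r) (gen r * u * gen t')%g = pi (rcons k r) (gen r * u * g)%g.
  move=> rk uk sk d p1 p2; apply: IH => //; last by rewrite rcons_uniq rk.
  by apply: leq_trans le; rewrite size_rcons (desc_len d) /= addSn ltnS leq_add2l ltnS.
have [e|ex] := pselect (ac u (simple t') = simple s); last first.
  apply: contract_step => //; first exact: IH1.
  by apply: IH => //; move: le => /=; lia.
have d : ~~ desc s u.
  by apply/negP => /(descP (rho := rho)); rewrite -e; apply: ninv_mulr.
rewrite [pi (s :: l) u]pi_skip // => h.
have dt : ~~ desc s (u * gen t)%g.
  apply/negP => /(pi_desc us); rewrite h; apply/negP; exact: pi_ndesc.
rewrite pi_skip // in h.
have h' := contract_rotate sl ul ne pt e dt h.
have dt' : desc s (u * gen t')%g.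
  by apply/(descP (rho := rho)); rewrite -e; apply: inv_mulr_self.
have sg : supported (pred2 t t') g by move=> c /hg[].
have [leg' leg] := polygon_le ne pt pt' hg (dihedral_top_gen hg).
have [_ dtg] := dihedral_desc hg.
have dg : desc s (u * g)%g.
  apply/(descP (rho := rho)); apply/(inv_polygon ne pt pt' _ sg).
  split; first exact: proot_simple.
  by right; rewrite -e actK; apply/descP.
have {}h' : pi (rcons l s) (u * gen t')%g = pi (rcons l s) (u * g)%g.
  (* The rotated word is no shorter, so the induction hypothesis does not apply to it. But its first
     letter [r] differs from [s], the image of [t'], so [contract_step] makes one more move, after
     which the measure has dropped. *)
  case: l {h IH1 leg leg'} sl ul ul' us h' le => [|r l] sl ul ul' us h' le.
    have one w : desc s w -> pi [:: s] w = gen s.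
      move=> dw; rewrite pi_take //= pi_skip ?pi_nil ?mulg1 //.
      by rewrite desc_flip dw.
    by rewrite /= !one.
  have [rl ull] : r \notin l /\ uniq l by move/andP: ul.
  have nrs : r != s by apply: contraNneq sl => ->; rewrite mem_head.
  have rls : r \notin rcons l s by rewrite mem_rcons inE negb_or nrs.
  have uls : uniq (rcons l s).
    by rewrite rcons_uniq ull andbT; apply: contra sl => i; rewrite inE i orbT.
  apply: (contract_step rls uls ne pt pt' hg) => [|||].
  - rewrite e => /(congr1 (fun f : V => f r)); rewrite !vE eqxx (negPf nrs).
    by move/eqP; rewrite eq_sym oner_eq0.
  - move=> dr p1 p2; apply: IH => //; last by rewrite rcons_uniq rls.
    by apply: leq_trans le; rewrite !size_rcons (desc_len dr) /= addSn ltnS leq_add2l.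
  - by apply: IH => //; move: le; rewrite size_rcons /=; lia.
  - exact: h'.
have es := conj_simple e.
have esj : (gen s * (u * g) = u * (gen t' * g))%g by rewrite mulgA es mulgA.
rewrite !pi_take //; congr (_ * _)%g; rewrite -es genK esj.
apply: (wle_anti (rho := rho)); first exact: pi_mono.
(* [q] is below [u t'] because the opposite side is contracted for [rcons l s]; it lacks the
   inversion [simple s], so it is below [u] itself, and idempotence finishes. *)
set q := pi _ (u * (_ * _))%g.
have qu : wle q u.
  apply: (wle_mulr_cases pt').
    apply: (wle_trans (v := pi (rcons l s) (u * gen t')%g)); last exact: pi_le.
    by rewrite h'; apply: pi_mono.
  rewrite e => /(descP (rho := rho)); apply/negP; rewrite /q -esj.
  exact: pi_ndesc_take.
by rewrite -[q]pi_idem //; apply: pi_mono => //; rewrite pi_idem.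
Qed.

Definition lub (a b k : W) := [/\ wle a k, wle b k & forall x : W, wle a x -> wle b x -> wle k x].

Lemma lubC (a b k : W) : lub a b k -> lub b a k.
Proof. by case=> h1 h2 h3; split=> // x h h'; apply: h3. Qed.

Lemma lub_uniq (a b k k' : W) : lub a b k -> lub a b k' -> k = k'.
Proof.
move=> [h1 h2 h3] [h1' h2' h3'].
by apply: (wle_anti (rho := rho)); [apply: h3|apply: h3'].
Qed.

(** Moving from [a'] to [a] one cover at a time reduces the claim to a contracted edge; that edge is
    then pushed upwards across polygons until it reaches the join with [b]. The bound [j] makes the
    climb terminate. *)
Lemma lub_pi l (a' a b j k k' : W) : uniq l -> wle a' a -> wle a j -> wle b j ->
  pi l a' = pi l a -> lub a' b k' -> lub a b k -> pi l k' = pi l k.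
Proof.
move=> ul; have [n] := ubnP (len j - len a')%N.
elim: n a' a b k k' => // n IH a' a b k k'; rewrite ltnS => le a'a aj bj e hk' hk.
have [e1|ne] := pselect (a' = a).
  by move: hk'; rewrite e1 => hk'; rewrite (lub_uniq hk' hk).
have [t [pt y1a]] := upper_cover a'a ne; set y1 := (a' * gen t)%g in y1a.
have a'y1 : wle a' y1 by apply: wle_mulr.
have ey1 : pi l y1 = pi l a'.
  by apply: (wle_anti (rho := rho)); [rewrite e|]; apply: pi_mono.
have y1j := wle_trans y1a aj.
have len_y1 := wle_leq y1j; have ly1 := len_mulr pt.
have [k1 hk1] := join2_ex y1j bj.
have step2 : pi l k1 = pi l k.
  by apply: (IH y1 a b) => //; [rewrite /y1 ly1; rewrite /y1 ly1 in len_y1; lia|rewrite ey1].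
rewrite -step2.
have [ak' bk' k'min] := hk'; have [yk1 bk1 k1min] := hk1.
have k'j : wle k' j by apply: k'min => //; apply: wle_trans a'a aj.
have [e2|ne2] := pselect (a' = k').
  rewrite -e2; have -> : k1 = y1.
    apply: (wle_anti (rho := rho)) => //; apply: k1min => //.
    by apply: wle_trans a'y1; rewrite e2.
  by rewrite ey1.
have [t' [pt' xk']] := upper_cover ak' ne2; set x := (a' * gen t')%g in xk'.
have [et|net] := eqVneq t t'.
  have -> // : k1 = k'.
  rewrite /y1 et -/x in hk1 yk1 k1min a'y1.
  apply: (wle_anti (rho := rho)); first exact: k1min.
  by apply: k'min => //; apply: wle_trans yk1.
have xj := wle_trans xk' k'j.
have [g hg] := polygon_ex net pt pt' y1j xj.
have pj : wle (a' * g)%g j by apply: (dihedral_top_join net pt pt' hg).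
have sg : supported (pred2 t t') g by move=> c /hg[].
have ix : wle x (a' * g)%g.
  by apply: wle_mulr_sub => //; [case: (polygon_le net pt pt' hg (supported1 (rho := rho) (P := pred2 t t'))); rewrite mulg1|
    apply/(inv_polygon net pt pt' _ sg); split=> //; right; rewrite actK; apply/descP; case: (dihedral_desc hg)].
have iy : wle y1 (a' * g)%g.
  by apply: wle_mulr_sub => //; [case: (polygon_le net pt pt' hg (supported1 (rho := rho) (P := pred2 t t'))); rewrite mulg1|
    apply/(inv_polygon net pt pt' _ sg); split=> //; right; rewrite actK; apply/descP; case: (dihedral_desc hg)].
have ex : pi l x = pi l (a' * g)%g by apply: (polygon_contract ul net pt pt' hg).
have a'x : wle a' x by apply: wle_mulr.
(* The side from [x] to [a' g] is contracted, starts higher than [a'], and has the same two joins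
   with [b]. *)
apply: (IH x (a' * g)%g b) => //.
- have := wle_leq xj; have := len_mulr pt'; rewrite -/x; lia.
- split=> // c xy bY; apply: k'min => //; exact: wle_trans xy.
- split=> // [|c py bY]; last by apply: k1min => //; apply: wle_trans py.
  apply: (dihedral_top_join net pt pt' hg) => //.
  apply: wle_trans xk' _; apply: k'min => //; exact: wle_trans yk1.
Qed.

Theorem pi_join l (X : W -> Prop) j : uniq l -> isjoin (rho := rho) X j ->
  isjoin (rho := rho) (fun y : W => exists2 a, X a & y = pi l a) (pi l j).
Proof.
move=> ul [up least]; split=> [_ [a Xa ->]|y hy]; first by apply: pi_mono => //; apply: up.
(* [j] is reached from 1 by joining with elements of [X] not yet below. The bound by [y] persists
   because the value at the join of [w] and [a] equals the value at the join of their images. *)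
pose T w := wle w j /\ wle (pi l w) y.
suff hT n w : (len j - len w <= n)%N -> T w -> T j.
  case: (hT _ 1%g (leqnn _)) => //; split; first exact: wle1.
  by apply: wle_trans (wle1 y); apply: pi_le.
elim: n w => [|n IH] w le [wj wy].
  have -> // : j = w.
  by apply: esym; apply: wle_eqlen => //; have := wle_leq wj; move: le; lia.
have [[a [Xa na]]|all_le] := pselect (exists a, X a /\ ~ wle a w); last first.
  have -> // : j = w; apply: (wle_anti (rho := rho)) => //; apply: least => a Xa.
  by apply: contrapT => na; apply: all_le; exists a.
have aj := up a Xa; have [k hk] := join2_ex wj aj.
have [wk ak kmin] := hk.
have kj : wle k j by exact: kmin.
have lt : (len w < len k)%N by apply: wle_ltn => // e; apply: na; rewrite e.
apply: (IH k); first by have := wle_leq kj; lia.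
split=> //.
have pwj : wle (pi l w) j by apply: wle_trans wj; apply: pi_le.
have paj : wle (pi l a) j by apply: wle_trans aj; apply: pi_le.
have [k1 hk1] := join2_ex pwj aj; have [k2 hk2] := join2_ex pwj paj.
have e1 : pi l k1 = pi l k.
  by apply: (lub_pi (a' := pi l w) (a := w) (b := a) ul _ wj aj) => //; [apply: pi_le|rewrite pi_idem].
have e2 : pi l k2 = pi l k1.
  apply: (lub_pi (a' := pi l a) (a := a) (b := pi l w) ul _ aj pwj) => //.
  - exact: pi_le.
  - by rewrite pi_idem.
  - exact: lubC.
  - exact: lubC.
rewrite -e1 -e2; have [_ _ k2min] := hk2.
apply: (wle_trans (pi_le (w := k2) ul)); apply: k2min => //.
by apply: hy; exists a.
Qed.

Theorem sortable_meet l (X : W -> Prop) a0 m : uniq l -> X a0 ->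
  (forall a, X a -> pi l a = a) -> ismeet (rho := rho) X m -> pi l m = m.
Proof.
have [n] := ubnP (len a0 + size l)%N; elim: n l X a0 m => // n IH [|s l] X a0 m; rewrite ltnS.
  move=> _ _ X0 hX [lo _]; rewrite pi_nil; apply: (wle_anti (rho := rho)); first exact: wle1.
  by have := lo a0 X0; rewrite -(hX a0 X0) pi_nil.
move=> le us X0 hX [lo gr].
have [sl ul] : s \notin l /\ uniq l by move/andP: us.
have ul' : uniq (rcons l s) by rewrite rcons_uniq sl.
have [[a1 [X1 d1]]|alld] := pselect (exists a, X a /\ ~~ desc s a); last first.
  have {}alld a : X a -> desc s a.
    by move=> Xa; apply: contrapT => /negP d; apply: alld; exists a.
  have dm : desc s m.
    apply: (wle_desc (u := gen s) (rho := rho)).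
      apply: gr => a /alld d; rewrite -[gen s]mulg1; apply: wle_gen_desc => //.
        by rewrite descE mulg1 len1.
      exact: wle1.
    by rewrite descE gen_sq len1 len_gen.
  rewrite pi_take //; apply: (mulgI (gen s)); rewrite genK.
  apply: (IH _ (fun y : W => X (gen s * y)%g) (gen s * a0)%g) => //.
  - by move: le; rewrite size_rcons (desc_len (alld _ X0)) addSn.
  - by rewrite genK.
  - move=> y Xy; have := hX _ Xy; rewrite pi_take ?genK; last exact: alld.
    by move/mulgI.
  - split=> [y Xy|x hx].
      rewrite -(genK s y); apply: wle_gen; last exact: lo.
      by rewrite dm alld.
    have nx : ~~ desc s x.
      apply/negP => /(wle_desc (hx (gen s * a0)%g _)); rewrite genK => /(_ X0).
      by rewrite desc_flip alld.
    rewrite -(genK s x); apply: wle_gen; first by rewrite dm desc_flip nx.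
    apply: gr => a Xa; apply: wle_gen_desc => //; last exact: alld.
    by apply: hx; rewrite genK.
(* A single element without the descent [s] confines the meet to the letters of [l]. By
   [pi_restrict], [m] is then also the meet of the images under [pi l], which are fixed for the
   shorter word. *)
have e1 : pi l a1 = a1 by rewrite -(pi_skip l d1) hX.
have sa1 : supported (fun i => i \in l) a1 by rewrite -e1; apply: pi_supported.
have sm : supported (fun i => i \in l) m := supported_le (lo a1 X1) sa1.
have dm : ~~ desc s m by apply: supported_ndesc sm.
rewrite pi_skip //; apply: (IH l (fun y : W => exists2 a, X a & y = pi l a) (pi l a0)) => //.
- by apply: leq_trans le; rewrite /= addnS ltnS leq_add2r; apply: wle_leq (pi_le (w := a0) ul).
- by exists a0.
- by move=> _ [a _ ->]; rewrite pi_idem.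
- split=> [_ [a Xa ->] b ib|x hx].
    apply: (pi_restrict us ul) => //.
    + by move=> i il; rewrite inE il orbT.
    + by move=> x y sx sy; rewrite omega_cons.
    + exact: hX.
    + exact: lo ib.
    + exact: sm ib.
  apply: gr => a Xa; apply: wle_trans (pi_le (w := a) ul); apply: hx.
  by exists a.
Qed.

End Congruence.

(** * Inversions as reflections, and the parabolic part *)

Section ParabolicPart.
Context {W : groupType} {S : finType} {gen : S -> W}.
Context {R : realFieldType} {rho : georep gen R}.
Local Notation V := {ffun S -> R}.
Local Notation len := (cox_length gen).
Local Notation wp := (wprod gen).
Local Notation ac := (act rho).
Local Notation root := (@root W S gen R rho).
Local Notation proot := (@proot W S gen R rho).
Local Notation inv := (@inv W S gen R rho).
Local Notation desc := (@desc W S gen).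
Local Notation supported := (@supported W S gen R rho).
Implicit Types (s t : S) (l : seq S) (w : W) (x y b : V).

Lemma supportedM (P : pred S) (u v : W) : supported P u -> supported P v ->
  supported P (u * v)%g.
Proof.
move=> /supportedP[a [Pa <-]] /supportedP[b [Pb <-]]; rewrite -wprod_cat.
by apply: supported_wprod; rewrite all_cat Pa Pb.
Qed.

Lemma supported_gen1 (P : pred S) r : P r -> supported P (gen r).
Proof.
move=> Pr; have -> : gen r = wp [:: r] by rewrite wprod_cons wprod_nil mulg1.
by apply: supported_wprod; rewrite /= Pr.
Qed.

Lemma supportedV (P : pred S) (u : W) : supported P u -> supported P (u^-1)%g.
Proof.
move=> /supportedP[a [Pa <-]]; rewrite -wprod_rev; apply: supported_wprod.
by rewrite all_rev.
Qed.

Lemma parabolicP (J : {set S}) w :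
  parabolic gen J w <-> supported (fun i => i \in J) w.
Proof.
split=> [[u uJ <-]|/supportedP[u [uJ uw]]]; last first.
  by exists u => // i iu; apply: (allP uJ).
by apply: supported_wprod; apply/allP.
Qed.

Lemma act_reflection (v : W) s : ac (v * gen s * v^-1)%g (ac v (simple s)) = - ac v (simple s).
Proof. by rewrite !actM actK act_simple actN. Qed.

Lemma inv_reflection_lt w (v : W) s : inv w (ac v (simple s)) ->
  (len (v * gen s * v^-1 * w)%g < len w)%N.
Proof.
have [n] := ubnP (len w); elim: n w v => // n IH w v; rewrite ltnS => lw iv.
have [e|/len_pred[r dr]] := pselect (w = 1%g); first by move: iv; rewrite e => /inv1.
have d : desc r w by [].
have pv := inv_proot iv.
have [e|ne] := pselect (ac v (simple s) = simple r).
  by rewrite -(conj_simple e) mulgK.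
have lt : (len (gen r * v * gen s * (gen r * v)^-1 * (gen r * w))%g < len (gen r * w)%g)%N.
  by apply: IH; [apply: leq_trans dr lw|rewrite actM; apply/inv_gen].
have e : (gen r * v * gen s * (gen r * v)^-1 * (gen r * w) =
          gen r * (v * gen s * v^-1 * w))%g.
  by rewrite invgM gen_inv -!mulgA genK.
rewrite e in lt; apply: (leq_ltn_trans (len_genl r _)).
by rewrite -[len w]prednK ?(leq_trans _ dr) // (desc_len d).
Qed.

Lemma inv_reflection w (v : W) s : proot (ac v (simple s)) ->
  (len (v * gen s * v^-1 * w)%g < len w)%N <-> inv w (ac v (simple s)).
Proof.
move=> pv; split=> [lt|]; last exact: inv_reflection_lt.
apply: contrapT => /(invN pv)[rw w0].
have : inv (v * gen s * v^-1 * w)%g (ac v (simple s)).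
  split=> //; rewrite invgM actM !invgM invgK gen_inv mulgA act_reflection.
  by rewrite actN opprK.
move=> /inv_reflection_lt; rewrite !mulgA.
rewrite (_ : v * gen s * v^-1 * v * gen s * v^-1 = 1)%g.
  by rewrite mul1g => /(ltn_trans lt); rewrite ltnn.
by rewrite mulgVK mulgenK mulgV.
Qed.

Lemma reflection_proot (t : W) : reflection gen t ->
  exists v s, t = (v * gen s * v^-1)%g /\ proot (ac v (simple s)).
Proof.
move=> [v [s ->]]; have rv : root (ac v (simple s)) by exists v, s.
case: (root_sign rv) => h; first by exists v, s.
exists (v * gen s)%g, s; split; first by rewrite invgM gen_inv mulgA !mulgenK.
by rewrite actM act_simple actN; split=> //; apply: rootN.
Qed.

Lemma supported_reflection (P : pred S) w (v : W) s : supported P w ->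
  inv w (ac v (simple s)) -> supported P (v * gen s * v^-1)%g.
Proof.
have [n] := ubnP (len w); elim: n w v => // n IH w v; rewrite ltnS => lw sw iv.
have [e|/len_pred[r dr]] := pselect (w = 1%g); first by move: iv; rewrite e => /inv1.
have d : desc r w by [].
have pv := inv_proot iv; have [Pr sw'] := supported_gen sw d.
have [e|ne] := pselect (ac v (simple s) = simple r).
  by rewrite -(conj_simple e) mulgK; apply: supported_gen1.
have h : supported P (gen r * v * gen s * (gen r * v)^-1)%g.
  apply: (IH (gen r * w)%g) => //; first exact: leq_trans dr lw.
  by rewrite actM; apply/inv_gen.
have -> : (v * gen s * v^-1 = gen r * (gen r * v * gen s * (gen r * v)^-1) * gen r)%g.
  by rewrite invgM gen_inv -!mulgA !genK gen_sq mulg1.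
by apply: supportedM; [apply: supportedM => //|]; apply: supported_gen1.
Qed.

Lemma parabolic_partE (J : {set S}) w :
  parabolic_part gen J w = par (rho := rho) (fun i => i \in J) w.
Proof.
set x := par _ w.
have sx : supported (fun i => i \in J) x by exact: par_supported.
pose X := [set y | parabolic gen J y /\
  inversions gen y = (inversions gen w `&` parabolic gen J)%classic]%classic.
have Xx : X x.
  split; first exact/parabolicP.
  apply/seteqP; split=> t.
    move=> [rt lt]; have [v [s [et pv]]] := reflection_proot rt.
    have iv : inv x (ac v (simple s)) by apply/inv_reflection; rewrite // -et.
    split; last by apply/parabolicP; rewrite et; apply: supported_reflection sx iv.
    split=> //; rewrite et; apply/inv_reflection => //; exact: par_le iv.
  move=> [[rt lt] /parabolicP st]; have [v [s [et pv]]] := reflection_proot rt.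
  split=> //; rewrite et; apply/inv_reflection => //; apply/parP; split.
    by apply/inv_reflection; rewrite // -et.
  move=> i iJ; have := supported_act (ac v (simple s)) st iJ.
  by rewrite et act_reflection vE; lra.
have : X (parabolic_part gen J w) by apply: xgetPex; exists x.
set y := parabolic_part _ _ _ => -[_ ey].
have [_ ex] := Xx.
have key b : inv y b <-> inv x b.
  split=> ib; have pb := inv_proot ib; have [[v [s eb]] _] := pb; subst b.
    have : inversions gen y (v * gen s * v^-1)%g.
      by split; [exists v, s|apply/inv_reflection].
    by rewrite ey -ex => -[_ /inv_reflection]; apply.
  have : inversions gen x (v * gen s * v^-1)%g.
    by split; [exists v, s|apply/inv_reflection].
  by rewrite ex -ey => -[_ /inv_reflection]; apply.
by apply: (wle_anti (rho := rho)) => b /key.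
Qed.

(** The inversions in the span of [P] decide the sign of the image of a negative root as well,
    through its opposite. *)
Lemma par_sign (P : pred S) w y : root y -> spanned P y ->
  nonneg (- ac w^-1 y) <-> nonneg (- ac (par (rho := rho) P w)^-1 y).
Proof.
move=> ry sy; set z := par P w; have [y0|y0] := root_sign ry.
  have py : proot y by [].
  split=> h; first by have [] : inv z y by apply/parP.
  by have /parP[[]] : inv z y by [].
have py : proot (- y) by split=> //; apply: rootN.
have sNy : spanned P (- y) by apply: spannedN.
have flip (v : W) : nonneg (- ac v^-1 y) <-> ~ inv v (- y).
  have rv : root (ac v^-1 y) by apply: root_act.
  split=> [h [_]|h]; rewrite ?actN ?opprK.
    by move=> h'; apply: (root_neq0 rv); apply: nonneg0.
  by apply: root_signN => // h'; apply: h; split=> //; rewrite actN opprK.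
by rewrite !flip parP; split=> h; [move=> [/h]|move=> i; apply: h].
Qed.

End ParabolicPart.

(** * Orientations and ordered words *)

Section Orientation.
Context {W : groupType} {S : finType} {gen : S -> W}.
Context {R : realFieldType} {rho : georep gen R}.
Local Notation V := {ffun S -> R}.
Local Notation wp := (wprod gen).
Local Notation ac := (act rho).
Local Notation A := (bil (gram rho)).
Local Notation inv := (@inv W S gen R rho).
Local Notation wle := (@wle W S gen R rho).
Local Notation desc := (@desc W S gen).
Local Notation supported := (@supported W S gen R rho).
Implicit Types (s t : S) (l : seq S) (w : W) (x y b : V).
Local Notation span l := (spanned (fun i => i \in l)).
Local Notation euler := (@euler W S gen R rho).
Local Notation pi := (@pi W S gen).
Context {Omega : rel S} (orO : orientation gen Omega).

Definition ordered l := uniq l && pairwise (fun i j => ~~ Omega i j) l.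

Lemma Omega_irr s : Omega s s = false.
Proof. by apply/negP => h; case: orO => _ /(_ s s); apply. Qed.

Lemma Omega_asym s t : Omega s t -> Omega t s = false.
Proof. by move=> h; apply/negP => h'; case: orO => _ /(_ s t); apply. Qed.

Lemma gram_Omega s t : Omega s t -> gram rho s t <= -1.
Proof.
move=> h; have [e _] := orO; have [_ nc] := iffRL (e s t) (or_introl h).
have ne : s != t by apply: contraTneq h => ->; rewrite Omega_irr.
case/orP: (gram_off rho ne) => // /eqP /(gram_commute rho ne) //.
Qed.

Lemma gram_nOmega s t : s != t -> ~~ Omega s t -> ~~ Omega t s -> gram rho s t = 0.
Proof.
move=> ne n1 n2; apply/(gram_commute rho ne); apply: contrapT => nc.
have [e _] := orO; have [||] := iffLR (e s t) _; try by apply/negP.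
by split=> //; apply/eqP.
Qed.

Lemma ordered_uniq l : ordered l -> uniq l.
Proof. by case/andP. Qed.

Lemma ordered_consE s l :
  ordered (s :: l) = [&& s \notin l, all (fun i => ~~ Omega s i) l & ordered l].
Proof. by rewrite /ordered /= -!andbA; do !bool_congr. Qed.

Lemma ordered_filter P l : ordered l -> ordered (filter P l).
Proof. by move=> /andP[u p]; rewrite /ordered filter_uniq //= pairwise_filter. Qed.

Lemma ordered_cat l1 l2 : ordered (l1 ++ l2) -> ordered l1 /\ ordered l2.
Proof.
rewrite /ordered cat_uniq pairwise_cat => /andP[/and3P[-> _ ->] /and3P[_ -> ->]] //.
Qed.

Lemma ordered_index l : ordered l -> forall s t, s \in l -> t \in l -> Omega s t ->
  (index t l < index s l)%N.
Proof.
elim: l => // i l IH; rewrite ordered_consE => /and3P[al /allP na ol] s t.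
have ne k : k \in l -> (i == k) = false by move=> kl; apply: contraNF al => /eqP ->.
rewrite !inE => /orP[/eqP->|sl] /orP[/eqP->|tl] O /=.
- by rewrite Omega_irr in O.
- by rewrite (negPf (na _ tl)) in O.
- by rewrite eqxx ne.
- by rewrite !ne // ltnS; apply: IH.
Qed.

Lemma index_ordered l : uniq l -> (forall s t, s \in l -> t \in l -> Omega s t ->
  (index t l < index s l)%N) -> ordered l.
Proof.
elim: l => // i l IH /= /andP[al ul] h; rewrite ordered_consE al /=.
have ne k : k \in l -> (i == k) = false by move=> kl; apply: contraNF al => /eqP ->.
apply/andP; split.
  apply/allP => b bl; apply/negP => O.
  by have := h i b (mem_head _ _); rewrite inE bl orbT eqxx ltn0 => /(_ isT O).
apply: IH => // s t sl tl O; have := h s t.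
by rewrite !inE sl tl !orbT !ne // ltnS; apply.
Qed.

Lemma omega_orderingP (J : {set S}) l :
  omega_ordering Omega J l <-> ordered l /\ l =i J.
Proof.
split=> [[ul lJ h]|[ol lJ]].
  by split=> //; apply: index_ordered => // s t; rewrite !lJ; apply: h.
split=> //; first exact: ordered_uniq.
by move=> s t; rewrite -!lJ; apply: ordered_index.
Qed.

Lemma ordered_acyclic l p : ordered l -> {subset p <= l} -> cycle Omega p -> p = [::].
Proof.
elim: l p => [|s l IH] p; first by case: p => // a p _ /(_ a (mem_head _ _)).
rewrite ordered_consE => /and3P[sl /allP ns ol] pl cp; apply: IH => // i ip.
have := pl i ip; rewrite inE => /orP[/eqP e|//]; subst i.
have O := next_cycle cp ip.
have := pl (next p s); rewrite mem_next => /(_ ip); rewrite inE => /orP[/eqP e|h].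
  by move: O; rewrite e Omega_irr.
by move: O; rewrite (negPf (ns _ h)).
Qed.

(** Without a sink, choosing an outgoing edge everywhere gives a self-map of [J]; an orbit of it
    must close up into a directed cycle. *)
Lemma sink_ex (J : {set S}) : omega_acyclic Omega J -> J != finset.set0 ->
  exists2 s, s \in J & forall t, t \in J -> ~~ Omega s t.
Proof.
move=> act0 /set0Pn[x0 x0J]; apply: contrapT => nosink.
have nx s : s \in J -> exists t, (t \in J) && Omega s t.
  move=> sJ; apply: contrapT => h; apply: nosink; exists s => // t tJ.
  by apply/negP => O; apply: h; exists t; rewrite tJ.
pose f s := odflt s [pick t in J | Omega s t].
have fP s : s \in J -> (f s \in J) /\ Omega s (f s).
  move=> sJ; rewrite /f; case: pickP => [t /andP[]//|h].
  by have [t ht] := nx s sJ; rewrite h in ht.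
have iterJ n : iter n f x0 \in J by elim: n => //= n /fP[].
pose y := iter #|S| f x0.
have [m [n [mn e]]] : exists m n, (m < n)%N /\ iter m f x0 = iter n f x0.
  have : ~~ uniq (traject f x0 #|S|.+1).
    by apply/negP => /card_uniqP e; have := max_card (mem (traject f x0 #|S|.+1));
      rewrite e size_traject ltnn.
  move=> nu; apply: contrapT => h; move/negP: nu; apply.
  apply/(uniqP x0) => i j; rewrite !inE size_traject => li lj.
  rewrite !nth_traject // => e; case: (ltngtP i j) => // lt; case: h.
    by exists i, j.
  by exists j, i.
pose z := iter m f x0.
have zc : iter (n - m) f z = z by rewrite /z -iterD subnK ?e // ltnW.
have cyc : fcycle f (orbit f z).
  by apply/(orbitPcycle 3 0); exists (n - m).-1; rewrite prednK ?subn_gt0.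
have sub i : i \in orbit f z -> i \in J.
  by rewrite -fconnect_orbit => /iter_findex <-; rewrite /z -iterD; apply: iterJ.
have : orbit f z = [::].
  apply: act0; first exact: sub.
  rewrite /ucycle; apply/andP; split; last exact: orbit_uniq.
  apply: (sub_in_cycle (P := mem J)) cyc; last by apply/allP.
  by move=> i j iJ _ /eqP <-; case: (fP i iJ).
by move/eqP; rewrite -size_eq0 size_orbit; case: (order f z) (order_gt0 f z).
Qed.

Lemma ordering_ex (J : {set S}) : omega_acyclic Omega J ->
  exists2 l, ordered l & l =i J.
Proof.
have [n] := ubnP #|J|; elim: n J => // n IH J; rewrite ltnS => cJ aJ.
have [->|J0] := eqVneq J finset.set0; first by exists [::] => // i; rewrite finset.in_set0.
have [s sJ ns] := sink_ex aJ J0.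
have [||l ol lJ] := IH (J :\ s)%SET.
- by move: cJ; rewrite (cardsD1 s) sJ.
- by move=> p pJ; apply: aJ => i /pJ; rewrite in_setD1 => /andP[].
exists (s :: l); last first.
  by move=> i; rewrite inE lJ in_setD1; case: eqVneq => // ->; rewrite sJ.
rewrite ordered_consE lJ in_setD1 eqxx /= ol andbT; apply/allP => i.
by rewrite lJ in_setD1 => /andP[_ /ns].
Qed.

Lemma ordered_omega_acyclic (J : {set S}) l : ordered l -> {subset J <= l} ->
  omega_acyclic Omega J.
Proof.
move=> ol Jl p pJ /andP[cp _]; apply: ordered_acyclic ol _ cp.
by move=> i /pJ/Jl.
Qed.

Lemma commute_word s u : (forall i, i \in u -> commute (gen s) (gen i)) ->
  (wp u * gen s = gen s * wp u)%g.
Proof.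
elim: u => [|i u IH] h; first by rewrite wprod_nil mul1g mulg1.
rewrite wprod_cons -mulgA IH ?mulgA => [|j ju]; last by apply: h; rewrite inE ju orbT.
by rewrite (h i (mem_head _ _)).
Qed.

Lemma nOmega_commute s t : ~~ Omega s t -> ~~ Omega t s -> commute (gen s) (gen t).
Proof.
move=> n1 n2; have [->//|ne] := eqVneq s t.
by apply/(gram_commute rho ne); apply: gram_nOmega.
Qed.

Lemma ordered_wprod l1 l2 : ordered l1 -> ordered l2 -> l1 =i l2 -> wp l1 = wp l2.
Proof.
elim: l1 l2 => [|s l1 IH] l2.
  by move=> _ _ e; case: l2 e => // i l2 /(_ i); rewrite mem_head.
rewrite ordered_consE => /and3P[sl1 /allP ns o1] o2 e.
have s2 : s \in l2 by rewrite -e mem_head.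
case/splitPr: s2 o2 e => p q o2 e.
have u2 := ordered_uniq o2.
have [sp sq] : s \notin p /\ s \notin q.
  by move: u2; rewrite cat_uniq /= negb_or -!andbA => /and5P[_ sp _ sq _].
have fs k : s \notin k -> filter (predC1 s) k = k.
  by move=> sk; apply/all_filterP/allP => i ik /=; apply: contraNneq sk => <-.
have o2' : ordered (p ++ q).
  have := ordered_filter (predC1 s) o2.
  by rewrite filter_cat /= eqxx !fs.
rewrite wprod_cat !wprod_cons mulgA commute_word => [|i ip].
  rewrite -mulgA -wprod_cat; congr (_ * _)%g; apply: IH => // i.
  have := e i; rewrite mem_cat !inE mem_cat; have [->|ne] := eqVneq i s => //= _.
  by rewrite (negPf sl1) (negPf sp) (negPf sq).
have is1 : i \in l1.
  have := e i; rewrite mem_cat ip /= inE; case: eqVneq => // es.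
  by move: sp; rewrite -es ip.
apply: nOmega_commute; first exact: ns.
move: o2; rewrite /ordered pairwise_cat => /andP[_ /andP[/allrelP h _]].
by apply: h => //; rewrite mem_head.
Qed.

Lemma cox_eltE (J : {set S}) l : ordered l -> l =i J -> cox_elt gen Omega J = wp l.
Proof.
move=> ol lJ; pose X := [set c | exists2 u, omega_ordering Omega J u & c = wp u]%classic.
have : X (cox_elt gen Omega J).
  by apply: xgetPex; exists (wp l), l => //; apply/omega_orderingP.
move=> [u /omega_orderingP[ou uJ] ->]; apply: ordered_wprod => // i.
by rewrite uJ lJ.
Qed.

Definition below l w := ordered l /\ wle (wp l) w.

Lemma acyclic_belowP w (J : {set S}) :
  acyclic_below gen Omega w J <-> exists2 l, l =i J & below l w.
Proof.
split=> [[aJ /(weak_leP (rho := rho)) le]|[l lJ [ol le]]].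
  by have [l ol lJ] := ordering_ex aJ; exists l => //; split=> //; rewrite -(cox_eltE ol lJ).
split; first by apply: ordered_omega_acyclic ol _ => i; rewrite lJ.
by apply/(weak_leP (rho := rho)); rewrite (cox_eltE ol lJ).
Qed.

Lemma wprod_supported l : supported (fun i => i \in l) (wp l).
Proof. by apply: supported_wprod; apply/allP. Qed.

Lemma wprod_cons_desc s l : s \notin l -> desc s (wp (s :: l)).
Proof.
move=> sl; rewrite wprod_cons desc_flip; apply: (supported_ndesc sl).
exact: wprod_supported.
Qed.

Lemma wle_wprod_cons s l w : s \notin l -> wle (wp (s :: l)) w <->
  desc s w /\ wle (wp l) (gen s * w)%g.
Proof.
move=> sl; have d := wprod_cons_desc sl; split=> [le|[dw le]].
  have dw := wle_desc le d; split=> //.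
  by rewrite -(genK s (wp l)) -wprod_cons; apply: wle_gen; rewrite ?d.
rewrite wprod_cons; apply: wle_gen_desc => //.
by move: d; rewrite wprod_cons desc_flip.
Qed.

(** A root [b] without [s]-coefficient pairs nonpositively with [simple s], so its reflection adds a
    nonnegative multiple of [simple s]: a combination of two inversions of [w]. *)
Lemma wle_wprod_gen s l w : s \notin l -> desc s w -> wle (wp l) w ->
  wle (wp l) (gen s * w)%g.
Proof.
move=> sl d le b ib; have sb := wprod_supported ib; have pb := inv_proot ib.
have ne : b <> simple s.
  by move=> e; have := sb s sl; rewrite e simple_id => /eqP; rewrite oner_eq0.
apply/inv_genl => //.
have [_ n1] := le b ib; have /(descP (rho := rho))[_ n2] := d.
apply: (inv_comb (p := 1) (q := - A (simple s) b) _ _ _ _ n1 n2) => //.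
- exact: proot_gen.
- by rewrite act_gen; apply/ffunP=> i; rewrite !vE; ring.
rewrite oppr_ge0 bil_simplel; apply: sumr_le0 => j _.
have [->|js] := eqVneq j s; first by rewrite (sb s sl) mulr0.
by have [_ /(_ j) b0] := pb; rewrite mulr_le0_ge0 // gram_le0 // eq_sym.
Qed.

(** The first letter belongs to one of the two subwords and is thus a descent of [w]; the other
    subword, if it lacks the letter, stays below by [wle_wprod_gen]. *)
Lemma wle_wprod_cover l w (P Q : pred S) : uniq l -> all (fun i => P i || Q i) l ->
  wle (wp (filter P l)) w -> wle (wp (filter Q l)) w -> wle (wp l) w.
Proof.
elim: l w => [|s l IH] w; first by rewrite wprod_nil => *; apply: wle1.
move=> /= /andP[sl ul] /andP[PQ all_l].
have nf T : s \notin filter T l by rewrite mem_filter negb_and sl orbT.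
have step T : desc s w -> wle (wp (if T s then s :: filter T l else filter T l)) w ->
    wle (wp (filter T l)) (gen s * w)%g.
  by move=> d; case: ifP => _; [case/wle_wprod_cons|apply: wle_wprod_gen].
move=> h1 h2; have d : desc s w.
  by case/orP: PQ => e; [move: h1|move: h2]; rewrite e => /wle_wprod_cons[].
by apply/wle_wprod_cons => //; split=> //; apply: IH => //; apply: step.
Qed.

(* [P] selects the letters that the recursion takes while it reads [l] once. *)
Lemma pi_first_pass l q w : uniq (l ++ q) -> exists P : pred S,
  [/\ pi (l ++ q) w =
       (wp (filter P l) * pi (q ++ filter P l) ((wp (filter P l))^-1 * w))%g,
     wle (wp (filter P l)) w &
     forall Q, wle (wp (filter Q l)) w -> {subset filter Q l <= filter P l}].
Proof.
elim: l q w => [|s l IH] q w.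
  by exists xpredT; split=> //=; [rewrite wprod_nil invg1 !mul1g cats0|rewrite wprod_nil; apply: wle1].
rewrite cat_cons => /= /andP[slq ulq].
have [sl sq] : s \notin l /\ s \notin q by move: slq; rewrite mem_cat negb_or => /andP.
have nf T : s \notin filter T l by rewrite mem_filter negb_and sl orbT.
have [d|d] := boolP (desc s w).
  have uq : uniq (l ++ rcons q s).
    by rewrite -rcons_cat rcons_uniq slq.
  have [P [e le max]] := IH (rcons q s) (gen s * w)%g uq.
  exists (predU1 s P); rewrite /= eqxx /=.
  have eP : filter (predU1 s P) l = filter P l.
    by apply: eq_in_filter => i il /=; case: eqVneq => // ei; move: sl; rewrite -ei il.
  rewrite !eP; split.
  - by rewrite pi_take // rcons_cat e wprod_cons invgM gen_inv cat_rcons !mulgA.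
  - by apply/wle_wprod_cons.
  - move=> Q; case: ifP => _ h i.
      move/wle_wprod_cons: h => /(_ (nf Q))[_ /max h].
      by rewrite !inE => /orP[->//|/h ->]; rewrite orbT.
    by rewrite inE => /(max Q (wle_wprod_gen (nf Q) d h)) ->; rewrite orbT.
have [P [e le max]] := IH q w ulq.
exists (predD1 P s); rewrite /= eqxx /=.
have eP : filter (predD1 P s) l = filter P l.
  by apply: eq_in_filter => i il /=; case: eqVneq => // ei; move: sl; rewrite -ei il.
rewrite !eP; split=> //; first by rewrite pi_skip.
move=> Q; case: ifP => _ h; last exact: max.
by case/wle_wprod_cons: h => // dd; rewrite dd in d.
Qed.

(** The inversions of a product of distinct letters form the basis dual to the simple roots under
    the Euler form; [b] is [simple a] moved by the letters before [a]. *)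
Lemma wprod_root l a : uniq l -> a \in l -> exists b, [/\ inv (wp l) b, b a = 1 &
  forall x, span l x -> euler l b x = x a].
Proof.
elim: l => //= s l IH /andP[sl ul]; rewrite inE; have [-> _|ne /= al] := eqVneq a s.
  exists (simple s); split; first by apply/descP; apply: wprod_cons_desc.
    by rewrite simple_id.
  by move=> x _; rewrite euler_headl.
have [b [ib ba eb]] := IH ul al.
have sb := wprod_supported ib; have pb := inv_proot ib.
have nb : b <> simple s.
  by move=> e; have := sb s sl; rewrite e simple_id => /eqP; rewrite oner_eq0.
exists (ac (gen s) b); split; first by rewrite wprod_cons; apply/inv_gen.
  by rewrite act_genE.
move=> x sx; rewrite -euler_rot //; last exact/span_gen/span_tail.
rewrite act_genK; have [x' sx' ex] := span_split (span_gen sx).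
rewrite ex eulerDr eulerZr euler_lastr //; last exact/span_rcons/span_tail.
rewrite sb // mulr0 add0r euler_rcons // eb //.
by rewrite -(act_genE x ne) ex !vE (negPf ne) mulr0 add0r.
Qed.

(** The Euler form read off the orientation. It makes sense on sets with directed cycles, where no
    ordered word exists, and so can pair roots coming from two different words. *)
Definition omega_gram i j : R := if i == j then 1 else if Omega i j then gram rho i j else 0.
Local Notation T := (bil omega_gram).

Lemma omega_gram_euler l x y : ordered l -> span l x -> span l y -> euler l x y = T x y.
Proof.
move=> ol sx sy; apply: (eq_bil _ sx sy) => i j il jl; rewrite /euler_gram /omega_gram.
have [//|ne] := eqVneq i j; have [O|nO] := boolP (Omega i j).
  by rewrite (ordered_index ol).
case: ifP => // lt; apply: gram_nOmega => //; apply/negP => O.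
by have := ordered_index ol jl il O; rewrite ltnNge ltnW.
Qed.

Lemma omega_gram_sym x y : T x y + T y x = A x y.
Proof.
have -> : T y x = bil (fun i j => omega_gram j i) x y.
  by rewrite /bil exchange_big; apply: eq_bigr => i _; apply: eq_bigr => j _; ring.
have sT (z : V) : spanned xpredT z by move=> i.
rewrite (_ : _ + _ = bil (fun i j => omega_gram i j + omega_gram j i) x y).
  apply: (eq_bil _ (sT x) (sT y)) => i j _ _; rewrite /omega_gram (eq_sym j).
  have [->|ne] := eqVneq i j; first by rewrite gram_diag; lra.
  have [O|nO] := boolP (Omega i j); first by rewrite (Omega_asym O) addr0.
  have [O|nO'] := boolP (Omega j i); first by rewrite add0r gram_sym.
  by rewrite addr0 gram_nOmega.
rewrite /bil -big_split; apply: eq_bigr => i _; rewrite -big_split.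
by apply: eq_bigr => j _ /=; ring.
Qed.

Lemma omega_gram_le0 i j : i != j -> omega_gram i j <= 0.
Proof. by rewrite /omega_gram => /[dup] /gram_le0 h /negPf ->; case: ifP. Qed.

Lemma omega_gram_simple_le x f c : nonneg x -> x c = 0 -> Omega f c -> T x (simple c) <= - x f.
Proof.
move=> x0 xc O; rewrite bil_simpler (bigD1 f) //=.
have ne : f != c by apply: contraTneq O => ->; rewrite Omega_irr.
have h1 : omega_gram f c <= -1 by rewrite /omega_gram (negPf ne) O gram_Omega.
have h2 : \sum_(i | i != f) omega_gram i c * x i <= 0.
  apply: sumr_le0 => i _; have [->|ni] := eqVneq i c; first by rewrite xc mulr0.
  by rewrite mulr_le0_ge0 ?omega_gram_le0.
by have := ler_wpM2r (x0 f) h1; move: h2; lra.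
Qed.

Lemma omega_gram_simple_le0 x c : nonneg x -> x c = 0 -> T x (simple c) <= 0.
Proof.
move=> x0 xc; rewrite bil_simpler; apply: sumr_le0 => i _.
have [->|ni] := eqVneq i c; first by rewrite xc mulr0.
by rewrite mulr_le0_ge0 ?omega_gram_le0.
Qed.

(** Duality expresses the coefficient of [b] at a vertex as a sum over incoming edges with weights
    at least 1, so coefficients never decrease along edges. *)
Lemma path_coef (P : pred S) b a p : nonneg b ->
  (forall j, P j -> T b (simple j) = (j == a)%:R) ->
  path Omega a p -> P a -> all P p -> 1 <= b (last a p).
Proof.
move=> b0 hb; have step i j : P j -> Omega i j -> b i <= b j.
  move=> Pj O; have := hb j Pj; rewrite bil_simpler.
  have ne : i != j by apply: contraTneq O => ->; rewrite Omega_irr.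
  rewrite (bigD1 i) //= (bigD1 j) /=; last by rewrite eq_sym.
  have h1 : omega_gram i j <= -1 by rewrite /omega_gram (negPf ne) O gram_Omega.
  have h2 : \sum_(k | (k != i) && (k != j)) omega_gram k j * b k <= 0.
    by apply: sumr_le0 => k /andP[_ kj]; rewrite mulr_le0_ge0 ?omega_gram_le0.
  have h3 : omega_gram j j = 1 by rewrite /omega_gram eqxx.
  have := ler_wpM2r (b0 i) h1; have : 0 <= (j == a)%:R :> R by rewrite ler0n.
  by rewrite h3; move: h2; lra.
move=> pp Pa Pp; have ba : 1 <= b a.
  have := hb a Pa; rewrite eqxx bil_simpler (bigD1 a) //=.
  have h2 : \sum_(k | k != a) omega_gram k a * b k <= 0.
    by apply: sumr_le0 => k ka; rewrite mulr_le0_ge0 ?omega_gram_le0.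
  by rewrite /omega_gram eqxx; lra.
elim: p a pp {Pa} ba Pp {hb} => //= c p IH a /andP[O pp] ba /andP[Pc Pp].
by apply: IH => //; apply: le_trans ba _; apply: step.
Qed.

End Orientation.

(** * The largest acyclic set below an element, and [pi_down] *)

Section Support.
Context {W : groupType} {S : finType} {gen : S -> W}.
Context {R : realFieldType} {rho : georep gen R}.
Local Notation V := {ffun S -> R}.
Local Notation len := (cox_length gen).
Local Notation wp := (wprod gen).
Local Notation ac := (act rho).
Local Notation A := (bil (gram rho)).
Local Notation root := (@root W S gen R rho).
Local Notation proot := (@proot W S gen R rho).
Local Notation inv := (@inv W S gen R rho).
Local Notation wle := (@wle W S gen R rho).
Local Notation supported := (@supported W S gen R rho).
Implicit Types (s t : S) (l : seq S) (w : W) (x y b : V).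
Local Notation span l := (spanned (fun i => i \in l)).
Local Notation euler := (@euler W S gen R rho).
Local Notation pi := (@pi W S gen).
Context {Omega : rel S} (orO : orientation gen Omega).
Local Notation ordered := (@ordered S Omega).
Local Notation below := (@below W S gen R rho Omega).
Local Notation T := (bil (@omega_gram W S gen R rho Omega)).

Lemma inv_finite w : exists L : seq V, forall b, inv w b -> b \in L.
Proof.
have [n] := ubnP (len w); elim: n w => // n IH w; rewrite ltnS => lw.
have [->|/len_pred[s dw]] := pselect (w = 1%g); first by exists [::] => b /inv1.
have [|L hL] := IH (gen s * w)%g; first exact: leq_trans dw lw.
exists (simple s :: [seq ac (gen s) b | b <- L]) => b ib; have pb := inv_proot ib.
rewrite inE; have [//|/eqP ne] := eqVneq b (simple s).
by apply/mapP; exists (ac (gen s) b); rewrite ?act_genK //; apply: hL; apply/inv_gen.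
Qed.

Lemma root_reflect b c : root b -> root c -> root (c - scal (A b c) b).
Proof.
move=> [v [s ->]] rc; have : root (ac (v * gen s * v^-1)%g c) by apply: root_act.
congr root; rewrite !actM act_gen -form_actl actD actN actZ actVK //.
Qed.

(* Such [b] and [c] would span an infinite dihedral subsystem, all of whose
   infinitely many positive roots are inversions. *)
Lemma inv_not_obtuse w b c : inv w b -> inv w c -> A b c <= -2 -> False.
Proof.
move=> ib ic hA; pose k := - A b c; have k2 : 2 <= k by rewrite /k; lra.
have [L hL] := inv_finite w.
(* Each step reflects the previous vector in the current root and changes sign. With [k] at least 2
   the recurrence keeps coefficients growing, so positivity persists, and the same holds after
   applying the inverse of [w] and negating. *)
pose u := fix u n : V * V := if n is n'.+1 then
  let: (x, y) := u n' in (y, scal k y - x) else (- b, c).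
have grow (f g : nat -> R) : f 0%N <= 0 -> 0 <= g 0%N ->
    (forall n, f n.+1 = g n) -> (forall n, g n.+1 = k * g n - f n) ->
    forall n, f n <= g n /\ 0 <= g n.
  move=> f0 g0 fS gS; elim=> [|n [IH1 IH2]]; first by split=> //; apply: le_trans g0.
  by rewrite fS gS; split; nra.
have uS n : u n.+1 = ((u n).2, scal k (u n).2 - (u n).1) by rewrite /=; case: (u n).
have [[[rb b0] nb] [[rc c0] nc]] := (ib, ic).
have Ak n : A (u n).1 (u n).2 = - k * -1 /\ root (u n).1 /\ root (u n).2.
  elim: n => [|n [IHA [r1 r2]]].
    by rewrite /= bilNl /k; split; [ring|split=> //; apply: rootN].
  rewrite uS /=; split; last split=> //.
    by rewrite !bilE form_root // (form_sym _ (u n).1) IHA; ring.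
  have -> : scal k (u n).2 - (u n).1 = - ((u n).1 - scal (A (u n).2 (u n).1) (u n).2).
    by rewrite form_sym IHA; apply/ffunP=> i; rewrite !vE; ring.
  by apply: rootN; apply: root_reflect.
have iu n : inv w (u n).2.
  split; first split; first by case: (Ak n) => _ [].
    move=> i; have [||||_ h] := grow (fun n => (u n).1 i) (fun n => (u n).2 i) _ _ _ _ n.
    - by rewrite /= vE; have := b0 i; lra.
    - exact: c0.
    - by move=> m; rewrite uS.
    - by move=> m; rewrite uS /= !vE.
    - by [].
  move=> i; have [||||_ h] := grow (fun n => - ac w^-1 (u n).1 i) (fun n => - ac w^-1 (u n).2 i) _ _ _ _ n.
  - by rewrite /= actN !vE; have := nb i; rewrite !vE; lra.
  - by have := nc i; rewrite vE.
  - by move=> m; rewrite uS.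
  - by move=> m; rewrite uS /= actD actN actZ !vE; ring.
  - by rewrite vE.
pose h (x : V) := \sum_i x i.
have hpos x : proot x -> 0 < h x.
  move=> [rx x0]; rewrite lt_def sumr_ge0 ?andbT //; apply/eqP => e.
  apply: (root_neq0 rx); apply/ffunP=> i; rewrite vE.
  by have /eqP := e; rewrite psumr_eq0 // => /allP/(_ i (mem_index_enum i))/eqP.
have hS n : h (u n.+1).2 = k * h (u n).2 - h (u n).1.
  rewrite uS /= /h mulr_sumr -sumrB; apply: eq_bigr => i _.
  by rewrite !vE.
have inc n : h (u n).1 < h (u n).2.
  elim: n => [|n IH].
    have := hpos b (conj rb b0); have := hpos c (conj rc c0); rewrite /=.
    have -> : h (- b) = - h b by rewrite /h -sumrN; apply: eq_bigr => i _; rewrite vE.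
    by lra.
  have := hpos _ (inv_proot (iu n)); rewrite hS uS /=; nra.
have mono m n : (m < n)%N -> h (u m).2 < h (u n).2.
  elim: n => // n IH; rewrite ltnS leq_eqVlt => /orP[/eqP->|/IH lt].
    by have := inc n.+1; rewrite {1}uS.
  by apply: lt_trans lt _; have := inc n.+1; rewrite {1}uS.
have inj : injective (fun n => (u n).2).
  move=> m n e; case: (ltngtP m n) => // /mono; first by rewrite e ltxx.
  by rewrite e ltxx.
have : (size (map (fun n => (u n).2) (iota 0 (size L).+1)) <= size L)%N.
  apply: uniq_leq_size; first by rewrite map_inj_uniq ?iota_uniq.
  by move=> _ /mapP[n _ ->]; apply: hL.
by rewrite size_map size_iota ltnn.
Qed.

Lemma bil_expandr (G : S -> S -> R) x y : bil G x y = \sum_j y j * bil G x (simple j).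
Proof.
rewrite /bil exchange_big; apply: eq_bigr => j _; rewrite -/(bil _ _ _) bil_simpler mulr_sumr.
by apply: eq_bigr => i _; ring.
Qed.

Lemma first_out (l p : seq S) : ~~ all (fun i => i \in l) p ->
  exists p1 c p2, [/\ p = p1 ++ c :: p2, all (fun i => i \in l) p1 & c \notin l].
Proof.
elim: p => //= i p IH; have [il /= /IH[p1 [c [p2 [-> h1 h2]]]]|il _] := boolP (i \in l).
  by exists (i :: p1), c, p2; split; rewrite //= il.
by exists [::], i, p.
Qed.

(** A cycle passes through [r], as [k] is ordered, and leaves [l], as [l] is ordered. Let [c] be its
    first letter after [r] outside [l]: the roots dual to [r] in [l] and to [c] in [k] are then too
    obtuse to be inversions of one element. *)
Lemma below_acyclic k l r w : ordered k -> ordered l -> r \in l -> r \notin k ->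
  {subset l <= r :: k} -> wle (wp k) w -> wle (wp l) w ->
  forall p, {subset p <= r :: k} -> ucycle Omega p -> p = [::].
Proof.
move=> ok ol rl rk lk wk wl p pk ucp.
have [rp|rp] := boolP (r \in p); last first.
  case/andP: ucp => cp _; apply: (ordered_acyclic orO ok) _ cp => i ip.
  have := pk i ip; rewrite inE => /orP[/eqP e|//].
  by move: rp; rewrite -e ip.
have [i p' ep] := rot_to rp.
have : ucycle Omega (r :: p') by rewrite -ep rot_ucycle.
move=> /andP[/= cp /andP[rp' up']].
have pk' j : j \in p' -> j \in k.
  move=> jp; have : j \in r :: k by apply: pk; rewrite -(mem_rot i) ep inE jp orbT.
  rewrite inE => /orP[/eqP e|//]; by move: rp'; rewrite -e jp.
have [all_l|/first_out[p1 [c [p2 [e p1l cl]]]]] := boolP (all (fun i => i \in l) p').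
  have : r :: p' = [::].
    apply: (ordered_acyclic orO ol) => // j; rewrite inE => /orP[/eqP->//|].
    exact: (allP all_l).
  by [].
exfalso; move: cp; rewrite e rcons_cat cat_path /= rcons_path => /and4P[pp1 O1 pp2 O2].
have ck : c \in k by apply: pk'; rewrite e mem_cat mem_head orbT.
have p2k : all (fun i => i \in k) p2.
  by apply/allP => j jp; apply: pk'; rewrite e mem_cat inE jp !orbT.
have [b1 [ib1 b1r eb1]] := wprod_root (rho := rho) (ordered_uniq ol) rl.
have [b2 [ib2 b2c eb2]] := wprod_root (rho := rho) (ordered_uniq ok) ck.
have [_ b1p] := inv_proot ib1; have [_ b2p] := inv_proot ib2.
have s1 := wprod_supported ib1; have s2 := wprod_supported ib2.
have T1 j : j \in l -> T b1 (simple j) = (j == r)%:R.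
  have sj : j \in l -> span l (simple j : V) by move=> jl; apply: spanned_simple.
  by move=> jl; rewrite -(omega_gram_euler orO ol) ?eb1 ?simpleE 1?eq_sym //; apply: sj.
have T2 j : j \in k -> T b2 (simple j) = (j == c)%:R.
  have sj : j \in k -> span k (simple j : V) by move=> jl; apply: spanned_simple.
  by move=> jl; rewrite -(omega_gram_euler orO ok) ?eb2 ?simpleE 1?eq_sym //; apply: sj.
have f1 := path_coef orO (P := fun i => i \in l) b1p T1 pp1 rl p1l.
have f2 := path_coef orO (P := fun i => i \in k) b2p T2 pp2 ck p2k.
have t1 := omega_gram_simple_le (rho := rho) orO b1p (s1 c cl) O1.
have t2 := omega_gram_simple_le (rho := rho) orO b2p (s2 r rk) O2.
(* The arc from [r] leads out of [l] at [c], and the arc from [c] leads out of [k] at [r]; by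
   [path_coef] each exit contributes at most -1, and no other term is positive. *)
have h1 : T b1 b2 <= -1.
  rewrite bil_expandr (bigD1 c) //= b2c mul1r.
  suff : \sum_(j | j != c) b2 j * T b1 (simple j) <= 0 by lra.
  apply: sumr_le0 => j jc; have [jl|jl] := boolP (j \in l).
    rewrite T1 //; case: eqVneq => [->|_]; last by rewrite mulr0.
    by rewrite (s2 r rk) mul0r.
  by rewrite mulr_ge0_le0 //; apply: (omega_gram_simple_le0 b1p); apply: s1.
have h2 : T b2 b1 <= -1.
  rewrite bil_expandr (bigD1 r) //= b1r mul1r.
  suff : \sum_(j | j != r) b1 j * T b2 (simple j) <= 0 by lra.
  apply: sumr_le0 => j jr; have [jk|jk] := boolP (j \in k).
    rewrite T2 //; case: eqVneq => [->|_]; last by rewrite mulr0.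
    by rewrite (s1 c cl) mul0r.
  by rewrite mulr_ge0_le0 //; apply: (omega_gram_simple_le0 b2p); apply: s2.
apply: (inv_not_obtuse (wl _ ib1) (wk _ ib2)).
by rewrite -(omega_gram_sym orO); lra.
Qed.

Lemma wprod_rcons_le l r : r \notin l -> wle (wp l) (wp (rcons l r)).
Proof.
move=> rl; rewrite -cats1 wprod_cat wprod_cons wprod_nil mulg1; apply: wle_mulr.
apply: root_signP; first exact/root_act/root_simple.
move=> /(_ r); rewrite vE (supported_act _ (wprod_supported (rho := rho) (l := l))) //.
by rewrite simple_id; lra.
Qed.

(** Letters of [l1] join [l2] one by one, so only one new letter at a time can close a cycle, the
    situation of [below_acyclic]. *)
Lemma below_union l1 l2 w : below l1 w -> below l2 w ->
  exists2 m, below m w & m =i l1 ++ l2.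
Proof.
elim/last_ind: l1 => [|l1 r IH] [o1 w1] [o2 w2]; first by exists l2.
have [ol1 _] : ordered l1 /\ ordered [:: r] by apply: ordered_cat; rewrite cats1.
have u1 := ordered_uniq o1; have rl1 : r \notin l1 by move: u1; rewrite rcons_uniq => /andP[].
have [||k [ok wk] ek] := IH.
- by split=> //; apply: wle_trans w1; apply: wprod_rcons_le.
- by [].
have [rk|rk] := boolP (r \in k).
  exists k => // i; rewrite ek !mem_cat mem_rcons inE.
  by case: eqVneq => // ->; rewrite -mem_cat -ek rk.
have sub : {subset rcons l1 r <= r :: k}.
  by move=> i; rewrite mem_rcons !inE ek mem_cat => /orP[->//|->]; rewrite !orbT.
have ac_rk : omega_acyclic Omega [set i in r :: k]%SET.
  move=> p pJ; apply: (below_acyclic ok o1 _ rk sub wk w1); first by rewrite mem_rcons mem_head.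
  by move=> i /pJ; rewrite finset.in_set.
have [m om em'] := ordering_ex ac_rk.
have {em'}em : m =i r :: k by move=> i; rewrite em' finset.in_set.
exists m; last by move=> i; rewrite em inE ek !mem_cat mem_rcons inE orbA.
split=> //; apply: (wle_wprod_cover (P := fun i => i \in rcons l1 r) (Q := fun i => i \in k)).
- exact: ordered_uniq om.
- by apply/allP => i; rewrite em mem_rcons !inE => /orP[->//|->]; rewrite !orbT.
- have -> // : wp (filter (fun i => i \in rcons l1 r) m) = wp (rcons l1 r).
  apply: (ordered_wprod (rho := rho) orO) => //; first exact: ordered_filter.
  by move=> i; rewrite mem_filter em andb_idr // => /sub.
- have -> // : wp (filter (fun i => i \in k) m) = wp k.
  apply: (ordered_wprod (rho := rho) orO) => //; first exact: ordered_filter.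
  by move=> i; rewrite mem_filter em inE andb_idr // => ->; rewrite orbT.
Qed.

Lemma omega_supportP w : exists l, [/\ l =i omega_support gen Omega w, below l w &
  forall k, below k w -> {subset k <= l}].
Proof.
pose X (J : {set S}) := `[< acyclic_below gen Omega w J >].
have X0 : X finset.set0.
  apply/asboolP/(acyclic_belowP orO (rho := rho)); exists [::] => [i|].
    by rewrite finset.in_set0.
  by split=> //; rewrite wprod_nil; apply: wle1.
pose Y := [set J | acyclic_below gen Omega w J /\
  forall K : {set S}, acyclic_below gen Omega w K -> J \subset K -> K = J]%classic.
have : Y (omega_support gen Omega w).
  apply: xgetPex; case: (arg_maxnP (fun J : {set S} => #|J|) X0) => J /asboolP XJ maxJ.
  exists J; split=> // K aK JK; apply/esym/eqP; rewrite eqEcard JK.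
  by apply: maxJ; apply/asboolP.
move=> [/(acyclic_belowP orO (rho := rho))[l el bl] max].
exists l; split=> // k bk i ik.
have [m bm em] := below_union bk bl.
rewrite el; have <- : [set j in m]%SET = omega_support gen Omega w.
  apply: max.
    by apply/(acyclic_belowP orO (rho := rho)); exists m => // j; rewrite finset.in_set.
  by apply/fintype.subsetP => j; rewrite -el finset.in_set em mem_cat => ->; rewrite orbT.
by rewrite finset.in_set em mem_cat ik.
Qed.

Lemma below_supported k l w : below k w -> supported (fun i => i \in l) w -> {subset k <= l}.
Proof.
move=> [ok le] sw i ik.
have [b [ib bi _]] := wprod_root (rho := rho) (ordered_uniq ok) ik.
by apply/negPn/negP => /(sw b (le b ib)); rewrite bi => /eqP; rewrite oner_eq0.
Qed.

(** One call of [pi_down_rec] matches one reading of the word by [pi]. The word need only contain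
    every [k] below [w], which lets one word serve for all elements below a given one. *)
Lemma pi_downE_aux n w l : (len w <= n)%N -> ordered l ->
  (forall k, below k w -> {subset k <= l}) ->
  pi_down_rec gen Omega n w = pi l w.
Proof.
have pi1 l' : uniq l' -> 1%g = pi l' 1%g.
  by move=> ul; apply: (wle_anti (rho := rho)); [apply: wle1|apply: pi_le].
elim: n w l => [|n IH] w l lw ol max; have ul := ordered_uniq ol.
  have -> : w = 1%g by apply: (len_eq0 (gen := gen)); apply/eqP; rewrite -leqn0.
  exact: pi1.
rewrite /=; case: eqP => [->|w1]; first exact: pi1.
set J := omega_support gen Omega w.
have [lJ [eJ [oJ wJ] maxJ]] := omega_supportP w; rewrite -/J in eJ.
have := @pi_first_pass W S gen R rho l [::] w; rewrite !cats0 => /(_ ul).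
move=> [P [e le maxP]]; set l1 := filter P l in e le maxP.
have ol1 : ordered l1 by apply: ordered_filter.
have ul1 := ordered_uniq ol1.
(* The first reading takes the largest subword of [l] with product below [w], and [l] contains the
   support. *)
have e1 : l1 =i J.
  move=> i; rewrite -eJ; apply/idP/idP; first exact: maxJ.
  move=> iJ; apply: (maxP (fun j => j \in lJ)).
    have -> // : wp (filter (fun j => j \in lJ) l) = wp lJ.
    apply: (ordered_wprod (rho := rho) orO) => //; first exact: ordered_filter.
    by move=> j; rewrite mem_filter andb_idr //; apply: max.
  by rewrite mem_filter iJ; apply: (max lJ).
have [s ds] := len_pred w1.
have sl1 : s \in l1.
  rewrite e1 -eJ; apply: (maxJ [:: s]); last by rewrite mem_head.
  split; first by rewrite ordered_consE.
  by apply/wle_wprod_cons => //; split=> //; rewrite wprod_nil; apply: wle1.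
rewrite (cox_eltE (rho := rho) orO ol1 e1) e /= parabolic_partE.
have -> : par (rho := rho) (fun i => i \in J) w = par (rho := rho) (fun i => i \in l1) w.
  apply: (wle_anti (rho := rho)) => b /parP[ib sb]; apply/parP; split=> // i il; apply: sb.
    by rewrite -e1.
  by rewrite e1.
set x := par _ w; have xw : wle x w by apply: par_le.
have cx : wle (wp l1) x by apply: le_par => //; apply: wprod_supported.
have sx : supported (fun i => i \in l1) x by apply: par_supported.
congr (_ * _)%g.
(* [pi l1] sees only inversions in the span of [l1], and by [par_sign] these do not change when [w]
   is replaced by its parabolic part. *)
have -> : pi l1 ((wp l1)^-1 * w)%g = pi l1 ((wp l1)^-1 * x)%g.
  apply: (pi_ext (rho := rho)) => // b sb.
  have key : proot b -> (nonneg (- ac ((wp l1)^-1 * w)^-1%g b) <->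
      nonneg (- ac ((wp l1)^-1 * x)^-1%g b)).
    move=> [rb _]; rewrite !invgM !invgK !actM; apply: par_sign; first exact: root_act.
    exact: (supported_span (wprod_supported (l := l1))).
  by split=> -[pb h]; split=> //; apply/key.
apply: IH => //.
  have := wle_len cx; have := wle_leq xw.
  have : (0 < len (wp l1))%N.
    rewrite lt0n; apply/eqP => /(len_eq0 (gen := gen)) c1.
    have [b [ib _ _]] := wprod_root (rho := rho) ul1 sl1.
    by move: ib; rewrite c1 => /inv1.
  move=> c0 lx ec; rewrite -ltnS; apply: leq_trans lw; apply: leq_trans lx.
  by rewrite -ec -[X in (X < _)%N]add0n ltn_add2r.
move=> k bk; apply: (below_supported bk).
by apply: supportedM => //; apply: supportedV; apply: wprod_supported.
Qed.

Lemma pi_downE w l : ordered l -> (forall k, below k w -> {subset k <= l}) ->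
  pi_down gen Omega w = pi l w.
Proof. exact: pi_downE_aux. Qed.

Lemma below_le u w k : wle u w -> below k u -> below k w.
Proof. by move=> uw [ok ku]; split=> //; apply: wle_trans uw. Qed.

Lemma pi_down_support w : exists l, [/\ ordered l, l =i omega_support gen Omega w,
  forall k, below k w -> {subset k <= l} &
  forall u, wle u w -> pi_down gen Omega u = pi l u].
Proof.
have [l [el [ol wl] max]] := omega_supportP w; exists l; split=> // u uw.
by apply: pi_downE => // k bk; apply: max; apply: below_le bk.
Qed.

Lemma euler_ordered l l' x y : ordered l -> ordered l' -> span l x -> span l y ->
  span l' x -> span l' y -> euler l x y = euler l' x y.
Proof. by move=> *; rewrite !(omega_gram_euler orO). Qed.

Theorem pi_down_join (X : W -> Prop) j : isjoin (rho := rho) X j ->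
  isjoin (rho := rho) (fun y : W => exists2 a, X a & y = pi_down gen Omega a) (pi_down gen Omega j).
Proof.
move=> hj; have [l [ol _ _ el]] := pi_down_support j.
have [up least] := pi_join (ordered_uniq ol) hj; rewrite (el j); last exact: wle_refl.
have [uj _] := hj.
split=> [_ [a Xa ->]|y hy]; first by rewrite (el a (uj a Xa)); apply: up; exists a.
by apply: least => _ [a Xa ->]; rewrite -(el a (uj a Xa)); apply: hy; exists a.
Qed.

Lemma pi_down_mono u w : wle u w -> wle (pi_down gen Omega u) (pi_down gen Omega w).
Proof.
move=> uw; have [l [ol _ _ el]] := pi_down_support w.
by rewrite !el //; apply: pi_mono => //; apply: ordered_uniq ol.
Qed.

(** The meet [x] of the images is below [m], since [pi_down] is decreasing; by monotonicity it only
    remains to see that [x] is fixed. *)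
Theorem pi_down_meet (X : W -> Prop) a0 m : X a0 -> ismeet (rho := rho) X m ->
  ismeet (rho := rho) (fun y : W => exists2 a, X a & y = pi_down gen Omega a) (pi_down gen Omega m).
Proof.
move=> X0 [lo gr]; split=> [_ [a Xa ->]|y hy]; first by apply: pi_down_mono; apply: lo.
have [|x [xlo xgr]] := @meet_ex W S gen R rho
    (fun y : W => exists2 a, X a & y = pi_down gen Omega a) (pi_down gen Omega a0).
  by exists a0.
apply: (wle_trans (v := x)); first exact: xgr.
have pd_le a : wle (pi_down gen Omega a) a.
  have [l [ol _ _ ->]] := pi_down_support a; last exact: wle_refl.
  exact/pi_le/(ordered_uniq ol).
have xm : wle x m.
  by apply: gr => a Xa; apply: wle_trans (pd_le a); apply: xlo; exists a.
suff <- : pi_down gen Omega x = x by apply: pi_down_mono.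
have [l0 [ol0 el0 _ _]] := pi_down_support a0.
(* Each image is supported on its own word, so [x] is supported on the letters common to all of
   them; [pi_restrict] then moves the images to this common word. *)
pose P i := `[< forall a, X a -> i \in omega_support gen Omega a >].
set l := filter P l0.
have ol : ordered l by apply: ordered_filter.
have ul := ordered_uniq ol.
have ml i : i \in l = P i.
  by rewrite mem_filter andb_idr // => /asboolP/(_ a0 X0); rewrite -el0.
have sx : supported (fun i => i \in l) x.
  move=> b ib i; rewrite ml => /asboolP h; apply: contrapT => bi; apply: h => a Xa.
  have [la [ola ela _ ea]] := pi_down_support a.
  rewrite -ela; apply/negPn/negP => ni; apply: bi.
  have : inv (pi la a) b.
    by rewrite -ea; [apply: (xlo _ _ b ib); exists a|exact: wle_refl].
  by move/(pi_supported (ordered_uniq ola)); apply.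
rewrite (pi_downE ol); last by move=> k bk; apply: below_supported bk sx.
apply: (sortable_meet (X := fun y : W => exists2 a, X a & y = pi l (pi_down gen Omega a))
   (a0 := pi l (pi_down gen Omega a0)) (rho := rho)) => //.
- by exists a0.
- by move=> _ [a _ ->]; rewrite (pi_idem (rho := rho)).
split=> [_ [a Xa ->] b ib|z hz].
  have [la [ola ela _ ea]] := pi_down_support a.
  have ula := ordered_uniq ola.
  have lla : {subset l <= la} by move=> i; rewrite ml ela => /asboolP; apply.
  apply: (pi_restrict ula ul lla) => //.
  - move=> c d sc sd; rewrite !omegaE.
    have sc' : span la c by apply: spannedS sc => i /lla.
    have sd' : span la d by apply: spannedS sd => i /lla.
    by rewrite (euler_ordered ol ola) // (euler_ordered ol ola).
  - by rewrite ea ?(pi_idem (rho := rho)) //; apply: wle_refl.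
  - by apply: (xlo _ _ b ib); exists a.
  - exact: sx.
apply: xgr => _ [a Xa ->]; apply: wle_trans (pi_le (w := pi_down gen Omega a) ul).
by apply: hz; exists a.
Qed.

End Support.

(** * The theorem *)

Section Angles.
Local Open Scope ring_scope.
Local Notation Rr := (Rdefinitions.R : realFieldType).

Definition dihedral_angle (m : nat) : Rr := 2 * cos (PI / m%:R : Rr).

Lemma cheb_sin (a : Rr) n : cheb (2 * cos a) n * sin a = sin (n%:R * a).
Proof.
suff : cheb (2 * cos a) n * sin a = sin (n%:R * a) /\
  cheb (2 * cos a) n.+1 * sin a = sin (n.+1%:R * a) by case.
elim: n => [|n [IH1 IH2]]; first by rewrite /= !mul0r sin_0 !mul1r.
split=> //; rewrite chebSS mulrBl -mulrA IH2 IH1.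
have -> : n.+2%:R * a = n.+1%:R * a + a :> Rr by rewrite -natr1; ring.
have -> : n%:R * a = n.+1%:R * a - a :> Rr by rewrite -[n.+1%:R]natr1; ring.
by have := sin_plus (n.+1%:R * a) a; have := sin_minus (n.+1%:R * a) a;
  rewrite ?RplusE ?RminusE ?RmultE => -> ->; ring.
Qed.

(** By [cheb_sin] the values are quotients of sin(n pi/m) by the positive sin(pi/m), so their signs
    are those of the sine on the interval from 0 to pi. *)
Lemma dihedral_angleP m : (1 < m)%N -> chebyshev_zero m (dihedral_angle m).
Proof.
move=> m1; have m0 : 0 < m%:R :> Rr by rewrite ltr0n ltnW.
have pi0 : 0 < (PI : Rr) by apply/RltP/PI_RGT_0.
pose a : Rr := PI / m%:R.
have sin_pos (x : Rr) : 0 < x -> x < PI -> 0 < (sin x : Rr).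
  by move=> /RltP h1 /RltP h2; apply/RltP/sin_gt_0.
have a0 : 0 < a by apply: divr_gt0.
have lt_pi n : (n < m)%N -> n%:R * a < PI.
  by move=> nm; rewrite /a mulrCA gtr_pMr // ltr_pdivrMr // mul1r ltr_nat.
have sa : 0 < (sin a : Rr) by apply: sin_pos => //; have := lt_pi 1%N m1; rewrite mul1r.
split=> [|n /andP[n0 nm]].
  have := cheb_sin a m; rewrite {2}/a mulrCA divff ?mulr1 ?gt_eqF // sin_PI => /eqP.
  by rewrite mulf_eq0 (gt_eqF sa) orbF => /eqP.
by rewrite -(pmulr_lgt0 _ sa) cheb_sin; apply: sin_pos; rewrite ?lt_pi // mulr_gt0 // ltr0n.
Qed.
End Angles.

Local Close Scope ring_scope.
Local Open Scope classical_set_scope.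

Theorem theorem1p6 (W : groupType) (S : finType) (gen : S -> W)
    (coxW : coxeter_system gen) (Omega : rel S) (orOmega : orientation gen Omega) :
  (forall A : set W, A !=set0 ->
     exists m : W, is_meet gen A m /\
       is_meet gen (pi_down gen Omega @` A) (pi_down gen Omega m)) /\
  (forall (A : set W) (j : W), is_join gen A j ->
     is_join gen (pi_down gen Omega @` A) (pi_down gen Omega j)).
Proof.
pose rho := cox_georep (coxW := coxW) dihedral_angleP.
have img (A : set W) : (fun y => exists2 a, A a & y = pi_down gen Omega a) =
    (pi_down gen Omega @` A).
  by apply/funext => y; apply/propext; split=> -[a Aa e]; exists a.
have meetP (A : set W) m : ismeet (rho := rho) A m <-> is_meet gen A m.
  by split=> -[lo gr]; split=> [a /lo/(weak_leP (rho := rho))//|x hx];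
    apply/(weak_leP (rho := rho))/gr => a /hx/(weak_leP (rho := rho)).
have joinP (A : set W) m : isjoin (rho := rho) A m <-> is_join gen A m.
  by split=> -[lo gr]; split=> [a /lo/(weak_leP (rho := rho))//|x hx];
    apply/(weak_leP (rho := rho))/gr => a /hx/(weak_leP (rho := rho)).
split=> [A [a0 Aa0]|A j /joinP hj].
  have [m hm] := @meet_ex W S gen _ rho A a0 Aa0.
  exists m; split; first exact/meetP.
  by apply/meetP; rewrite -img; apply: pi_down_meet Aa0 hm.
by apply/joinP; rewrite -img; apply: pi_down_join hj.
Qed.
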